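(* Let $n\ge 2$. The following four statements are equivalent: (i) $W_0^{1,1}(\mathbb{R}^n)\subset L^{n/(n-1),\infty}(\mathbb{R}^n)$ continuously, i.e. there is $c>0$ with $\sup_{t>0} t\,|\{x\in\mathbb{R}^n: |f(x)|>t\}|^{(n-1)/n}\le c\int_{\mathbb{R}^n}|\nabla f(x)|\,dx$ for all $f\in W_0^{1,1}(\mathbb{R}^n)$. (ii) There is a constant $c>0$ such that for all $f\in C_0^\infty(\mathbb{R}^n)$ and all $t>0$, $$\int_0^t s^{-1/n}\,[f^{**}(s)-f^{*}(s)]\,ds\le c\,n\int_0^t |\nabla f|^{*}(s)\,ds .$$ (iii) For every rearrangement invariant space $X$ with lower Boyd index $\alpha_X>0$ there is a constant $C=C(n,X)>0$ such that for all $f\in C_0^\infty(\mathbb{R}^n)$, $$\big\| s^{-1/n}(f^{**}(s)-f^{*}(s))\big\|_X\le C\,\big\| |\nabla f|\big\|_X .$$ (iv) $W_0^{1,1}(\mathbb{R}^n)\subset L^{n/(n-1),1}(\mathbb{R}^n)$ continuously, i.e. there is $c>0$ with $\|f\|_{L^{n/(n-1),1}}\le c\int_{\mathbb{R}^n}|\nabla f|\,dx$ for all $f\in W_0^{1,1}(\mathbb{R}^n)$.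
   Context: For a measurable $f$ on $\mathbb{R}^n$, $f^*$ denotes the non-increasing rearrangement of $|f|$ on $(0,\infty)$ and $f^{**}(t)=\frac1t\int_0^t f^*(s)\,ds$. $|E|$ is Lebesgue measure. $\|f\|_{L^{n/(n-1),1}}=\int_0^\infty f^{**}(s)s^{1-1/n}\frac{ds}{s}$. A rearrangement invariant (r.i.) space $X$ is a Banach function space (with the Fatou property) such that $f^*=g^*$ and $g\in X$ imply $f\in X$ and $\|f\|_X=\|g\|_X$; it is identified with a space of functions on $(0,\infty)$ via $\|f\|_X=\|f^*\|_X$. With $h_X(s)=\sup_{f\in X}\|f^*(\cdot/s)\|_X/\|f^*\|_X$ the norm of the dilation operator, the lower Boyd index is $\alpha_X=\sup_{s<1}\ln h_X(s)/\ln s$. *)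

(* Defs.v *)
From HB Require Import structures.
From mathcomp Require Import all_boot all_order all_algebra.
From mathcomp Require Import all_classical all_reals all_analysis.
From mathcomp Require Import measurable_realfun.
Set Implicit Arguments. Unset Strict Implicit. Unset Printing Implicit Defensive.
Import Order.TTheory GRing.Theory Num.Theory.
Import numFieldNormedType.Exports.
Local Open Scope classical_set_scope.
Local Open Scope ring_scope.

Section Defs.
Variable R : realType.

Fixpoint iint (n : nat) : (n.-tuple R -> \bar R) -> \bar R :=
  match n as m return (m.-tuple R -> \bar R) -> \bar R with
  | 0 => fun F => F [tuple]
  | m.+1 => fun F =>
      (\int[@lebesgue_measure R]_x iint (fun t => F (cons_tuple x t)))%E
  end.

Definition row_of_tuple n (t : n.-tuple R) : 'rV[R]_n := \row_i tnth t i.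

Definition intRn n (f : 'rV[R]_n -> \bar R) : \bar R :=
  iint (fun t => f (row_of_tuple t)).

Definition lebRn n (A : set 'rV[R]_n) : \bar R :=
  intRn (fun x => (\1_A x : R)%:E).

(* Borel measurability on R^n (product sigma-algebra on tuples) *)
Definition borelRn n (f : 'rV[R]_n -> R) : Prop :=
  measurable_fun [set: n.-tuple R] (fun t => f (row_of_tuple t)).

Definition evec n (i : 'I_n) : 'rV[R]_n := delta_mx 0 i.

Definition pderiv n (i : 'I_n) (f : 'rV[R]_n -> R) : 'rV[R]_n -> R :=
  fun x => 'D_(evec i) f x.

Definition iter_pderiv n (s : seq 'I_n) (f : 'rV[R]_n -> R) :=
  foldr (@pderiv n) f s.

Definition smooth n (f : 'rV[R]_n -> R) : Prop :=
  forall s : seq 'I_n,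
    continuous (iter_pderiv s f) /\
    forall (i : 'I_n) (x : 'rV[R]_n), derivable (iter_pderiv s f) x (evec i).

Definition Cc_infty n (f : 'rV[R]_n -> R) : Prop :=
  smooth f /\ compact (closure [set x | f x != 0]).

Definition grad_norm n (f : 'rV[R]_n -> R) : 'rV[R]_n -> R :=
  fun x => Num.sqrt (\sum_(i < n) (pderiv i f x) ^+ 2).

(* W011 f g : f belongs to W_0^{1,1}(R^n) with (weak) gradient g = (g_i)_i,
   i.e. there are phi_k in C_c^infty with phi_k -> f and d_i phi_k -> g_i in L^1. *)
Definition W011 n (f : 'rV[R]_n -> R) (g : 'I_n -> 'rV[R]_n -> R) : Prop :=
  borelRn f /\ (forall i, borelRn (g i)) /\
  exists phi : nat -> 'rV[R]_n -> R,
    (forall k, Cc_infty (phi k)) /\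
    ((fun k => intRn (fun x => `|phi k x - f x|%:E)) @ \oo --> 0%E) /\
    (forall i, (fun k => intRn (fun x => `|pderiv i (phi k) x - g i x|%:E))
                 @ \oo --> 0%E).

Definition vec_norm n (g : 'I_n -> 'rV[R]_n -> R) : 'rV[R]_n -> R :=
  fun x => Num.sqrt (\sum_(i < n) (g i x) ^+ 2).

Definition distrib T (m : set T -> \bar R) (f : T -> \bar R) (t : R) : \bar R :=
  m [set x | (t%:E < `|f x|)%E].

Definition rearr T (m : set T -> \bar R) (f : T -> \bar R) (s : R) : \bar R :=
  ereal_inf [set t%:E | t in [set t : R | 0 <= t /\ (distrib m f t <= s%:E)%E]].

Definition mean_fun (h : R -> \bar R) (t : R) : \bar R :=
  ((t^-1)%:E * \int[@lebesgue_measure R]_(s in `]0%R, t]) h s)%E.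

Definition rstar n (f : 'rV[R]_n -> R) : R -> \bar R :=
  rearr (@lebRn n) (fun x => (f x)%:E).

Definition rstarstar n (f : 'rV[R]_n -> R) : R -> \bar R := mean_fun (rstar f).

Definition leb_pos (A : set R) : \bar R :=
  @lebesgue_measure R (A `&` `]0, +oo[).

Definition rstar_pos (h : R -> \bar R) : R -> \bar R := rearr leb_pos h.

Definition lorentz_norm n (f : 'rV[R]_n -> R) : \bar R :=
  (\int[@lebesgue_measure R]_(s in `]0%R, +oo[)
     (rstarstar f s * ((s `^ (1 - n%:R^-1)) / s)%:E))%E.

Definition pos_itv : set R := `]0, +oo[.

Definition Mplus (f : R -> \bar R) : Prop :=
  measurable_fun pos_itv f /\ forall s, 0 < s -> (0 <= f s)%E.

Definition ae_pos (P : R -> Prop) : Prop :=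
  {ae @lebesgue_measure R, forall s, pos_itv s -> P s}.

(* rho is a rearrangement invariant Banach function norm (with the Fatou
   property) on (0,oo) with Lebesgue measure (Bennett--Sharpley, Def. I.1.1
   and II.4.1) *)
Definition ri_norm (rho : (R -> \bar R) -> \bar R) : Prop :=
  (forall f, Mplus f -> (0 <= rho f)%E) /\
  (forall f, Mplus f -> (rho f = 0%E <-> ae_pos (fun s => f s = 0%E))) /\
  (forall f (a : R), Mplus f -> 0 <= a ->
      rho (fun s => a%:E * f s)%E = (a%:E * rho f)%E) /\
  (forall f g, Mplus f -> Mplus g ->
      (rho (fun s => f s + g s) <= rho f + rho g)%E) /\
  (forall f g, Mplus f -> Mplus g -> ae_pos (fun s => (g s <= f s)%E) ->
      (rho g <= rho f)%E) /\
  (forall (fk : nat -> R -> \bar R) f, (forall k, Mplus (fk k)) -> Mplus f ->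
      ae_pos (fun s => (forall k, (fk k s <= fk k.+1 s)%E) /\
                        (fun k => fk k s) @ \oo --> f s) ->
      (fun k => rho (fk k)) @ \oo --> rho f) /\
  (forall E, measurable E -> E `<=` pos_itv ->
      (@lebesgue_measure R E < +oo)%E -> (rho (fun s => (\1_E s : R)%:E) < +oo)%E) /\
  (forall E, measurable E -> E `<=` pos_itv -> (@lebesgue_measure R E < +oo)%E ->
      exists CE : R, 0 <= CE /\
        forall f, Mplus f ->
          (\int[@lebesgue_measure R]_(s in E) f s <= CE%:E * rho f)%E) /\
  (forall f g, Mplus f -> Mplus g -> rstar_pos f = rstar_pos g -> rho f = rho g).

Definition dilation_norm (rho : (R -> \bar R) -> \bar R) (s : R) : \bar R :=
  ereal_sup [set (rho (fun t => rstar_pos f (t / s)) * (fine (rho (rstar_pos f)))^-1%:E)%E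
            | f in [set f | Mplus f /\ (0 < rho (rstar_pos f) < +oo)%E]].

Definition lower_boyd (rho : (R -> \bar R) -> \bar R) : \bar R :=
  ereal_sup [set (ln (fine (dilation_norm rho s)) / ln s)%:E | s in `]0, 1[].

End Defs.

Section Statements.
Local Open Scope ereal_scope.
Variables (R : realType) (n : nat).

Definition stmt_i : Prop :=
  exists c : R, (0 < c)%R /\
    forall (f : 'rV[R]_n -> R) (g : 'I_n -> 'rV[R]_n -> R), W011 f g ->
      forall t : R, (0 < t)%R ->
        t%:E * (distrib (@lebRn R n) (fun x => (f x)%:E) t)
                   `^ ((n%:R - 1) / n%:R)%R
        <= c%:E * intRn (fun x => (vec_norm g x)%:E).

Definition stmt_ii : Prop :=
  exists c : R, (0 < c)%R /\
    forall f : 'rV[R]_n -> R, Cc_infty f ->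
      forall t : R, (0 < t)%R ->
        \int[@lebesgue_measure R]_(s in `]0%R, t])
           ((s `^ (- n%:R^-1))%:E * (rstarstar f s - rstar f s))
        <= (c * n%:R)%:E *
           \int[@lebesgue_measure R]_(s in `]0%R, t]) rstar (grad_norm f) s.

Definition stmt_iii : Prop :=
  forall rho : (R -> \bar R) -> \bar R, ri_norm rho -> 0 < lower_boyd rho ->
    exists C : R, (0 < C)%R /\
      forall f : 'rV[R]_n -> R, Cc_infty f ->
        rho (fun s => (s `^ (- n%:R^-1))%:E * (rstarstar f s - rstar f s))
        <= C%:E * rho (rstar (grad_norm f)).

Definition stmt_iv : Prop :=
  exists c : R, (0 < c)%R /\
    forall (f : 'rV[R]_n -> R) (g : 'I_n -> 'rV[R]_n -> R), W011 f g ->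
      lorentz_norm f <= c%:E * intRn (fun x => (vec_norm g x)%:E).

End Statements.

(* Main.v *)
(** The implications are proved in a cycle. Throughout, lambda is the distribution
    function of f and q = 1/n.
    (i) => (ii): the weak inequality is applied to smooth truncations of f between
    consecutive levels; summing over a fine partition gives Maz'ya's inequality
    int_a^oo lambda^(1-q) <= 2c int_{|f| > a} |grad f|. By Tonelli the left-hand
    side of (ii) is an integral over levels, bounded by n int_a^oo lambda^(1-q)
    with a = f^*(t).
    (ii) => (iii): alpha_X > 0 provides a dilation of norm < 1, so that the
    dilation series S of |grad f|^* is bounded in X. As s (f^** - f^* ) is
    nondecreasing, F = s^(-q) (f^** - f^* ) is dominated by a decreasing function
    whose integrals over (0,t] are at most a multiple of those of S, and the
    Hardy--Littlewood--Polya principle concludes.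
    (iii) => (iv): take X = L^1. The Lorentz norm is the integral of
    s^(-q) (f^** - f^* ) plus that of s^(-q) f^*, and Tonelli bounds the latter by
    8 times the former; f^* is lower semicontinuous under L^1 convergence, so
    Fatou's lemma passes from C_c^infty to W_0^{1,1}.
    (iv) => (i): f^* >= t on (0, lambda(t)). *)
Require Import Defs.
From HB Require Import structures.
From mathcomp Require Import all_boot all_order all_algebra perm.
From mathcomp Require Import all_classical all_reals all_analysis.
From mathcomp Require Import measurable_realfun ring lra.
Set Implicit Arguments. Unset Strict Implicit. Unset Printing Implicit Defensive.
Import Order.TTheory GRing.Theory Num.Theory.
Import numFieldNormedType.Exports.
Local Open Scope classical_set_scope.
Local Open Scope ring_scope.

(** * Rearrangements and distribution functions *)

(** The truncations must themselves be of class C_c^infty, since (i) is applied to them and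
    membership in W_0^{1,1} is defined by approximation. They are built from softplus functions of
    steepness K. Their slopes leak into neighbouring levels, but the sum over levels telescopes and
    the excess is O(1/K), which disappears for large K while the partition stays fixed.
    Rearrangements are handled through distribution functions: [distr_like] isolates the properties
    used, and s times f^** - f^* becomes the integral of lambda over the levels where lambda <= s
    ([tail]). Positivity and monotonicity are then visible, and the exponent 1 - 1/n comes from
    integrating s^(-1/n-1) from lambda(y) on. In (ii) => (iii) the norm is known only by its axioms,
    so the Hardy--Littlewood--Polya principle is derived from them: on equal cells the norm is a
    symmetric convex function of the values, hence monotone under majorization, and the Fatou
    property gives the limit. The first cell, where the dominating function may blow up, costs a
    second copy of its norm. *)

Section Scaling.
Local Open Scope ereal_scope.
Context {R : realType}.
Local Notation mu := (@lebesgue_measure R).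

(** The image of Lebesgue measure under x -> c x, multiplied by c, agrees with Lebesgue measure on
    half-open intervals, hence everywhere. *)
Lemma ge0_integral_scale (c : R) (f : R -> \bar R) : (0 < c)%R ->
  measurable_fun [set: R] f -> (forall x, 0 <= f x) ->
  \int[mu]_x f (c * x)%R = (c^-1)%:E * \int[mu]_x f x.
Proof.
move=> c0 mf f0.
pose phi : R -> measurableTypeR R :=  *%R c.
have mc : measurable_fun [set: R] phi by exact: mulrl_measurable.
have := @ge0_integral_pushforward _ _ (measurableTypeR R) (measurableTypeR R) R
  phi mc mu setT f measurableT mf (fun x _ => f0 x).
rewrite preimage_setT/= => <-.
have [pm pmE] : exists m : {measure set (measurableTypeR R) -> \bar R},
    m = pushforward mu phi :> (set _ -> _).
  by unshelve eexists (pushforward mu phi).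
pose nu := mscale (NngNum (ltW c0)) pm.
have nuE A : nu A = c%:E * mu (phi @^-1` A) by rewrite /nu /mscale/= pmE.
have E : forall A, measurable A -> mu A = nu A.
  apply: lebesgue_measure_unique => _ [[a b]] _ <-.
  rewrite -[RHS]/(nu _) nuE/=.
  have -> : phi @^-1` `]a, b] = `](a / c)%R, (b / c)%R]%classic.
    apply/seteqP; split=> x /=; rewrite !in_itv/= ltr_pdivrMr// ler_pdivlMr//;
    by rewrite (mulrC x).
  rewrite !lebesgue_measure_itv/= !lte_fin ltr_pM2r ?invr_gt0//.
  case: ifPn; last by rewrite mule0.
  by move=> ab; rewrite -!EFinD -EFinM -mulrBl mulrC divfK ?gt_eqF.
have -> : \int[mu]_x f x = \int[nu]_x f x.
  by apply: eq_measure_integral => A mA _; exact: E.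
rewrite ge0_integral_mscale//= muleA -EFinM mulVf ?gt_eqF// mul1e.
by apply: eq_measure_integral => A mA _; rewrite pmE.
Qed.

Lemma ge0_integral_itv_scale (c t : R) (f : R -> \bar R) : (0 < c)%R ->
  measurable_fun `]0%R, t] f -> (forall x, (0 < x)%R -> 0 <= f x) ->
  \int[mu]_(x in `]0%R, (t / c)%R]) f (c * x)%R = (c^-1)%:E * \int[mu]_(x in `]0%R, t]) f x.
Proof.
move=> c0 mf f0.
rewrite [LHS]integral_mkcond [in RHS]integral_mkcond -ge0_integral_scale//.
- apply: eq_integral => x _; rewrite !patchE !mem_setE !in_itv/=.
  by rewrite pmulr_rgt0// ler_pdivlMr// (mulrC x).
- exact/(measurable_restrictT _ _).1.
- move=> x; rewrite patchE; case: ifPn => //.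
  by rewrite inE/= in_itv/= => /andP[x0 _]; exact: f0.
Qed.

Lemma ge0_integral_pos_scale (c : R) (f : R -> \bar R) : (0 < c)%R ->
  measurable_fun (@pos_itv R) f -> (forall x, (0 < x)%R -> 0 <= f x) ->
  \int[mu]_(x in @pos_itv R) f (c * x)%R = (c^-1)%:E * \int[mu]_(x in @pos_itv R) f x.
Proof.
move=> c0 mf f0.
rewrite [LHS]integral_mkcond [in RHS]integral_mkcond -ge0_integral_scale//.
- apply: eq_integral => x _; rewrite !patchE !mem_setE !in_itv/= !andbT.
  by rewrite pmulr_rgt0.
- by apply/(measurable_restrictT _ _).1 => //; exact: measurable_itv.
- move=> x; rewrite patchE; case: ifPn => //.
  by rewrite inE /pos_itv/= in_itv/= => /andP[x0 _]; exact: f0.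
Qed.
End Scaling.

Section Rearrangement.
Local Open Scope ereal_scope.
Context {R : realType}.
Local Notation mu := (@lebesgue_measure R).

(* [l] plays the role of a distribution function. *)
Definition distr_like (l : R -> \bar R) :=
  (forall y, 0 <= l y) /\
  (forall y z, (y <= z)%R -> l z <= l y) /\
  (forall y s, s < l y -> exists2 z, (y < z)%R & s < l z).

Definition ginv (l : R -> \bar R) (s : R) : \bar R :=
  ereal_inf [set t%:E | t in [set t : R | (0 <= t)%R /\ l t <= s%:E]].

Lemma rearrE T (m : set T -> \bar R) (f : T -> \bar R) :
  rearr m f = ginv (distrib m f).
Proof. by []. Qed.

Lemma ginv_ge0 l s : 0 <= ginv l s.
Proof. by apply/ereal_infP => _ [t [t0 _] <-]; rewrite lee_fin. Qed.

Lemma eq_ginv l l' : (forall y, (0 <= y)%R -> l y = l' y) -> ginv l = ginv l'.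
Proof.
move=> ll'; apply/funext => s; congr ereal_inf; apply/seteqP.
by split=> _ [t [t0 lt] <-]; exists t => //; split => //; [rewrite -ll'|rewrite ll'].
Qed.

(** Right continuity, the third clause of [distr_like], makes the Galois connection between [l] and
    [ginv l] exact for strict inequalities. Superlevel sets of f^* are computed below by means of
    it. *)
Lemma ginv_gt l : distr_like l -> forall y s, (0 <= y)%R ->
  (y%:E < ginv l s) = (s%:E < l y).
Proof.
move=> [_ [lni lrc]] y s y0; apply/idP/idP => [ys|/lrc[z yz sz]].
  rewrite ltNge; apply/negP => lys; move: ys; rewrite ltNge => /negP; apply.
  by apply: ereal_inf_lbound; exists y.
apply: (@lt_le_trans _ _ z%:E); first by rewrite lte_fin.
apply/ereal_infP => _ [t [t0 lts] <-]; rewrite lee_fin leNgt.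
apply/negP => /ltW/lni; apply/negP; rewrite -ltNge.
exact: le_lt_trans sz.
Qed.

Lemma ginv_le l : distr_like l -> forall y s, (0 <= y)%R ->
  (ginv l s <= y%:E) = (l y <= s%:E).
Proof. by move=> dl y s y0; rewrite leNgt ginv_gt// -leNgt. Qed.

Lemma ginv_nonincreasing l s t : (s <= t)%R -> ginv l t <= ginv l s.
Proof.
move=> st; apply: ereal_inf_le_tmp => _ [y [y0 ly] <-]; exists y => //; split => //.
by rewrite (le_trans ly)// lee_fin.
Qed.

(** The intersection with [D] lets one statement serve both [leb_pos] and, with [D] the whole space,
    [lebRn]. *)
Lemma distr_like_distrib d (T : measurableType d) (m : {measure set T -> \bar R})
    (D : set T) (f : T -> \bar R) : measurable D -> measurable_fun D f ->
  distr_like (distrib (fun A => m (A `&` D)) f).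
Proof.
move=> mD mf; rewrite /distrib.
have mS y : measurable ([set x | y%:E < `|f x|] `&` D).
  rewrite setIC; apply: emeasurable_fun_o_infty => //.
  exact: measurableT_comp.
split=> [y|]; first exact: measure_ge0.
split=> [y z yz|y s sy].
  apply: le_measure; rewrite ?inE//; apply: setSI => x /=.
  by apply: le_lt_trans; rewrite lee_fin.
(* Right continuity: the superlevel set at y is the increasing union of those at y + 1/(k+1), so
   continuity from below applies even when the measures are infinite. *)
pose F k := [set x | (y + k.+1%:R^-1)%:E < `|f x|] `&` D.
have mF k : measurable (F k) by exact: mS.
have UF : \bigcup_k F k = [set x | y%:E < `|f x|] `&` D.
  apply/seteqP; split=> x.
    move=> [k _ []] /=; rewrite /F/= => fx Dx; split => //=.
    by apply: lt_trans fx; rewrite lte_fin ltrDl invr_gt0.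
  move=> [/= yf Dx].
  have [z yz zf] : exists2 z, (y < z)%R & z%:E <= `|f x|.
    move: yf; case: `|f x| => [r|_|//]; last by exists (y + 1)%R; rewrite ?ltrDl ?leey.
    by rewrite lte_fin => yr; exists r.
  have : (0 < z - y)%R by rewrite subr_gt0.
  move=> /ltr_add_invr[k]; rewrite add0r => kz.
  exists k => //; split=> //=; apply: lt_le_trans zf.
  by rewrite lte_fin addrC -ltrBrDr.
have ndF : nondecreasing_seq F.
  move=> i j ij; apply/subsetPset; apply: setSI => x/=; apply: le_lt_trans.
  by rewrite lee_fin lerD2l lef_pV2 ?posrE ?ler_nat.
have := @nondecreasing_cvg_mu _ _ _ m F mF.
rewrite UF => /(_ (mS y) ndF) mcv.
have [k sk] : exists k, s < m (F k).
  apply: contrapT => /forallNP H.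
  suff : m ([set x | y%:E < `|f x|] `&` D) <= s by rewrite leNgt sy.
  move/cvg_lim : (mcv) => <- //; apply: lime_le; first by apply/cvg_ex; eexists; exact: mcv.
  by apply: nearW => k /=; rewrite leNgt; apply/negP/H.
by exists (y + k.+1%:R^-1)%R => //; rewrite ltrDl invr_gt0.
Qed.

End Rearrangement.

(** * Integrals as integrals over levels *)

Section LayerCake.
Local Open Scope ereal_scope.
Context {R : realType}.
Local Notation mu := (@lebesgue_measure R).

(** Superlevel sets within an interval are again intervals. Nondecreasing functions are treated
    later through their opposites. *)
Lemma nonincreasing_emeasurable (u : R -> \bar R) (D : set R) :
  is_interval D -> (forall s t, D s -> D t -> (s <= t)%R -> u t <= u s) ->
  measurable_fun D u.
Proof.
move=> iD uni; have mD := is_interval_measurable iD.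
apply: (measurability _ (ErealGenOInfty.measurableE R)) => _ [_ [r ->] <-].
apply: is_interval_measurable => x y /= [Dx rx] [Dy ry] z /andP[xz zy].
have Dz : D z by apply: (iD x y) => //; rewrite xz.
split=> //; move: ry; rewrite /= !in_itv/= !andbT => ry.
by apply: lt_le_trans ry _; exact: uni.
Qed.

Lemma measurable_pos_itv : measurable (@pos_itv R).
Proof. exact: measurable_itv. Qed.

Lemma pos_itvE (x : R) : pos_itv x = (0 < x)%R :> Prop.
Proof. by rewrite /pos_itv/= in_itv/= andbT. Qed.

Lemma lebesgue_measure_itv_below (r : \bar R) : 0 <= r ->
  mu [set y : R | (0 < y)%R /\ y%:E < r] = r.
Proof.
case: r => [r| |//].
- rewrite lee_fin => r0.
  have -> : [set y | (0 < y)%R /\ y%:E < r%:E] = `]0%R, r[%classic.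
    by apply/seteqP; split => y /=; rewrite in_itv/= lte_fin; [move=> [-> ->]|move=> /andP[]].
  rewrite lebesgue_measure_itv/= lte_fin; case: ltgtP r0 => // [r0 _|<- _//].
  by rewrite oppr0 adde0.
- have -> : [set y | (0 < y)%R /\ y%:E < (+oo : \bar R)] = `]0%R, +oo[%classic.
    by apply/seteqP; split => y /=; rewrite in_itv/= andbT ltry; [case|].
  by rewrite lebesgue_measure_itv/= ltry.
Qed.

Lemma lebesgue_measure_itv0c (t : R) : (0 <= t)%R -> mu `]0%R, t] = t%:E.
Proof.
rewrite lebesgue_measure_itv/= lte_fin; case: ltgtP => // [t0 _|<- _//].
by rewrite oppr0 adde0.
Qed.

(** Tonelli for the indicator of the region under the graph, after extending [f] by zero outside
    [D]. *)
Lemma layer_cake d (T : measurableType d)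
    (m : {sigma_finite_measure set T -> \bar R}) (D : set T) (f : T -> \bar R) :
  measurable D -> measurable_fun D f -> (forall x, D x -> 0 <= f x) ->
  \int[m]_(x in D) f x =
  \int[mu]_(y in @pos_itv R) m (D `&` [set x | y%:E < f x]).
Proof.
move=> mD mf f0.
pose h := f \_ D.
have mh : measurable_fun setT h by apply/(measurable_restrictT f mD).1.
have h0 x : 0 <= h x.
  by rewrite /h patchE; case: ifPn => // /set_mem; exact: f0.
pose A := [set xy : T * R | (0 < xy.2)%R /\ xy.2%:E < h xy.1].
have mA : measurable A.
  have -> : A = (setT `&` [set xy | cst 0 xy < (xy.2)%:E]) `&`
                (setT `&` [set xy | (xy.2)%:E < h xy.1]).
    by rewrite /A; apply/seteqP; split=> -[x y]/=; rewrite lte_fin; tauto.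
  apply: measurableI; apply: measurable_lte => //.
  - by apply/measurable_EFinP; exact: measurable_snd.
  - by apply/measurable_EFinP; exact: measurable_snd.
  - by apply: measurableT_comp => //; exact: measurable_fst.
have mI : measurable_fun setT (fun xy => (\1_A xy : R)%:E).
  by apply/measurable_EFinP; exact: measurable_indic.
have := @fubini_tonelli _ _ _ _ R m mu (fun xy => (\1_A xy : R)%:E) mI.
move=> /(_ (fun _ => lee0n _)) H.
transitivity (\int[m]_x \int[mu]_y (\1_A (x, y) : R)%:E).
  rewrite integral_mkcond; apply: eq_integral => x _.
  rewrite -/h -[LHS](lebesgue_measure_itv_below (h0 x)).
  rewrite -(setIT [set y | _]) -integral_indic//; last first.
    have -> : [set y | (0 < y)%R /\ y%:E < h x] = xsection A x.
      by apply/seteqP; split => y; rewrite /xsection/= inE.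
    exact: measurable_xsection.
rewrite H [RHS]integral_mkcond; apply: eq_integral => y _.
rewrite patchE mem_setE in_itv/= andbT; case: ifPn => y0.
- rewrite -(setIT (_ `&` _)) -integral_indic//; last exact: emeasurable_fun_o_infty.
  apply: eq_integral => x _; congr (_%:E); rewrite !indicE.
  congr (nat_of_bool _)%:R; apply/idP/idP; rewrite !inE /A/= /h patchE.
  + move=> [_]; case: ifPn; first by rewrite inE.
    by rewrite lte_fin ltNge (ltW y0).
  + by move=> [Dx yf]; rewrite mem_set.
- apply: integral0_eq => x _; rewrite indicE memNset// /A/= => -[].
  by move/negP : y0.
Qed.

Lemma distr_like_measurable l : distr_like l -> measurable_fun (@pos_itv R) l.
Proof.
move=> [_ [lni _]]; apply: nonincreasing_emeasurable.
  exact: interval_is_interval.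
by move=> s t _ _; exact: lni.
Qed.

Lemma ginv_measurable l : measurable_fun (@pos_itv R) (ginv l).
Proof.
apply: nonincreasing_emeasurable; first exact: interval_is_interval.
by move=> s t _ _; exact: ginv_nonincreasing.
Qed.

(** At level y the part of (0,t] where [ginv l] exceeds y is an interval starting at 0, of length
    min(t, l y). *)
Lemma integral_ginv l (t : R) : distr_like l -> (0 <= t)%R ->
  \int[mu]_(s in `]0%R, t]) ginv l s =
  \int[mu]_(y in @pos_itv R) mine t%:E (l y).
Proof.
move=> dl t0; rewrite layer_cake//; last 2 first.
- apply: measurable_funS (ginv_measurable l) => //; first exact: measurable_pos_itv.
  by move=> x /=; rewrite /pos_itv/= !in_itv/= andbT => /andP[].
- by move=> s _; exact: ginv_ge0.
apply: eq_integral => y; rewrite inE pos_itvE => y0.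
have [ty|yt] := ltP t%:E (l y).
- have -> : `]0%R, t]%classic `&` [set x | y%:E < ginv l x] = `]0%R, t]%classic.
    apply/seteqP; split=> x/=; first by case.
    move=> xt; split=> //; move: xt; rewrite in_itv/= => /andP[x0 xt].
    by rewrite ginv_gt ?(ltW y0)//; apply: le_lt_trans ty; rewrite lee_fin.
  exact: lebesgue_measure_itv0c.
- rewrite -[RHS](lebesgue_measure_itv_below (dl.1 y)); congr (mu _).
  apply/seteqP; split=> x/=; rewrite in_itv/= ginv_gt ?(ltW y0)//.
    by move=> [/andP[-> _] ->].
  move=> [x0 xl]; rewrite x0; split => //=.
  by move: (lt_le_trans xl yt); rewrite lte_fin => /ltW.
Qed.

Lemma integral_pos_ginv l : distr_like l ->
  \int[mu]_(s in @pos_itv R) ginv l s = \int[mu]_(y in @pos_itv R) l y.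
Proof.
move=> dl; rewrite layer_cake//; last 3 first.
- exact: measurable_pos_itv.
- exact: ginv_measurable.
- by move=> s _; exact: ginv_ge0.
apply: eq_integral => y; rewrite inE pos_itvE => y0.
rewrite -[RHS](lebesgue_measure_itv_below (dl.1 y)); congr (mu _).
by apply/seteqP; split=> x/=; rewrite pos_itvE ginv_gt ?(ltW y0).
Qed.

End LayerCake.

(** * Lebesgue measure on R^n from iterated integrals *)

Section PackSigmaFinite.
Context d (T : measurableType d) (R : realType).
Variables (m : {measure set T -> \bar R}) (sf : sigma_finite setT m).

(** A copy of [m] that can carry the sigma-finite structure, so that the measure built in one
    dimension can enter the product giving the next. *)
Definition pack_sigma_finite of sigma_finite setT m : set T -> \bar R := m.
Local Notation p := (pack_sigma_finite sf).
HB.instance Definition _ := Measure.on p.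

Let p_sf : sigma_finite setT p := sf.
HB.instance Definition _ := @Measure_isSigmaFinite.Build _ _ _ p p_sf.

End PackSigmaFinite.

Section TupleMeasure.
Local Open Scope ereal_scope.
Context {R : realType}.
Local Notation mu := (@lebesgue_measure R).

Lemma sigma_finite_pushforward d1 d2 (X : measurableType d1)
    (Y : measurableType d2) (m : set X -> \bar R)
    (f : X -> Y) (g : Y -> X) : measurable_fun setT g -> cancel f g ->
  cancel g f -> sigma_finite setT m ->
  sigma_finite setT (pushforward m f).
Proof.
move=> mg fg gf [F TF Ffin].
exists (fun i => g @^-1` F i); first by rewrite -preimage_bigcup -TF.
move=> i; split; first by rewrite -[X in measurable X]setTI; apply: mg => //; apply: (Ffin i).1.
rewrite /pushforward; have -> : f @^-1` (g @^-1` F i) = F i.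
  by apply/seteqP; split => x /=; rewrite fg.
exact: (Ffin i).2.
Qed.

Lemma integral_eq_pushforward d1 d2 (X : measurableType d1)
    (Y : measurableType d2) (m : {measure set X -> \bar R})
    (p : {measure set Y -> \bar R}) (f : X -> Y) (F : Y -> \bar R) :
  measurable_fun setT f -> p = pushforward m f :> (set _ -> _) ->
  measurable_fun setT F -> (forall y, 0 <= F y) ->
  \int[p]_y F y = \int[m]_x F (f x).
Proof.
move=> mf pE mF F0.
have := ge0_integral_pushforward mf m measurableT mF (fun y _ => F0 y).
rewrite preimage_setT => <-.
by apply: eq_measure_integral => A mA _; rewrite [in LHS]pE.
Qed.

Lemma sigma_finite_product d1 d2 (T1 : measurableType d1)
    (T2 : measurableType d2) (m1 : {sigma_finite_measure set T1 -> \bar R})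
    (m2 : {sigma_finite_measure set T2 -> \bar R}) :
  sigma_finite setT (m1 \x m2).
Proof.
(* The exhaustions are taken increasing, so that the diagonal rectangles F_k x G_k already cover the
   product. *)
have /sigma_finiteP[F [TF ndF Foo]] := sigma_finiteT m1.
have /sigma_finiteP[G [TG ndG Goo]] := sigma_finiteT m2.
exists (fun k => F k `*` G k).
  rewrite -setXTT TF TG predeqE => -[x y]; split; last first.
    by move=> [k _ [? ?]]; split; exists k.
  move=> [/= [i _ Fx] [j _ Gy]]; exists (maxn i j) => //; split.
  - by move: x Fx; exact/subsetPset/ndF/leq_maxl.
  - by move: y Gy; exact/subsetPset/ndG/leq_maxr.
move=> k; have [mF Fk] := Foo k; have [mG Gk] := Goo k.
split; first exact: measurableX.
by rewrite product_measure1E// lte_mul_pinfty// ge0_fin_numE.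
Qed.

Let cons2 n (z : measurableTypeR R * n.-tuple R) : n.+1.-tuple R := cons_tuple z.1 z.2.
Let uncons2 n (t : n.+1.-tuple R) : measurableTypeR R * n.-tuple R := (thead t, [tuple of behead t]).

Let measurable_cons2 n : measurable_fun setT (@cons2 n).
Proof. by apply: measurable_cons; [exact: measurable_fst|exact: measurable_snd]. Qed.

Let measurable_uncons2 n : measurable_fun setT (@uncons2 n).
Proof.
apply/measurable_fun_pairP; split; [exact: measurable_tnth|exact: measurable_behead].
Qed.

Let cons2K n : cancel (@cons2 n) (@uncons2 n).
Proof. by move=> [x t]; rewrite /uncons2 theadE; congr (_, _); apply/val_inj. Qed.

Let uncons2K n : cancel (@uncons2 n) (@cons2 n).
Proof. by move=> t; rewrite /cons2/= [RHS]tuple_eta; apply/val_inj. Qed.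

(** Turns iterated integration into integration against a measure. By induction the measure is the
    image of mu x m under adjoining a first coordinate, and Tonelli identifies the two integrals. *)
Lemma iint_measure n : exists m : {sigma_finite_measure set (n.-tuple R) -> \bar R},
  forall F, measurable_fun setT F -> (forall t, 0 <= F t) ->
  iint F = \int[m]_t F t.
Proof.
elim: n => [|n [m mE]].
  exists (\d_([tuple] : 0.-tuple R)) => F mF F0; rewrite /=.
  by rewrite integral_dirac// diracT mul1e.
have [pm pmE] : exists p : {measure set (n.+1.-tuple R) -> \bar R},
    p = pushforward (mu \x m) (@cons2 n) :> (set _ -> _).
  by unshelve eexists (pushforward (mu \x m) (@cons2 n)) => //; exact: measurable_cons2.
have sf : sigma_finite setT pm.
  rewrite pmE; apply: (sigma_finite_pushforward (@measurable_uncons2 n));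
    [exact: cons2K|exact: uncons2K|have := (@sigma_finite_product _ _ _ _ mu m); exact].
exists (pack_sigma_finite sf) => F mF F0.
rewrite -[RHS]/(\int[pm]_t F t).
rewrite (integral_eq_pushforward (@measurable_cons2 n) pmE mF F0).
rewrite fubini_tonelli1//; last first.
  by apply: (measurableT_comp mF); exact: measurable_cons2.
rewrite -[LHS]/(\int[mu]_x iint (fun t => F (cons_tuple x t))).
apply: eq_integral => x _; rewrite /fubini_F mE//.
by apply: (measurableT_comp mF); apply: measurable_cons.
Qed.

End TupleMeasure.

Section TupleLebesgue.
Local Open Scope ereal_scope.
Context {R : realType}.
Local Notation mu := (@lebesgue_measure R).

(** Picked by choice: only its sigma-finiteness and [iintE] matter. *)
Definition tuple_leb n : {sigma_finite_measure set (n.-tuple R) -> \bar R} :=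
  projT1 (cid (@iint_measure R n)).

Lemma iintE n (F : n.-tuple R -> \bar R) : measurable_fun setT F ->
  (forall t, 0 <= F t) -> iint F = \int[tuple_leb n]_t F t.
Proof. exact: (projT2 (cid (@iint_measure R n))). Qed.

Lemma borel_EFin n (f : 'rV[R]_n -> R) : borelRn f ->
  measurable_fun setT (fun t : n.-tuple R => (f (row_of_tuple t))%:E).
Proof. by move=> bf; apply/measurable_EFinP. Qed.

Lemma intRnE n (f : 'rV[R]_n -> R) : borelRn f -> (forall x, 0 <= f x)%R ->
  intRn (fun x => (f x)%:E) = \int[tuple_leb n]_t (f (row_of_tuple t))%:E.
Proof.
move=> bf f0; rewrite /intRn iintE//; first exact: (borel_EFin bf).
by move=> t; rewrite lee_fin.
Qed.

Lemma lebRnE n (A : set 'rV[R]_n) : measurable ((@row_of_tuple R n) @^-1` A) ->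
  lebRn A = tuple_leb n ((@row_of_tuple R n) @^-1` A).
Proof.
move=> mA; rewrite /lebRn /intRn.
have -> : (fun t : n.-tuple R => (\1_A (row_of_tuple t) : R)%:E) =
          (fun t => (\1_((@row_of_tuple R n) @^-1` A) t : R)%:E).
  by apply/funext => t; rewrite !indicE; congr (nat_of_bool _)%:R%:E;
     apply/idP/idP; rewrite !inE.
rewrite iintE//; first by rewrite integral_indic// setIT.
by apply/measurable_EFinP; exact: measurable_indic.
Qed.

Lemma distrib_lebRnE n (f : 'rV[R]_n -> R) : borelRn f ->
  distrib (@lebRn R n) (fun x => (f x)%:E) =
  distrib (fun A => tuple_leb n (A `&` setT)) (fun t => (f (row_of_tuple t))%:E).
Proof.
move=> bf; apply/funext => y; rewrite /distrib setIT lebRnE//.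
rewrite -[X in measurable X]setTI.
apply: emeasurable_fun_o_infty => //; apply: measurableT_comp => //.
exact: (borel_EFin bf).
Qed.

Lemma distr_like_lebRn n (f : 'rV[R]_n -> R) : borelRn f ->
  distr_like (distrib (@lebRn R n) (fun x => (f x)%:E)).
Proof.
by move=> bf; rewrite distrib_lebRnE//; apply: distr_like_distrib => //; exact: (borel_EFin bf).
Qed.

Lemma integral_rstar n (f : 'rV[R]_n -> R) : borelRn f -> (forall x, 0 <= f x)%R ->
  \int[mu]_(s in @pos_itv R) rstar f s = intRn (fun x => (f x)%:E).
Proof.
move=> bf f0; rewrite /rstar rearrE integral_pos_ginv; last exact: distr_like_lebRn.
rewrite intRnE// [RHS]layer_cake//; last 2 first.
- exact: (borel_EFin bf).
- by move=> t _; rewrite lee_fin.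
rewrite distrib_lebRnE//; apply: eq_integral => y _.
by rewrite /distrib setIC; congr (tuple_leb n (_ `&` _)); apply/seteqP; split => t /=;
  rewrite ger0_norm.
Qed.

End TupleLebesgue.

(** * The oscillation f^** - f^* as an integral over levels *)

Section TailIntegral.
Local Open Scope ereal_scope.
Context {R : realType}.
Local Notation mu := (@lebesgue_measure R).
Implicit Types (l k h : R -> \bar R).

(** Any relation between s and y is encoded in the region [B]; this serves three double integrals,
    with different weights and regions. *)
Lemma tonelli_pos k h (B : set (R * R)) :
  measurable_fun (@pos_itv R) k -> measurable_fun (@pos_itv R) h ->
  (forall s, (0 < s)%R -> 0 <= k s) -> (forall s, (0 < s)%R -> 0 <= h s) ->
  measurable B ->
  \int[mu]_(s in @pos_itv R) (k s * \int[mu]_(y in @pos_itv R `&` xsection B s) h y) =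
  \int[mu]_(y in @pos_itv R) (h y * \int[mu]_(s in @pos_itv R `&` ysection B y) k s).
Proof.
move=> mk mh k0 h0 mB.
have mp := @measurable_pos_itv R.
pose K := k \_ (@pos_itv R); pose H := h \_ (@pos_itv R).
have mK : measurable_fun setT K by apply/(measurable_restrictT _ _).1 => //; exact: mp.
have mH : measurable_fun setT H by apply/(measurable_restrictT _ _).1 => //; exact: mp.
have K0 s : 0 <= K s.
  by rewrite /K patchE; case: ifPn => // /set_mem; rewrite pos_itvE => /k0.
have H0 s : 0 <= H s.
  by rewrite /H patchE; case: ifPn => // /set_mem; rewrite pos_itvE => /h0.
have mI : measurable_fun setT (fun xy => (\1_B xy : R)%:E).
  by apply/measurable_EFinP; exact: measurable_indic.
pose F (z : R * R) := K z.1 * (H z.2 * (\1_B z : R)%:E).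
have mF : measurable_fun setT F.
  apply: emeasurable_funM; first by apply: measurableT_comp => //; exact: measurable_fst.
  by apply: emeasurable_funM => //; apply: measurableT_comp => //; exact: measurable_snd.
have F0 z : 0 <= F z by rewrite !mule_ge0// lee_fin.
have E := fubini_tonelli (m1 := mu) (m2 := mu) F mF F0.
transitivity (\int[mu]_s \int[mu]_y F (s, y)).
  rewrite integral_mkcond; apply: eq_integral => s _.
  rewrite /F; cbn [fst snd]; rewrite ge0_integralZl; last 4 first.
  - exact: measurableT.
  - apply: emeasurable_funM; first exact: mH.
    exact: (measurableT_comp mI (measurable_pair1 s)).
  - by move=> y _; rewrite mule_ge0 ?H0// lee_fin.
  - exact: K0.
  rewrite !patchE; case: ifPn => [sp|]; last by rewrite /K patchE => /negbTE ->; rewrite mul0e.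
  rewrite /K patchE sp; congr (_ * _).
  rewrite [LHS]integral_mkcond; apply: eq_integral => y _.
  rewrite /H !patchE in_setI indicE mem_xsection; case: (y \in _) => /=; last by rewrite mul0e.
  by case: (_ \in B); rewrite /= ?mule1 ?mule0.
rewrite E [RHS]integral_mkcond; apply: eq_integral => y _.
transitivity (\int[mu]_s (H y * (K s * (\1_B (s, y) : R)%:E))).
  by apply: eq_integral => s _; rewrite /F; cbn [fst snd]; rewrite muleCA.
rewrite ge0_integralZl; last 4 first.
- exact: measurableT.
- apply: emeasurable_funM; first exact: mK.
  exact: (measurableT_comp mI (measurable_pair2 y)).
- by move=> s _; rewrite mule_ge0 ?K0// lee_fin.
- exact: H0.
rewrite !patchE; case: ifPn => [yp|]; last by rewrite /H patchE => /negbTE ->; rewrite mul0e.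
rewrite /H patchE yp; congr (_ * _).
rewrite [RHS]integral_mkcond; apply: eq_integral => s _.
rewrite /K !patchE in_setI indicE mem_ysection; case: (s \in _) => /=; last by rewrite mul0e.
by case: (_ \in B); rewrite /= ?mule1 ?mule0.
Qed.

(** By [mean_fun_sub] this is s times f^**(s) - f^*(s) when f^*(s) is finite. In this form it is
    visibly nonnegative and nondecreasing in s. *)
Definition tail l s := \int[mu]_(y in @pos_itv R `&` [set y | l y <= s%:E]) l y.

Lemma measurable_le_level l s : distr_like l ->
  measurable (@pos_itv R `&` [set y | l y <= s%:E]).
Proof.
move=> dl; apply: emeasurable_fun_infty_c; first exact: measurable_pos_itv.
exact: distr_like_measurable.
Qed.

Lemma measurable_gt_level l s : distr_like l ->
  measurable (@pos_itv R `&` [set y | s%:E < l y]).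
Proof.
move=> dl; apply: emeasurable_fun_o_infty; first exact: measurable_pos_itv.
exact: distr_like_measurable.
Qed.

Lemma tail_ge0 l s : distr_like l -> 0 <= tail l s.
Proof. by move=> dl; apply: integral_ge0 => y _; exact: dl.1. Qed.

Lemma tail_nondecreasing l s t : distr_like l -> (s <= t)%R -> tail l s <= tail l t.
Proof.
move=> dl st; apply: ge0_subset_integral; try exact: measurable_le_level.
- apply: measurable_funS (distr_like_measurable dl); first exact: measurable_pos_itv.
  exact: subIsetl.
- by move=> y _; exact: dl.1.
- by apply: setIS => y /= /le_trans; apply; rewrite lee_fin.
Qed.

(** Over levels, the integral of f^* on (0,s] is that of min(s, l y). The levels with l y > s are
    exactly those below f^*(s), and they contribute s f^*(s). *)
Lemma integral_ginv_tail l s : distr_like l -> (0 <= s)%R ->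
  \int[mu]_(u in `]0%R, s]) ginv l u = s%:E * ginv l s + tail l s.
Proof.
move=> dl s0; rewrite integral_ginv//.
have -> : @pos_itv R = (@pos_itv R `&` [set y | s%:E < l y]) `|`
                       (@pos_itv R `&` [set y | l y <= s%:E]).
  by rewrite -setIUr; apply/seteqP; split=> [y py|y []//]; split=> //=;
    case: (leP (l y) s%:E); [right|left].
have ml := distr_like_measurable dl.
rewrite ge0_integral_setU//; last 5 first.
- exact: measurable_gt_level.
- exact: measurable_le_level.
- rewrite -setIUr; apply: (@measurable_funS _ _ _ _ (@pos_itv R)) => //.
    exact: measurable_pos_itv.
  by apply: measurable_mine => //.
- by move=> y _; rewrite le_min lee_fin s0 dl.1.
- apply/disj_setPS => y [[_ /= sl] [_ /=]]; rewrite leNgt; exact/negP/negPn.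
congr (_ + _).
- transitivity (\int[mu]_(y in @pos_itv R `&` [set y | s%:E < l y]) s%:E).
    by apply: eq_integral => y; rewrite inE => -[_ /= sl]; rewrite min_l// ltW.
  rewrite integral_cst; last exact: measurable_gt_level.
  congr (_ * _); rewrite -[RHS](lebesgue_measure_itv_below (ginv_ge0 l s)).
  congr (mu _); apply/seteqP; split=> y /=.
    by rewrite pos_itvE => -[y0 sl]; rewrite y0 ginv_gt ?(ltW y0).
  by move=> [y0]; rewrite pos_itvE ginv_gt ?(ltW y0).
- by apply: eq_integral => y; rewrite inE => -[_ /= sl]; rewrite min_r.
Qed.

Lemma mean_fun_sub l s : distr_like l -> (0 < s)%R -> ginv l s \is a fin_num ->
  mean_fun (ginv l) s - ginv l s = (s^-1)%:E * tail l s.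
Proof.
move=> dl s0 gf; rewrite /mean_fun integral_ginv_tail ?(ltW s0)//.
rewrite ge0_muleDr ?tail_ge0//; last by rewrite mule_ge0 ?ginv_ge0// lee_fin ltW.
by rewrite muleA -EFinM mulVf ?gt_eqF// mul1e addeAC subee// add0e.
Qed.

End TailIntegral.

(** * From the Lorentz to the weak embedding *)

Section WeakFromLorentz.
Local Open Scope ereal_scope.
Context {R : realType}.
Local Notation mu := (@lebesgue_measure R).

Lemma powRN_nonincreasing (q s t : R) : (0 <= q)%R -> (0 < s)%R -> (s <= t)%R ->
  (t `^ (- q) <= s `^ (- q))%R.
Proof.
move=> q0 s0 st; rewrite !powRN lef_pV2 ?posrE ?powR_gt0 ?(lt_le_trans s0)//.
by apply: ge0_ler_powR; rewrite ?nnegrE// ltW// (lt_le_trans s0).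
Qed.

Lemma powR_subV (q s : R) : (0 < s)%R -> (s `^ (1 - q) / s = s `^ (- q))%R.
Proof.
move=> s0; rewrite powRD; last by rewrite (gt_eqF s0) implybT.
by rewrite powRr1 ?(ltW s0)// mulrAC divff ?gt_eqF// mul1r.
Qed.

Lemma measurable_mean_fun (h : R -> \bar R) : measurable_fun (@pos_itv R) h ->
  (forall s, (0 < s)%R -> 0 <= h s) -> measurable_fun (@pos_itv R) (mean_fun h).
Proof.
move=> mh h0; apply: emeasurable_funM.
  apply/measurable_EFinP.
  apply: (@eq_measurable_fun _ _ _ _ _ (fun s => s `^ (-1))%R).
    by move=> s; rewrite inE pos_itvE => s0; rewrite powR_inv1// ltW.
  by apply: measurable_funS (measurable_powR (-1)%R).
have sub (t : R) : `]0%R, t]%classic `<=` @pos_itv R.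
  by move=> s /=; rewrite /pos_itv/= !in_itv/= andbT => /andP[].
rewrite (_ : (fun _ => _) = -%E \o (fun t => - \int[mu]_(s in `]0%R, t]) h s)); last first.
  by apply/funext => t /=; rewrite oppeK.
apply: measurableT_comp => //.
apply: nonincreasing_emeasurable; first exact: interval_is_interval.
move=> s t _ _ st; rewrite leeN2; apply: ge0_subset_integral => //.
- by apply: measurable_funS mh => //; exact: measurable_pos_itv.
- by move=> x /sub; rewrite pos_itvE; exact: h0.
- by move=> x /=; rewrite !in_itv/= => /andP[-> /le_trans]; exact.
Qed.

Lemma mean_fun_ge0 (h : R -> \bar R) s : (0 < s)%R ->
  (forall s, (0 < s)%R -> 0 <= h s) -> 0 <= mean_fun h s.
Proof.
move=> s0 h0; rewrite mule_ge0//; first by rewrite lee_fin invr_ge0 ltW.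
by apply: integral_ge0 => x /=; rewrite in_itv/= => /andP[x0 _]; exact: h0.
Qed.

Lemma measurable_lorentz_integrand n (f : 'rV[R]_n -> R) :
  measurable_fun (@pos_itv R)
    (fun s => rstarstar f s * ((s `^ (1 - n%:R^-1)) / s)%R%:E).
Proof.
apply: emeasurable_funM.
  apply: measurable_mean_fun; first exact: ginv_measurable.
  by move=> s _; exact: ginv_ge0.
apply/measurable_EFinP.
apply: (@eq_measurable_fun _ _ _ _ _ (fun s => s `^ (- n%:R^-1))%R).
  by move=> s; rewrite inE pos_itvE => s0; rewrite powR_subV.
by apply: measurable_funS (measurable_powR _).
Qed.

(** On (0,r) both f^* and f^** are at least t, and s^(-1/n) is at least r^(-1/n). The auxiliary [r]
    covers an infinite distribution function. *)
Lemma lorentz_norm_ge n (f : 'rV[R]_n -> R) (t r : R) : borelRn f ->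
  (0 <= t)%R -> (0 < r)%R -> r%:E <= distrib (@lebRn R n) (fun x => (f x)%:E) t ->
  (t * r `^ (1 - n%:R^-1))%R%:E <= lorentz_norm f.
Proof.
move=> bf t0 r0 rl.
have dl := distr_like_lebRn bf.
have sub : `]0%R, r[%classic `<=` @pos_itv R.
  by move=> s /=; rewrite /pos_itv/= !in_itv/= andbT => /andP[].
have int_cst (c s : R) : (0 < s)%R -> \int[mu]_(x in `]0%R, s[) c%:E = (c * s)%R%:E.
  move=> s0; rewrite integral_cst// -[X in _ * X]/(mu `]0%R, s[).
  rewrite lebesgue_measure_itv/= lte_fin s0.
  by rewrite oppr0 adde0 -EFinM.
apply: (@le_trans _ _ (\int[mu]_(s in `]0%R, r[) (t * r `^ (- n%:R^-1))%R%:E)).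
  rewrite int_cst// lee_fin -mulrA ler_wpM2l//.
  by rewrite -powR_subV// divfK// gt_eqF.
apply: (@le_trans _ _ (\int[mu]_(s in `]0%R, r[)
    (rstarstar f s * ((s `^ (1 - n%:R^-1)) / s)%R%:E))); last first.
  apply: ge0_subset_integral => //.
  - exact: measurable_lorentz_integrand.
  - move=> s /=; rewrite in_itv/= andbT => s0; rewrite mule_ge0//.
      by apply: mean_fun_ge0 => // u _; exact: ginv_ge0.
    by rewrite lee_fin powR_subV// powR_ge0.
apply: ge0_le_integral => //.
- by move=> s _; rewrite lee_fin mulr_ge0// powR_ge0.
- apply: measurable_funS (measurable_lorentz_integrand f) => //.
  exact: measurable_pos_itv.
move=> s; rewrite /= in_itv/= => /andP[s0 sr].
rewrite EFinM powR_subV//; apply: lee_pmul; rewrite ?lee_fin ?powR_ge0//; last first.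
  by apply: powRN_nonincreasing; rewrite ?invr_ge0// ltW.
rewrite /rstarstar /mean_fun.
have -> : t%:E = (s^-1)%:E * (t * s)%R%:E.
  by rewrite -EFinM mulrCA mulVf ?mulr1// gt_eqF.
rewrite lee_pmul2l ?lte_fin ?invr_gt0// -int_cst//.
apply: (@le_trans _ _ (\int[mu]_(x in `]0%R, s[) rstar f x)).
  apply: ge0_le_integral => //.
  - apply: measurable_funS (ginv_measurable _) => //; first exact: measurable_pos_itv.
    by move=> x /=; rewrite /pos_itv/= !in_itv/= andbT => /andP[].
  - move=> x /=; rewrite in_itv/= => /andP[x0 xs].
    rewrite ltW// ginv_gt//; apply: lt_le_trans rl.
    by rewrite lte_fin (lt_trans xs).
apply: ge0_subset_integral => //.
- apply: measurable_funS (ginv_measurable _) => //; first exact: measurable_pos_itv.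
  by move=> x /=; rewrite /pos_itv/= !in_itv/= andbT => /andP[].
- by move=> x _; exact: ginv_ge0.
- by move=> x /=; rewrite !in_itv/= => /andP[-> /ltW].
Qed.

Lemma stmt_iv_i n : (2 <= n)%N -> stmt_iv R n -> stmt_i R n.
Proof.
move=> n2 [c [c0 ivc]]; exists c; split => // f g fg t t0.
apply: le_trans (ivc f g fg); have [bf _] := fg.
have n0 : (0 < n%:R :> R)%R by rewrite ltr0n (leq_trans _ n2).
have pE : ((n%:R - 1) / n%:R = 1 - n%:R^-1 :> R)%R.
  by rewrite mulrBl divff ?gt_eqF// mul1r.
have p0 : (0 < 1 - n%:R^-1 :> R)%R by rewrite subr_gt0 invf_lt1// ltr1n.
rewrite pE.
have := @lorentz_norm_ge n f t _ bf (ltW t0).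
have := (distr_like_lebRn bf).1 t.
case: (distrib _ _ _) => [r r0 H| _ H|//].
- rewrite poweR_EFin -EFinM.
  move: r0; rewrite lee_fin le_eqVlt => /predU1P[<-|r0]; last exact: H.
  rewrite powR0 ?gt_eqF// mulr0; apply: integral_ge0 => s /=.
  rewrite in_itv/= andbT => s0; rewrite mule_ge0//.
    by apply: mean_fun_ge0 => // u _; exact: ginv_ge0.
  by rewrite lee_fin powR_subV// powR_ge0.
- rewrite poweRyr ?gt_eqF// gt0_muley ?lte_fin//.
  rewrite leye_eq; apply/eqP.
  case: (lorentz_norm f) H => [x|//|] H; last first.
    by have := H 1%R ltr01 (leey _).
  (* Here lambda(t) is infinite, so [r] is free; this value makes t r^(1-1/n) equal to |x| + 1, more
     than the supposed finite norm x. *)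
  pose r := (((`|x| + 1) / t) `^ (1 - n%:R^-1)^-1)%R.
  have b0 : (0 < (`|x| + 1) / t)%R by rewrite divr_gt0// ltr_wpDl.
  have := H r (powR_gt0 _ b0) (leey _).
  rewrite lee_fin /r -powRrM mulVf ?gt_eqF// powRr1 ?(ltW b0)//.
  rewrite mulrC divfK ?gt_eqF// => xx.
  by exfalso; have := ler_norm x; move: xx; lra.
Qed.

End WeakFromLorentz.

(** * Smooth truncations *)

Section SmoothCalculus.
Context {R : realType}.

Lemma smooth_continuous n (f : 'rV[R]_n -> R) : smooth f -> continuous f.
Proof. by move=> /(_ [::])[]. Qed.

Lemma smooth_derivable n (f : 'rV[R]_n -> R) : smooth f ->
  forall i x, derivable f x (evec R i).
Proof. by move=> /(_ [::])[]. Qed.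

Lemma smooth_pderiv n (f : 'rV[R]_n -> R) i : smooth f -> smooth (pderiv i f).
Proof. by move=> sf s; move: (sf (rcons s i)); rewrite /iter_pderiv foldr_rcons. Qed.

(** Smoothness as a greatest fixed point: it suffices to exhibit a class stable under partial
    derivatives whose members are continuous and have them. *)
Lemma smooth_coind n (P : ('rV[R]_n -> R) -> Prop) :
  (forall h, P h -> [/\ continuous h, forall i x, derivable h x (evec R i) &
     forall i, P (pderiv i h)]) ->
  forall h, P h -> smooth h.
Proof.
move=> HP h Ph s; have : P (iter_pderiv s h).
  by elim: s => //= i s /HP[].
by move=> /HP[].
Qed.

(** [smooth] speaks only of partial derivatives. Restricting to a line reduces the chain rule to one
    variable and avoids total differentiability. *)
Lemma is_derive_slice (V : normedModType R) (f : V -> R) x v d :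
  is_derive x v f d <-> is_derive (0 : R) 1 (fun h : R => f (h *: v + x)) d.
Proof.
have E : 'D_v f x = 'D_1 (fun h : R => f (h *: v + x)) 0.
  rewrite /derive; apply: (congr1 (fun F : R -> R => lim (F @ 0^'))).
  apply/funext => h /=.
  by rewrite addr0 scale0r add0r [h%:A]mulr1.
split=> -[df dv].
  by apply: DeriveDef; [exact: (derivable1P f x v).1|rewrite -E].
by apply: DeriveDef; [exact: (derivable1P f x v).2|rewrite E].
Qed.

Lemma is_derive_comp (V : normedModType R) (u : R -> R) (f : V -> R) x v a b :
  is_derive (f x) 1 u a -> is_derive x v f b ->
  is_derive x v (u \o f) (a * b).
Proof.
move=> du /is_derive_slice df; apply/is_derive_slice.
apply: (@is_derive1_comp _ u (fun h : R => f (h *: v + x))) => //.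
by rewrite scale0r add0r.
Qed.

Definition derivative_chain (u : nat -> R -> R) :=
  forall j (x : R), is_derive x 1 (u j) (u j.+1 x).

Lemma derivative_chain_continuous u j : derivative_chain u -> continuous (u j).
Proof.
move=> du x; apply: differentiable_continuous.
by apply/derivable1_diffP; case: (du j x).
Qed.

(** The class fed to [smooth_coind] for compositions: the chain rule and the Leibniz rule keep
    partial derivatives inside it. *)
Inductive chain_algebra n (u : nat -> R -> R) (f : 'rV[R]_n -> R) :
    ('rV[R]_n -> R) -> Prop :=
  | ChainSmooth h : smooth h -> chain_algebra u f h
  | ChainComp j : chain_algebra u f (u j \o f)
  | ChainAdd h1 h2 : chain_algebra u f h1 -> chain_algebra u f h2 ->
      chain_algebra u f (h1 + h2)
  | ChainMul h1 h2 : chain_algebra u f h1 -> chain_algebra u f h2 ->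
      chain_algebra u f (h1 * h2).

Lemma pderiv_comp n (u : nat -> R -> R) j (f : 'rV[R]_n -> R) i :
  derivative_chain u -> smooth f ->
  pderiv i (u j \o f) = (u j.+1 \o f) * pderiv i f.
Proof.
move=> du sf; apply/funext => x.
have := @is_derive_comp _ (u j) f x (evec R i) _ _ (du j (f x))
  (derivableP (@smooth_derivable _ _ sf i x)).
by case=> _; rewrite /pderiv => ->.
Qed.

Lemma smooth_comp n (u : nat -> R -> R) j (f : 'rV[R]_n -> R) :
  derivative_chain u -> smooth f -> smooth (u j \o f).
Proof.
move=> du sf; apply: (@smooth_coind _ (chain_algebra u f)); last exact: ChainComp.
move=> h; elim=> {h} [h sh|k|h1 h2 P1 [c1 d1 D1] P2 [c2 d2 D2]|h1 h2 P1 [c1 d1 D1] P2 [c2 d2 D2]].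
- split; [exact: smooth_continuous|exact: smooth_derivable|].
  by move=> i; apply: ChainSmooth; exact: smooth_pderiv.
- split.
  + move=> x; apply: continuous_comp; first exact: smooth_continuous.
    exact: derivative_chain_continuous.
  + move=> i x.
    have := @is_derive_comp _ (u k) f x (evec R i) _ _ (du k (f x))
      (derivableP (@smooth_derivable _ _ sf i x)).
    by case.
  + move=> i; rewrite pderiv_comp//; apply: ChainMul; first exact: ChainComp.
    by apply: ChainSmooth; exact: smooth_pderiv.
- split.
  + by move=> x; apply: continuousD; [exact: c1|exact: c2].
  + by move=> i x; apply: derivableD.
  + move=> i; have -> : pderiv i (h1 + h2) = pderiv i h1 + pderiv i h2.
      by apply/funext => x; rewrite /pderiv deriveD.
    exact: ChainAdd.
- split.
  + by move=> x; apply: continuousM; [exact: c1|exact: c2].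
  + by move=> i x; apply: derivableM.
  + move=> i.
    have -> : pderiv i (h1 * h2) = h1 * pderiv i h2 + h2 * pderiv i h1.
      by apply/funext => x; rewrite /pderiv deriveM.
    by apply: ChainAdd; apply: ChainMul.
Qed.

Lemma Cc_infty_comp n (u : nat -> R -> R) (f : 'rV[R]_n -> R) :
  derivative_chain u -> u 0%N 0 = 0 -> Cc_infty f -> Cc_infty (u 0%N \o f).
Proof.
move=> du u0 [sf cf]; split; first exact: smooth_comp.
apply: subclosed_compact cf _; first exact: closed_closure.
apply: closure_subset => x /=; apply: contra_neq => fx0.
by rewrite /= fx0.
Qed.

Lemma grad_norm_comp n (u : nat -> R -> R) (f : 'rV[R]_n -> R) x :
  derivative_chain u -> smooth f ->
  grad_norm (u 0%N \o f) x = `|u 1%N (f x)| * grad_norm f x.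
Proof.
move=> du sf; rewrite /grad_norm -sqrtr_sqr -sqrtrM ?sqr_ge0// mulr_sumr.
by congr Num.sqrt; apply: eq_bigr => i _; rewrite pderiv_comp// exprMn.
Qed.

Lemma derivative_chain_affine u (c d : R) : derivative_chain u ->
  derivative_chain (fun j x => c ^+ j * u j (c * x + d)).
Proof.
move=> du j x.
have dL : is_derive x 1 (fun x : R => c * x + d) c.
  have : is_derive x 1 ((c *: (@id R)) + cst d) (c *: (1 : R) + 0).
    by apply: is_deriveD.
  rewrite addr0 /GRing.scale/= mulr1.
  by congr is_derive.
have := @is_derive1_comp _ (u j) (fun x => c * x + d) x _ _ (du j (c * x + d)) dL.
move=> /(is_deriveZ (c ^+ j)).
rewrite /GRing.scale/=.
have -> : c ^+ j * (u j.+1 (c * x + d) * c) = c ^+ j.+1 * u j.+1 (c * x + d).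
  by rewrite exprSr mulrA mulrAC.
by congr is_derive.
Qed.

Lemma derivative_chainD u v : derivative_chain u -> derivative_chain v ->
  derivative_chain (fun j x => u j x + v j x).
Proof. by move=> du dv j x; exact: is_deriveD. Qed.

Lemma derivative_chainZ u (c : R) : derivative_chain u ->
  derivative_chain (fun j x => c * u j x).
Proof. by move=> du j x; exact: is_deriveZ. Qed.

Lemma derivative_chain_addcst u (c : R) : derivative_chain u ->
  derivative_chain (fun j x => u j x + (if j is 0%N then c else 0)).
Proof.
move=> du [|j] x.
  have : is_derive x 1 (u 0%N + cst c) (u 1%N x + 0) by apply: is_deriveD.
  by congr is_derive.
have : is_derive x 1 (u j.+1 + cst 0) (u j.+2 x + 0) by apply: is_deriveD.
by congr is_derive.
Qed.

End SmoothCalculus.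

(** * Softplus, a smooth substitute for the positive part *)

Section Softplus.
Context {R : realType}.
Implicit Types x y z a b K : R.

Definition softplus x := ln (1 + expR x).
Definition logistic x := 1 - (1 + expR x)^-1.

(** The logistic function L satisfies L' = L - L^2, so the derivative of p(L) is p'(L) (L - L^2):
    every derivative of softplus is a polynomial in L. *)
Definition softplus_chain (j : nat) x : R :=
  if j is i.+1 then (iter i (fun p => p^`() * ('X - 'X^2)) 'X).[logistic x]
  else softplus x.

Let add1_gt0 x : 0 < 1 + expR x.
Proof. by rewrite addr_gt0 ?expR_gt0. Qed.

Let is_derive_add1 x : is_derive x 1 (fun x => 1 + expR x) (expR x).
Proof.
have : is_derive x 1 (cst 1 + expR) (0 + expR x) by apply: is_deriveD.
by rewrite add0r; congr is_derive.
Qed.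

Lemma is_derive_logistic x :
  is_derive x 1 logistic (logistic x * (1 - logistic x)).
Proof.
have := @is_deriveV _ (fun x => 1 + expR x) x _ 1 (lt0r_neq0 (add1_gt0 x)) (is_derive_add1 x).
move=> dV.
have : is_derive x 1 (cst 1 - (fun x => (1 + expR x)^-1)) (0 - (- (1 + expR x) ^- 2 *: expR x)).
  by apply: is_deriveB.
rewrite sub0r.
have -> : - (- (1 + expR x) ^- 2 *: expR x) = logistic x * (1 - logistic x).
  rewrite /logistic /GRing.scale/=; have := lt0r_neq0 (add1_gt0 x) => h.
  by field.
by congr is_derive.
Qed.

Lemma softplus_chainP : derivative_chain softplus_chain.
Proof.
move=> [|j] x /=.
  rewrite hornerX.
  have := @is_derive1_comp _ (@ln R) (fun x => 1 + expR x) x _ _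
    (is_derive1_ln (add1_gt0 x)) (is_derive_add1 x).
  have -> : (1 + expR x)^-1 * expR x = logistic x.
    by rewrite /logistic; have := lt0r_neq0 (add1_gt0 x) => h; field.
  by congr is_derive.
set p := iter j _ _.
have dp : is_derive (logistic x) 1 (horner p) p^`().[logistic x].
  by apply: DeriveDef; [exact: derivable_horner|rewrite -derive1E -derivE].
have := @is_derive1_comp _ (horner p) logistic x _ _ dp (is_derive_logistic x).
rewrite hornerM [in X in _ -> X]hornerD hornerN hornerX hornerXn.
have -> : p^`().[logistic x] * (logistic x - logistic x ^+ 2) =
          p^`().[logistic x] * (logistic x * (1 - logistic x)) by ring.
by [].
Qed.

Lemma softplus_ge0 x : 0 <= softplus x.
Proof. by rewrite ln_ge0// lerDl expR_ge0. Qed.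

Lemma softplus_ge x : x <= softplus x.
Proof.
by rewrite -[leLHS]expRK ler_ln ?posrE ?expR_gt0// lerDr.
Qed.

Lemma softplus_le x y : x <= y -> softplus x <= softplus y.
Proof. by move=> xy; rewrite ler_ln ?posrE// lerD2l ler_expR. Qed.

Lemma softplus_le_add1 x : 0 <= x -> softplus x <= x + 1.
Proof.
move=> x0; rewrite -[leRHS]expRK ler_ln ?posrE ?expR_gt0// expRD.
have e1 : 1 <= expR x by rewrite -expR0 ler_expR.
have e2 : 2 <= expR (1 : R) by have := expR_ge1Dx (1 : R).
nra.
Qed.

Lemma softplus_le1 x : x <= 0 -> softplus x <= 1.
Proof. by move=> /softplus_le/le_trans; apply; rewrite -[leRHS]add0r softplus_le_add1. Qed.

Lemma logistic_ge0 x : 0 <= logistic x.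
Proof. by rewrite subr_ge0 invf_le1// lerDl expR_ge0. Qed.

Lemma logistic_le1 x : logistic x <= 1.
Proof. by rewrite lerBlDr lerDl invr_ge0 ltW. Qed.

Lemma logistic_le x y : x <= y -> logistic x <= logistic y.
Proof.
by move=> xy; rewrite lerD2l lerN2 lef_pV2 ?posrE// lerD2l ler_expR.
Qed.

Lemma logistic_small z : 0 < z -> logistic (- z) <= z^-1.
Proof.
move=> z0; have -> : logistic (- z) = (1 + expR z)^-1.
  rewrite /logistic expRN; have h := expR_gt0 z.
  have h1 := lt0r_neq0 h; have h2 := lt0r_neq0 (add1_gt0 z).
  by field; rewrite h1 h2.
rewrite lef_pV2 ?posrE//; have := expR_ge1Dx z; lra.
Qed.

(* Smooth even function vanishing at 0, close to b - a for |x| >= b, with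
   derivative close to the indicator of a <= |x| <= b up to sign. *)
Lemma smooth_truncation a b K : 0 <= a -> a < b -> 0 < K ->
  exists V : nat -> R -> R, [/\ derivative_chain V, V 0%N 0 = 0,
    forall x, V 1%N x = logistic (K * x - K * a) - logistic (K * x - K * b)
      - (logistic (- K * x - K * a) - logistic (- K * x - K * b)) &
    forall x, b <= `|x| -> b - a - 3 / K <= V 0%N x].
Proof.
move=> a0 ab K0.
pose A c d (j : nat) x := c ^+ j * softplus_chain j (c * x + d).
have cA c d : derivative_chain (A c d).
  exact: derivative_chain_affine softplus_chainP.
(* For c = K this is a smooth copy of the truncation between a and b, for c = -K its reflection. The
   constant [k0] restores the value 0 at 0, so that composition preserves compact support. *)
pose v c (j : nat) x := K^-1 * (A c (- (K * a)) j x + (-1) * A c (- (K * b)) j x).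
have cv c : derivative_chain (v c).
  exact: (derivative_chainZ _ (derivative_chainD (cA _ _)
    (derivative_chainZ _ (cA _ _)))).
pose k0 := v K 0%N 0 + v (- K) 0%N 0.
exists (fun j x => (v K j x + v (- K) j x) + (if j is 0%N then - k0 else 0)).
have Kn : K != 0 by rewrite gt_eqF.
split.
- exact: (derivative_chain_addcst _ (derivative_chainD (cv K) (cv (- K)))).
- by rewrite /k0 subrr.
- move=> x; rewrite /v /A/= !hornerX !expr1 addr0 !mulN1r.
  by field.
- move=> x bx.
  have vE c y : v c 0%N y = K^-1 * (softplus (c * y - K * a) - softplus (c * y - K * b)).
    by rewrite /v /A/= !expr0 !mul1r mulN1r.
  have v0 c : v c 0%N 0 <= K^-1.
    rewrite vE -[leRHS]mulr1 ler_pM2l ?invr_gt0// mulr0 !sub0r.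
    have := @softplus_le1 (- (K * a)); rewrite oppr_le0 mulr_ge0 ?(ltW K0)// => /(_ isT).
    by have := softplus_ge0 (- (K * b)); lra.
  have vge0 c y : 0 <= v c 0%N y.
    rewrite vE mulr_ge0 ?invr_ge0 ?(ltW K0)// subr_ge0 softplus_le// lerD2l lerN2.
    by rewrite ler_pM2l// ltW.
  have vbig c y : b * K <= c * y -> b - a - K^-1 <= v c 0%N y.
    move=> h; rewrite vE.
    have -> : b - a - K^-1 = K^-1 * (K * b - K * a - 1) by field.
    rewrite ler_pM2l ?invr_gt0//.
    have := softplus_ge (c * y - K * a).
    have := @softplus_le_add1 (c * y - K * b); rewrite subr_ge0 mulrC => /(_ h).
    rewrite [b * K]mulrC; lra.
  rewrite /k0.
  have big : b - a - K^-1 <= v K 0%N x + v (- K) 0%N x.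
    have [x0|x0] := leP 0 x.
      move: bx; rewrite ger0_norm// => bx.
      have /vbig : b * K <= K * x by rewrite mulrC ler_pM2l.
      by have := vge0 (- K) x; lra.
    move: bx; rewrite ltr0_norm// => bx.
    have /vbig : b * K <= - K * x by rewrite mulNr -mulrN mulrC ler_pM2l.
    by have := vge0 K x; lra.
  (* Each of the two terms of [k0] costs at most 1/K, and [big] loses one more: hence 3/K. *)
  have h1 := v0 K; have h2 := v0 (- K).
  by have -> : 3 / K = K^-1 + K^-1 + K^-1; [field|lra].
Qed.

End Softplus.

(** * Measurability and finiteness for test functions *)

Section BorelContinuous.
Context {R : realType}.

Lemma measurable_floor_level (c : R) (m : int) : 0 <= c ->
  measurable [set x : R | Num.floor (c * x) = m].
Proof.
move=> c0; apply: is_interval_measurable => x y /= xm ym z /andP[xz zy].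
apply/eqP; rewrite eq_le; apply/andP; split; [rewrite -ym|rewrite -xm];
  by apply: le_floor; rewrite ler_wpM2l.
Qed.

(** The sigma-algebra on tuples is generated by coordinates. Rounding each coordinate down to a
    multiple of 1/(k+1) gives a function with countably many values, measurable level by level, and
    continuity gives pointwise convergence. *)
Lemma continuous_borel n (f : 'rV[R]_n -> R) : continuous f -> borelRn f.
Proof.
move=> cf; rewrite /borelRn.
pose v k (t : n.-tuple R) := [ffun i => Num.floor (k.+1%:R * tnth t i)].
pose g k (w : {ffun 'I_n -> int}) := \row_i ((w i)%:~R / k.+1%:R) : 'rV[R]_n.
apply: (@measurable_fun_cvg _ _ _ _ (fun k t => f (g k (v k t)))) => [k|t _].
  move=> _ Y mY; rewrite setTI.
  have -> : (fun t => f (g k (v k t))) @^-1` Y =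
      \bigcup_(w : {ffun 'I_n -> int})
        (if f (g k w) \in Y then [set t | v k t = w] else set0).
    apply/seteqP; split => t /=.
      by move=> Yt; exists (v k t) => //; rewrite mem_set.
    by move=> [w _]; case: ifPn => // /set_mem Yw /= ->.
  apply: countable_bigcupT_measurable; first exact: countableP.
  move=> w; case: ifPn => // _.
  have -> : [set t | v k t = w] = \bigcap_(i in [set: 'I_n])
      ((@tnth _ R ^~ i) @^-1` [set x : R | Num.floor (k.+1%:R * x) = w i]).
    apply/seteqP; split => t /= H.
      by move=> i _ /=; rewrite -H ffunE.
    by apply/ffunP => i; rewrite ffunE; apply: H.
  apply: fin_bigcap_measurable => // i _; rewrite -[X in measurable X]setTI.
  by apply: measurable_tnth => //; exact: measurable_floor_level.
suff : g k (v k t) @[k --> \oo] --> row_of_tuple t by move=> H; apply: cvg_comp H (cf _).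
apply/cvg_ballP => e e0.
near=> k; split => // i j; rewrite !mxE ffunE /ball/=.
set x := tnth t j; set m := Num.floor _.
have k0 : 0 < k.+1%:R :> R by rewrite ltr0n.
have -> : x - m%:~R / k.+1%:R = (k.+1%:R * x - m%:~R) / k.+1%:R.
  by rewrite mulrBl mulrAC divff ?gt_eqF// mul1r.
have /andP[h1 h2] := floor_itv (k.+1%:R * x).
rewrite normrM ger0_norm ?subr_ge0// ger0_norm ?invr_ge0 ?ler0n//.
have ke : k.+1%:R^-1 < e by near: k; exact: (near_infty_natSinv_lt (PosNum e0)).
apply: le_lt_trans ke; rewrite ler_piMl ?invr_ge0 ?ler0n//.
by rewrite lerBlDr ltW// (lt_le_trans h2)// intrD addrC.
Unshelve. all: by end_near. Qed.

Lemma borel_norm n (f : 'rV[R]_n -> R) : borelRn f -> borelRn (fun x => `|f x|).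
Proof. by move=> bf; apply: measurableT_comp. Qed.

End BorelContinuous.

Section CompactSupport.
Local Open Scope ereal_scope.
Context {R : realType}.
Local Notation mu := (@lebesgue_measure R).

Definition box n (M : R) := [set t : n.-tuple R | forall i, (`|tnth t i| <= M)%R].

Arguments box n M : clear implicits.

Lemma measurable_box n M : measurable (box n M).
Proof.
have -> : box n M = \bigcap_(i in [set: 'I_n])
    ((@tnth _ R ^~ i) @^-1` [set x : R | (`|x| <= M)%R]).
  by apply/seteqP; split => t /= H; [move=> i _; exact: H|move=> i; exact: H].
apply: fin_bigcap_measurable => // i _; rewrite -[X in measurable X]setTI.
apply: measurable_tnth => //.
have -> : [set x : R | (`|x| <= M)%R] = `[(- M)%R, M]%classic.
  by apply/seteqP; split=> x /=; rewrite in_itv/= ler_norml.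
exact: measurable_itv.
Qed.

Lemma iint0 n : iint (fun _ : n.-tuple R => 0) = 0.
Proof.
elim: n => //= n IH; apply: integral0_eq => x _; exact: IH.
Qed.

Lemma iint_box n (M : R) : (0 <= M)%R -> exists c : R, (0 <= c)%R /\
  iint (fun t : n.-tuple R => (\1_(box n M) t : R)%:E) = c%:E.
Proof.
move=> M0; elim: n => [|n [c [c0 IH]]].
  exists 1%R; split => //=; rewrite indicE mem_set//.
  by move=> [].
exists (c * (M + M))%R; split; first by rewrite mulr_ge0// addr_ge0.
transitivity (\int[mu]_(x in `[(- M)%R, M]) c%:E); last first.
  rewrite integral_cst//= -[X in _ * X]/(mu `[(- M)%R, M]) lebesgue_measure_itv/=.
  rewrite lte_fin; case: ltP => [_|MM].
    by rewrite -EFinD -EFinM opprK.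
  have -> : M = 0%R by move: MM M0; rewrite le_eqVlt; lra.
  by rewrite addr0 mulr0 mule0.
rewrite /= [RHS]integral_mkcond; apply: eq_integral => x _.
rewrite patchE mem_setE in_itv/= -ler_norml; case: ifPn => xM.
- rewrite -IH; congr iint; apply/funext => t.
  rewrite !indicE; congr (nat_of_bool _)%:R%:E; apply/idP/idP; rewrite !inE => H.
    move=> i; have := H (lift ord0 i); by rewrite tnthS.
  move=> i; case: (unliftP ord0 i) => [j ->|->]; first by rewrite tnthS; exact: H.
  by rewrite tnth0.
- rewrite -[RHS](iint0 n); congr iint; apply/funext => t.
  by rewrite indicE memNset//= => /(_ ord0); rewrite tnth0; exact/negP.
Qed.

Lemma box_finite n M : (0 <= M)%R -> tuple_leb n (box n M) < +oo.
Proof.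
move=> M0; have [c [c0 cE]] := iint_box n M0.
have : iint (fun t : n.-tuple R => (\1_(box n M) t : R)%:E) < +oo by rewrite cE ltry.
rewrite iintE//.
  by rewrite integral_indic// ?setIT//; exact: measurable_box.
by apply/measurable_EFinP; apply: measurable_indic; exact: measurable_box.
Qed.

(** The common features of f and |grad f| for a test function f. They make the rearrangement and the
    distribution function finite, so that f^** - f^* is a genuine difference. *)
Definition bounded_support n (h : 'rV[R]_n -> R) := borelRn h /\
  exists B M : R, [/\ (0 <= B)%R, (0 <= M)%R, forall x, (`|h x| <= B)%R &
    forall x, h x != 0%R -> forall i, (`|x ord0 i| <= M)%R].

Lemma bounded_support_distrib n (h : 'rV[R]_n -> R) y : bounded_support h ->
  (0 <= y)%R -> distrib (@lebRn R n) (fun x => (h x)%:E) y < +oo.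
Proof.
move=> [bh [B [M [B0 M0 hB hM]]]] y0.
rewrite distrib_lebRnE// /distrib setIT.
apply: le_lt_trans (box_finite n M0); apply: le_measure; rewrite ?inE.
- rewrite -[X in measurable X]setTI.
  apply: emeasurable_fun_o_infty => //; apply: measurableT_comp => //.
  exact: (borel_EFin bh).
- exact: measurable_box.
- move=> t /= yh i; have := hM (row_of_tuple t) _ i; rewrite mxE; apply.
  by apply: contraTneq yh => ->; rewrite normr0 lte_fin ltNge y0.
Qed.

Lemma bounded_support_rstar n (h : 'rV[R]_n -> R) : bounded_support h ->
  exists B : R, forall s, (0 <= s)%R -> rstar h s <= B%:E.
Proof.
move=> [bh [B [M [B0 M0 hB hM]]]]; exists B => s s0.
rewrite /rstar rearrE ginv_le//; last exact: distr_like_lebRn.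
rewrite distrib_lebRnE// /distrib setIT.
have -> : [set x : n.-tuple R | B%:E < `|(h (row_of_tuple x))%:E|] = set0.
  by apply/seteqP; split => x //=; rewrite lte_fin ltNge hB.
by rewrite measure0 lee_fin.
Qed.

Lemma bounded_support_rstar_fin n (h : 'rV[R]_n -> R) s : bounded_support h ->
  (0 <= s)%R -> rstar h s \is a fin_num.
Proof.
move=> /bounded_support_rstar[B hB] s0.
rewrite ge0_fin_numE; last exact: ginv_ge0.
by apply: le_lt_trans (hB _ s0) _; rewrite ltry.
Qed.

Lemma bounded_support_intRn n (h : 'rV[R]_n -> R) : bounded_support h ->
  (forall x, 0 <= h x)%R -> intRn (fun x => (h x)%:E) < +oo.
Proof.
move=> [bh [B [M [B0 M0 hB hM]]]] h0.
rewrite intRnE//.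
apply: (@le_lt_trans _ _ (\int[tuple_leb n]_t (B%:E * (\1_(box n M) t : R)%:E))).
  apply: ge0_le_integral => //.
  - by move=> t _; rewrite lee_fin.
  - exact: (borel_EFin bh).
  - apply: emeasurable_funM => //; apply/measurable_EFinP; apply: measurable_indic.
    exact: measurable_box.
  - move=> t _; rewrite -EFinM lee_fin indicE.
    have [/eqP ->|hn] := boolP (h (row_of_tuple t) == 0%R); first by rewrite mulr_ge0.
    rewrite mem_set ?mulr1; first exact: le_trans (ler_norm _) (hB _).
    by move=> i; have := hM _ hn i; rewrite mxE.
rewrite ge0_integralZl//; last first.
  by apply/measurable_EFinP; apply: measurable_indic; exact: measurable_box.
rewrite integral_indic ?setIT//; last exact: measurable_box.
by rewrite lte_mul_pinfty ?lee_fin//; exact: box_finite.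
Qed.

Lemma compact_bounded_support n (f h : 'rV[R]_n -> R) :
  compact (closure [set x | f x != 0%R]) -> continuous h ->
  (forall x, ~ closure [set x | f x != 0%R] x -> h x = 0%R) -> bounded_support h.
Proof.
set K := closure _ => cK ch hK.
split; first exact: continuous_borel.
have [M [Mr HM]] := compact_bounded cK.
have [B [Br HB]] : bounded_set (h @` K).
  by apply: compact_bounded; apply: continuous_compact => //; exact: continuous_subspaceT.
exists (`|B| + 1)%R, (`|M| + 1)%R.
have B1 : (B < `|B| + 1)%R by rewrite (le_lt_trans (ler_norm _))// ltrDl.
have M1 : (M < `|M| + 1)%R by rewrite (le_lt_trans (ler_norm _))// ltrDl.
split; rewrite ?addr_ge0//.
- move=> x; have [Kx|Kx] := pselect (K x); first by apply: HB => //; exists x.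
  by rewrite hK// normr0 addr_ge0.
- move=> x hx i; have Kx : K x by apply: contrapT => /hK /eqP; exact/negP.
  apply: le_trans (HM _ M1 _ Kx); rewrite -[leRHS]/(mx_norm x) mx_normrE.
  exact: (le_bigmax _ (fun ij : 'I_1 * 'I_n => `|x ij.1 ij.2|%R) (ord0, i)).
Qed.

Lemma Cc_bounded_support n (f : 'rV[R]_n -> R) : Cc_infty f -> bounded_support f.
Proof.
move=> [sf cf]; apply: (compact_bounded_support cf); first exact: smooth_continuous.
move=> x nx; apply/eqP; apply/negP => /negP fx; apply: nx.
exact: subset_closure.
Qed.

Lemma continuous_grad_norm n (f : 'rV[R]_n -> R) : smooth f ->
  continuous (grad_norm f).
Proof.
move=> sf x; apply: (@continuous_comp _ _ _
  (fun x => \sum_(i < n) (pderiv i f x) ^+ 2)%R (@Num.sqrt R)); last exact: sqrt_continuous.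
have -> : (fun x => \sum_(i < n) (pderiv i f x) ^+ 2)%R =
          (\sum_(i < n) (fun x => (pderiv i f x) ^+ 2))%R.
  by apply/funext => y; rewrite fct_sumE.
elim/big_ind : _ => [|g h cg ch|i _].
- exact: cst_continuous.
- exact: continuousD.
- apply: (@continuousM _ _ (pderiv i f) (pderiv i f) x);
    exact: (smooth_continuous (smooth_pderiv i sf)).
Qed.

Lemma grad_norm_ge0 n (f : 'rV[R]_n -> R) x : (0 <= grad_norm f x)%R.
Proof. exact: sqrtr_ge0. Qed.

Lemma Cc_grad_norm_bounded_support n (f : 'rV[R]_n -> R) : Cc_infty f ->
  bounded_support (grad_norm f).
Proof.
move=> [sf cf]; apply: (compact_bounded_support cf).
  exact: continuous_grad_norm.
move=> x nx; rewrite /grad_norm big1 ?sqrtr0// => i _.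
suff -> : pderiv i f x = 0%R by rewrite expr0n.
rewrite /pderiv -[RHS](derive_cst (0%R : R) (evec R i) x).
(* Off the closed support f vanishes on a whole neighbourhood, so its derivatives are those of the
   zero function. *)
apply: near_eq_derive.
have : nbhs x (~` closure [set x | f x != 0%R]).
  by apply: open_nbhs_nbhs; split => //; apply: closed_openC; exact: closed_closure.
apply: filterS => y ny; apply/eqP; apply/negP => /negP fy; apply: ny.
exact: subset_closure.
Qed.

Lemma Cc_grad_norm_borel n (f : 'rV[R]_n -> R) : Cc_infty f -> borelRn (grad_norm f).
Proof. by move=> /Cc_grad_norm_bounded_support[]. Qed.

Lemma Cc_borel n (f : 'rV[R]_n -> R) : Cc_infty f -> borelRn f.
Proof. by move=> /Cc_bounded_support[]. Qed.

Lemma Cc_W011 n (f : 'rV[R]_n -> R) : Cc_infty f -> W011 f (fun i => pderiv i f).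
Proof.
move=> cf; have [sf _] := cf; split; first exact: Cc_borel.
split; first by move=> i; apply: continuous_borel; exact: smooth_continuous (smooth_pderiv i sf).
have H (h : 'rV[R]_n -> R) : intRn (fun x => `|h x - h x|%:E) = 0.
  rewrite /intRn -[RHS](@iint0 n); congr iint; apply/funext => t.
  by rewrite subrr normr0.
exists (fun _ => f); split => //.
by split=> [|i]; rewrite H; exact: cvg_cst.
Qed.

End CompactSupport.

Section KernelIntegral.
Local Open Scope ereal_scope.
Context {R : realType}.
Local Notation mu := (@lebesgue_measure R).

Lemma integral_powR (p r t : R) : (p != 0)%R -> (0 < r)%R -> (r <= t)%R ->
  \int[mu]_(s in `[r, t]) (s `^ (p - 1))%R%:E = (p^-1 * (t `^ p - r `^ p))%R%:E.
Proof.
move=> p0 r0; rewrite le_eqVlt => /predU1P[<-|rt].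
  by rewrite set_itv1 integral_set1 subrr mulr0.
pose F (s : R) := (p^-1 * s `^ p)%R.
have dF (s : R) : (0 < s)%R -> is_derive s 1%R F (s `^ (p - 1))%R.
  move=> s0; have := is_derive1_powR p s0.
  by move=> /(is_deriveZ p^-1); rewrite /GRing.scale/= mulrA mulVf// mul1r.
have cF (s : R) : (0 < s)%R -> {for s, continuous F}.
  move=> s0; apply: differentiable_continuous; apply/derivable1_diffP.
  by case: (dF s s0).
rewrite (@continuous_FTC2 _ _ F r t)//.
- by rewrite -EFinB /F mulrBr.
- apply: derivable_within_continuous => s; rewrite in_itv/= => /andP[rs _].
  have s0 := lt_le_trans r0 rs.
  by case: (is_derive1_powR (p - 1) s0).
- split.
  + move=> s; rewrite in_itv/= => /andP[rs _].
    by case: (dF s (lt_trans r0 rs)).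
  + by apply: cvg_at_right_filter; exact: cF.
  + by apply: cvg_at_left_filter; apply: cF; exact: lt_trans rt.
- move=> s; rewrite in_itv/= => /andP[rs _].
  by rewrite derive1E; case: (dF s (lt_trans r0 rs)).
Qed.

Lemma integral_powR_tail (q r t : R) : (0 < q)%R -> (0 < r)%R -> (r <= t)%R ->
  \int[mu]_(s in `[r, t]) (s `^ (- q - 1))%R%:E <= (q^-1 * r `^ (- q))%R%:E.
Proof.
move=> q0 r0 rt; rewrite integral_powR//; last by rewrite oppr_eq0 gt_eqF.
rewrite lee_fin invrN mulNr -mulrN opprB ler_wpM2l ?invr_ge0 ?(ltW q0)//.
by rewrite gerBl powR_ge0.
Qed.

Lemma integral_cst_co (c : \bar R) (a b : R) : (a <= b)%R ->
  \int[mu]_(x in `[a, b[) c = (b - a)%R%:E * c.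
Proof.
move=> ab; rewrite integral_cst// -[X in _ * X]/(mu `[a, b[).
rewrite lebesgue_measure_itv/= lte_fin; case: ltP => [_|ba].
  by rewrite muleC.
by have -> : a = b; [apply/eqP; rewrite eq_le ab|rewrite subrr mul0e mule0].
Qed.

Lemma riemann_sum_ge (h : R -> \bar R) (a d : R) N :
  (forall y, (a <= y)%R -> 0 <= h y) ->
  (forall y z, (a <= y)%R -> (y <= z)%R -> h z <= h y) -> (0 < d)%R ->
  \int[mu]_(y in `[a, (a + N%:R * d)%R[) h y <= d%:E * \sum_(k < N) h (a + k%:R * d)%R.
Proof.
move=> h0 hni d0.
have mh : measurable_fun `[a, +oo[ h.
  apply: nonincreasing_emeasurable; first exact: interval_is_interval.
  by move=> s t /=; rewrite in_itv/= andbT => as_ _; exact: hni.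
have mhi (x y : R) : (a <= x)%R -> measurable_fun `[x, y[ h.
  move=> ax; apply: measurable_funS mh => // z /=.
  by rewrite !in_itv/= andbT => /andP[/(le_trans ax)].
elim: N => [|N IH].
  by rewrite mul0r addr0 set_itvco0 integral_set0 big_ord0 mule0.
have aN (k : nat) : (a <= a + k%:R * d)%R by rewrite lerDl mulr_ge0// ltW.
have NN : (a + N%:R * d <= a + N.+1%:R * d)%R by rewrite lerD2l ler_pM2r// ler_nat.
rewrite (@itv_bndbnd_setU _ _ _ (BLeft (a + N%:R * d)%R)) ?bnd_simp//.
rewrite ge0_integral_setU//=; last 3 first.
- rewrite -itv_bndbnd_setU ?bnd_simp//; exact: mhi.
- by move=> x [] /=; rewrite in_itv/= => /andP[ax _]; apply: h0 => //; exact: le_trans ax.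
- apply/disj_setPS => x [] /=; rewrite !in_itv/= => /andP[_ xa] /andP[ax _].
  by move: xa; rewrite ltNge ax.
rewrite big_ord_recr/= ge0_muleDr; last 2 first.
- by apply: sume_ge0 => k _; exact: h0.
- exact: h0.
apply: leeD => //.
apply: (@le_trans _ _ (\int[mu]_(y in `[(a + N%:R * d)%R, (a + N.+1%:R * d)%R[)
    h (a + N%:R * d)%R)).
  apply: ge0_le_integral => //=.
  - by move=> x; rewrite /= in_itv/= => /andP[ax _]; apply: h0; exact: le_trans ax.
  - exact: mhi.
  - by move=> x; rewrite /= in_itv/= => /andP[ax _]; exact: hni.
rewrite integral_cst_co//; apply: lee_wpmul2r; first exact: h0.
by rewrite lee_fin -natr1 le_eqVlt; apply/orP; left; apply/eqP; ring.
Qed.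

End KernelIntegral.

(** * Summation of the truncations over levels *)

Section Truncation.
Local Open Scope ereal_scope.
Context {R : realType}.
Local Notation mu := (@lebesgue_measure R).

(** Each summand is at most the sum of two nonnegative differences, one for each sign of K, and both
    telescope, so the bound is free of N. The surviving terms are at most 1. A sign c with c z <= K
    a gives an argument at most -K d, since the first level is a + d and not a, hence a term at most
    1/(K d); for |z| > a at most one sign escapes this. *)
Lemma sum_logistic (K a d z : R) N : (0 < K)%R -> (0 < d)%R -> (0 <= a)%R ->
  (\sum_(k < N) `|logistic (K * z - K * (a + k.+1%:R * d))
      - logistic (K * z - K * (a + k.+2%:R * d))
      - (logistic (- K * z - K * (a + k.+1%:R * d))
      - logistic (- K * z - K * (a + k.+2%:R * d)))|
   <= (a < `|z|)%R%:R + 2 / (K * d))%R.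
Proof.
move=> K0 d0 a0.
pose L (c : R) (k : nat) := logistic (c * z - K * (a + k.+1%:R * d)).
have L0 c k : (0 <= L c k)%R by exact: logistic_ge0.
have Ld c k : (L c k.+1 <= L c k)%R.
  by apply: logistic_le; rewrite lerD2l lerN2 ler_pM2l// lerD2l ler_pM2r// ler_nat.
have tele c : (\sum_(k < N) (L c k - L c k.+1) <= L c 0%N)%R.
  have -> : (\sum_(k < N) (L c k - L c k.+1) = L c 0%N - L c N)%R.
    elim: N => [|N IH]; first by rewrite big_ord0 subrr.
    by rewrite big_ord_recr/= IH addrA subrK.
  by rewrite lerBlDr lerDl.
apply: (@le_trans _ _ (L K 0%N + L (- K) 0%N)%R).
  apply: le_trans (lerD (tele K) (tele (- K)%R)).
  rewrite -big_split/=; apply: ler_sum => k _.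
  rewrite (le_trans (ler_normB _ _))//.
  by rewrite !ger0_norm ?subr_ge0 ?Ld.
have Kd : (0 < K * d)%R by exact: mulr_gt0.
have small c : (c * z <= K * a)%R -> (L c 0%N <= (K * d)^-1)%R.
  move=> cz; apply: le_trans (logistic_small Kd); apply: logistic_le.
  by rewrite mul1r mulrDr; lra.
have le1 c k : (L c k <= 1)%R by exact: logistic_le1.
have K2 : (2 / (K * d) = (K * d)^-1 + (K * d)^-1)%R by rewrite mulr_natl mulr2n.
have iKd : (0 < (K * d)^-1)%R by rewrite invr_gt0.
rewrite K2; case: ltP => [az|za].
- have [z0|z0] := leP 0%R z.
  + have := le1 K 0%N; have /small : (- K * z <= K * a)%R.
      by rewrite mulNr -mulrN ler_pM2l//; move: a0 z0; lra.
    by rewrite /=; lra.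
  + have := le1 (- K)%R 0%N; have /small : (K * z <= K * a)%R.
      by rewrite ler_pM2l//; move: a0 z0; lra.
    by rewrite /=; lra.
- have zl := ler_norm z; have zr := ler_normr z; have nz := ler_norm (- z)%R.
  rewrite normrN in nz.
  have /small : (K * z <= K * a)%R by rewrite ler_pM2l//; lra.
  have /small : (- K * z <= K * a)%R by rewrite mulNr -mulrN ler_pM2l//; lra.
  by rewrite /=; lra.
Qed.

End Truncation.

Section TruncationInequality.
Local Open Scope ereal_scope.
Context {R : realType}.
Local Notation mu := (@lebesgue_measure R).

(** The k-th truncation acts between y_(k+1) and y_(k+2). By [sum_logistic] the gradients of all
    truncations together cost |grad f| on the set where |f| > a, up to a small multiple of the total
    integral. *)
Lemma isocapacitary_sum n (c : R) (f : 'rV[R]_n -> R) (a d p : R) N :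
  (0 < c)%R -> (0 < p)%R ->
  (forall (f : 'rV[R]_n -> R) (g : 'I_n -> 'rV[R]_n -> R), W011 f g ->
      forall t : R, (0 < t)%R ->
        t%:E * (distrib (@lebRn R n) (fun x => (f x)%:E) t) `^ p
        <= c%:E * intRn (fun x => (vec_norm g x)%:E)) ->
  Cc_infty f -> (0 <= a)%R -> (0 < d)%R ->
  (d / 2)%:E * \sum_(k < N)
      (distrib (@lebRn R n) (fun x => (f x)%:E) (a + k.+2%:R * d)%R) `^ p
  <= c%:E * \int[tuple_leb n]_(t in [set t | (a < `|f (row_of_tuple t)|)%R])
       (grad_norm f (row_of_tuple t))%:E.
Proof.
move=> c0 p0 Hi cf a0 d0; have [sf _] := cf.
set l := distrib _ _; set m := tuple_leb n; set E := [set t | _].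
pose g (t : n.-tuple R) := grad_norm f (row_of_tuple t).
have bf := Cc_borel cf; have bg := Cc_grad_norm_borel cf.
have mg : measurable_fun setT (EFin \o g) by exact: (borel_EFin bg).
have g0 t : (0 <= g t)%R by exact: grad_norm_ge0.
have mE : measurable E.
  have -> : E = setT `&` [set t | a%:E < `|(f (row_of_tuple t))%:E|].
    by rewrite setTI; apply/seteqP; split => t /=; rewrite lte_fin.
  apply: emeasurable_fun_o_infty => //; apply: measurableT_comp => //.
  exact: (borel_EFin bf).
pose I := \int[m]_t (g t)%:E.
have I_fin : I \is a fin_num.
  rewrite ge0_fin_numE; last by apply: integral_ge0 => t _; rewrite lee_fin.
  rewrite /I -intRnE//; last by move=> x; exact: grad_norm_ge0.
  apply: bounded_support_intRn; first exact: Cc_grad_norm_bounded_support.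
  by move=> x; exact: grad_norm_ge0.
have I0 : (0 <= fine I)%R.
  by apply: fine_ge0; apply: integral_ge0 => t _; rewrite lee_fin.
apply/lee_addgt0Pr => e e0.
(* K is chosen so that the truncations exceed d/2 and the tails cost at most e. *)
pose K := Num.max (12 / d)%R (2 * c * (fine I + 1) / (d * e))%R.
have K0 : (0 < K)%R by rewrite lt_max divr_gt0.
have K1 : (12 / d <= K)%R by rewrite le_max lexx.
have K2 : (2 * c * (fine I + 1) / (d * e) <= K)%R by rewrite le_max lexx orbT.
pose y k := (a + k%:R * d)%R.
have y0 k : (0 <= y k)%R by rewrite addr_ge0// mulr_ge0// ltW.
have yd k : (y k.+1 - y k = d)%R by rewrite /y -natr1; ring.
have ylt k : (y k < y k.+1)%R by rewrite -subr_gt0 yd.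
have /choice[V HV] : forall k : nat, exists V : nat -> R -> R,
  [/\ derivative_chain V, V 0%N 0%R = 0%R,
    forall x, V 1%N x = (logistic (K * x - K * y k.+1) - logistic (K * x - K * y k.+2)
      - (logistic (- K * x - K * y k.+1) - logistic (- K * x - K * y k.+2)))%R &
    forall x, (y k.+2 <= `|x|)%R -> (y k.+2 - y k.+1 - 3 / K <= V 0%N x)%R].
  by move=> k; exact: smooth_truncation.
(* Where |f| > y_(k+2), the truncated function is at least d - 3/K >= 3d/4, because K >= 12/d. The
   weak inequality can thus be used at the level d/2. *)
have step (k : nat) : (d / 2)%:E * l (y k.+2) `^ p <=
    c%:E * \int[m]_t (`|V k 1%N (f (row_of_tuple t))| * g t)%:E.
  have [dV V0 V1 Vb] := HV k.
  have cV : Cc_infty (V k 0%N \o f) by exact: Cc_infty_comp.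
  have d20 : (0 < d / 2)%R by rewrite divr_gt0.
  have := Hi _ _ (Cc_W011 cV) (d / 2)%R d20.
  rewrite (_ : intRn _ = \int[m]_t (`|V k 1%N (f (row_of_tuple t))| * g t)%:E); last first.
    have -> : (fun x => (vec_norm (fun i => pderiv i (V k 0%N \o f)) x)%:E) =
              (fun x => (grad_norm (V k 0%N \o f) x)%:E) by [].
    rewrite intRnE; last 2 first.
    - exact: Cc_grad_norm_borel.
    - by move=> x; exact: grad_norm_ge0.
    by apply: eq_integral => t _; rewrite grad_norm_comp.
  apply: le_trans; apply: lee_wpmul2l; first by rewrite lee_fin divr_ge0// ltW.
  have lV := (distr_like_lebRn (Cc_borel cV)).1 (d / 2)%R.
  apply: (gt0_ler_poweR (ltW p0)); rewrite ?in_itv/= ?leey ?lV ?andbT//.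
    exact: (distr_like_lebRn bf).1.
  rewrite /l !distrib_lebRnE//; last exact: Cc_borel.
  rewrite /distrib !setIT; apply: le_measure; rewrite ?inE.
  - rewrite -[X in measurable X]setTI.
    apply: emeasurable_fun_o_infty => //; apply: measurableT_comp => //.
    exact: (borel_EFin bf).
  - rewrite -[X in measurable X]setTI.
    apply: emeasurable_fun_o_infty => //; apply: measurableT_comp => //.
    exact: (borel_EFin (Cc_borel cV)).
  - move=> t /=; rewrite !lte_fin => /ltW /Vb; rewrite yd => h.
    apply: lt_le_trans (ler_norm _); apply: lt_le_trans h.
    have : (3 / K <= d / 4)%R.
      rewrite ler_pdivrMr// mulrAC ler_pdivlMr//.
      by move: K1; rewrite ler_pdivrMr// mulrC; lra.
    by lra.
rewrite ge0_sume_distrr; last by move=> k _; exact: poweR_ge0.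
apply: (@le_trans _ _ (\sum_(k < N)
    c%:E * \int[m]_t (`|V k 1%N (f (row_of_tuple t))| * g t)%:E)).
  by apply: lee_sum => k _; exact: step.
have bV k : borelRn (fun x => V k 1%N (f x)).
  have [dV _ _ _] := HV k; apply: continuous_borel => x.
  apply: continuous_comp; first exact: smooth_continuous.
  exact: derivative_chain_continuous.
have mV k : measurable_fun setT
    (fun t : n.-tuple R => (`|V k 1%N (f (row_of_tuple t))| * g t)%:E).
  apply/measurable_EFinP; apply: measurable_funM => //.
  by apply: measurableT_comp => //; exact: bV.
rewrite -ge0_sume_distrr; last first.
  by move=> k _; apply: integral_ge0 => t _; rewrite lee_fin mulr_ge0.
rewrite -ge0_integral_sum//; last by move=> k t _; rewrite lee_fin mulr_ge0.
(* The error 2 c I / (K d) is at most e by the choice of [K], which relies on I being finite. *)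
apply: (@le_trans _ _ (c%:E * (\int[m]_(t in E) (g t)%:E + (2 / (K * d))%:E * I))); last first.
  rewrite ge0_muleDr; last 2 first.
  - by apply: integral_ge0 => t _; rewrite lee_fin.
  - rewrite mule_ge0 ?lee_fin ?divr_ge0 ?mulr_ge0 ?(ltW K0) ?(ltW d0)//.
    by apply: integral_ge0 => t _; rewrite lee_fin.
  apply: leeD2l; rewrite -(fineK I_fin) -!EFinM lee_fin.
  move: K2; rewrite ler_pdivrMr ?mulr_gt0// => K2.
  have -> : (c * (2 / (K * d) * fine I) = (2 * c * fine I) / (K * d))%R.
    by field; rewrite !gt_eqF.
  rewrite ler_pdivrMr ?mulr_gt0//.
  by move: K2; rewrite !mulrDr mulr1 => K2; nra.
apply: lee_wpmul2l; first by rewrite lee_fin ltW.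
rewrite [X in _ <= X + _]integral_mkcond -ge0_integralZl//; last 2 first.
- by move=> t _; rewrite lee_fin.
- by rewrite lee_fin divr_ge0// mulr_ge0// ltW.
have mgE : measurable_fun setT ((fun t => (g t)%:E) \_ E).
  by apply/(measurable_restrictT _ _).1 => //; exact: measurable_funS mg.
rewrite -ge0_integralD//; last 3 first.
- by move=> t _; rewrite patchE; case: ifPn; rewrite ?lee_fin.
- by move=> t _; rewrite -EFinM lee_fin mulr_ge0// divr_ge0// mulr_ge0// ltW.
- by apply: emeasurable_funM.
apply: ge0_le_integral => //.
- by move=> t _; apply: sume_ge0 => k _; rewrite lee_fin mulr_ge0.
- by apply: emeasurable_sum => k.
- by apply: emeasurable_funD => //; apply: emeasurable_funM.
- move=> t _; rewrite sumEFin -mulr_suml.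
  set z := f (row_of_tuple t).
  have -> : ((fun t => (g t)%:E) \_ E) t = ((a < `|z|)%R%:R * g t)%:E.
    rewrite patchE; case: ifPn; first by rewrite inE /E/= => ->; rewrite mul1r.
    by rewrite notin_setE /E/= => /negP/negbTE ->; rewrite mul0r.
  rewrite -EFinM -EFinD -mulrDl lee_fin; apply: ler_wpM2r => //.
  rewrite -/(y _); apply: le_trans (sum_logistic z N K0 d0 a0).
  by apply: ler_sum => k _; have [_ _ -> _] := HV k.
Qed.

End TruncationInequality.

(** * From the weak embedding to the oscillation inequality *)

Section SymmetrizationInequality.
Local Open Scope ereal_scope.
Context {R : realType}.
Local Notation mu := (@lebesgue_measure R).

(** Riemann sums of mesh d. The factor 2 arises because each cell of length d was paid for at the
    truncation level d/2. *)
Lemma isocapacitary_integral n (c : R) (f : 'rV[R]_n -> R) (a p : R) :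
  (0 < c)%R -> (0 < p)%R ->
  (forall (f : 'rV[R]_n -> R) (g : 'I_n -> 'rV[R]_n -> R), W011 f g ->
      forall t : R, (0 < t)%R ->
        t%:E * (distrib (@lebRn R n) (fun x => (f x)%:E) t) `^ p
        <= c%:E * intRn (fun x => (vec_norm g x)%:E)) ->
  Cc_infty f -> (0 <= a)%R ->
  \int[mu]_(y in `[a, +oo[) (distrib (@lebRn R n) (fun x => (f x)%:E) y) `^ p
  <= (2 * c)%R%:E * \int[tuple_leb n]_(t in [set t | (a < `|f (row_of_tuple t)|)%R])
       (grad_norm f (row_of_tuple t))%:E.
Proof.
move=> c0 p0 Hi cf a0.
set l := distrib _ _; set G := \int[tuple_leb n]_(t in _) _.
have bf := Cc_borel cf; have dl := distr_like_lebRn bf.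
pose h y := l y `^ p.
have h0 y : 0 <= h y by exact: poweR_ge0.
have hni y z : (y <= z)%R -> h z <= h y.
  by move=> yz; apply: (gt0_ler_poweR (ltW p0)); rewrite ?in_itv/= ?leey ?andbT
    ?dl.1//; apply: dl.2.1.
have G0 : 0 <= G by apply: integral_ge0 => t _; rewrite lee_fin grad_norm_ge0.
have [B [B0 lB]] : exists B : R, (0 <= B)%R /\ forall y, (B <= y)%R -> h y = 0.
  have [_ [B [M [B0 _ hB _]]]] := Cc_bounded_support cf.
  exists B; split => // y By.
  have -> : h y = 0 `^ p; last by rewrite poweR0r// gt_eqF.
  congr (_ `^ _); rewrite /l distrib_lebRnE// /distrib setIT.
  have -> : [set x : n.-tuple R | y%:E < `|(f (row_of_tuple x))%:E|] = set0.
    by apply/seteqP; split => x //=; rewrite lte_fin ltNge (le_trans (hB _)).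
  by rewrite measure0.
have ha : h a \is a fin_num.
  rewrite ge0_fin_numE//; apply: poweR_lty.
  by apply: bounded_support_distrib => //; exact: Cc_bounded_support.
have ha0 : (0 <= fine (h a))%R by exact: fine_ge0.
apply/lee_addgt0Pr => e e0.
(* The terms of the Riemann sum at a and a + d are not reached by [isocapacitary_sum], which starts
   at a + 2d. With this mesh they total at most 2 d h(a) <= e. *)
pose d := (e / (2 * (fine (h a) + 1)))%R.
have d0 : (0 < d)%R by rewrite divr_gt0// mulr_gt0// ltr_wpDl.
have [N NB] : exists N : nat, (B <= N%:R * d)%R.
  exists (Num.Def.archi_bound (B / d)).
  rewrite -ler_pdivrMr//; apply: le_trans (ltW (archi_boundP _)) => //.
  by rewrite divr_ge0// ltW.
pose b := (a + N.+2%:R * d)%R.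
have Bb : (B <= b)%R.
  apply: le_trans NB _; rewrite -[leLHS]add0r lerD// ler_pM2r// ler_nat.
  by rewrite -addn2 leq_addr.
have ab : (a <= b)%R by rewrite lerDl mulr_ge0// ltW.
have mh (i : interval R) : measurable_fun [set` i] h.
  by apply: nonincreasing_emeasurable; [exact: interval_is_interval|move=> s t _ _; exact: hni].
rewrite (@itv_bndbnd_setU _ _ _ (BLeft b)) ?bnd_simp//.
rewrite ge0_integral_setU//=; last 3 first.
- by rewrite -itv_bndbnd_setU ?bnd_simp//; exact: mh.
- by move=> x _; exact: h0.
- apply/disj_setPS => x [] /=; rewrite !in_itv/= => /andP[_ xb]; rewrite andbT => bx.
  by move: xb; rewrite ltNge bx.
rewrite [X in _ + X](_ : _ = 0) ?adde0; last first.
  apply: integral0_eq => y /=; rewrite in_itv/= andbT => by_.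
  by apply: lB; exact: le_trans by_.
have := @riemann_sum_ge _ h a d N.+2 (fun y _ => h0 y) (fun y z _ => @hni y z) d0.
rewrite -/b => /le_trans; apply.
rewrite 2!big_ord_recl/= mul0r addr0 /bump/= !add1n mul1r.
have S0 : 0 <= (\sum_(i < N) h (a + i.+2%:R * d)%R)%R.
  by apply: sume_ge0 => k _.
rewrite addeA ge0_muleDr ?adde_ge0//.
rewrite [leLHS]addeC; apply: leeD.
- have := @isocapacitary_sum _ n c f a d p N c0 p0 Hi cf a0 d0.
  rewrite -/l -/G.
  move=> /(lee_wpmul2l (x := 2%:E)); rewrite lee_fin => /(_ (ler0n _ _)).
  rewrite !muleA -!EFinM (_ : (2 * (d / 2) = d)%R); last by field.
  exact.
- apply: (@le_trans _ _ (d%:E * (h a + h a))).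
    by apply: lee_wpmul2l; [rewrite lee_fin ltW|apply: leeD2l; apply: hni; rewrite lerDl ltW].
  rewrite -(fineK ha) -EFinD -EFinM lee_fin /d.
  rewrite mulrAC ler_pdivrMr ?mulr_gt0 ?ltr_wpDl//.
  by apply: ler_wpM2l; [exact: ltW|lra].
Qed.

(** Level by level: the part of E where f > y has measure at most both t and lambda(y), and min(t,
    lambda(y)) is the layer of the right-hand side. *)
Lemma integral_superlevel_le n (f : 'rV[R]_n -> R) (E : set (n.-tuple R)) (t : R) :
  borelRn f -> (forall x, 0 <= f x)%R -> measurable E ->
  (0 <= t)%R -> tuple_leb n E <= t%:E ->
  \int[tuple_leb n]_(u in E) (f (row_of_tuple u))%:E <=
  \int[mu]_(s in `]0%R, t]) rstar f s.
Proof.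
move=> bf f0 mE t0 Et; have dl := distr_like_lebRn bf.
rewrite /rstar rearrE integral_ginv// layer_cake//; last 2 first.
- by apply: measurable_funS (borel_EFin bf).
- by move=> u _; rewrite lee_fin.
have mS (y : R) : measurable [set u : n.-tuple R | y%:E < (f (row_of_tuple u))%:E].
  rewrite -[X in measurable X]setTI; apply: emeasurable_fun_o_infty => //.
  exact: (borel_EFin bf).
have mp := @measurable_pos_itv R.
apply: ge0_le_integral => //.
- apply: nonincreasing_emeasurable; first exact: interval_is_interval.
  move=> y z _ _ yz; apply: le_measure; rewrite ?inE; try exact: measurableI.
  by apply: setIS => u /=; apply: le_lt_trans; rewrite lee_fin.
- by apply: measurable_mine => //; exact: distr_like_measurable.
- move=> y _; rewrite le_min; apply/andP; split.
    apply: le_trans Et; apply: le_measure; rewrite ?inE;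
      [exact: measurableI|exact: mE|exact: subIsetl].
  rewrite distrib_lebRnE// /distrib setIT.
  have -> : [set x : n.-tuple R | y%:E < `|(f (row_of_tuple x))%:E|] =
            [set x | y%:E < (f (row_of_tuple x))%:E].
    by apply/seteqP; split => u /=; rewrite ger0_norm.
  by apply: le_measure; rewrite ?inE;
    [exact: measurableI|exact: mS|exact: subIsetr].
Qed.

(* The double integral defining the left-hand side is computed by integrating
   first in s for a fixed level y. *)
Lemma integral_oscillation_le n (f : 'rV[R]_n -> R) (t : R) : (2 <= n)%N ->
  bounded_support f -> (0 < t)%R ->
  \int[mu]_(s in `]0%R, t])
     ((s `^ (- n%:R^-1))%R%:E * (rstarstar f s - rstar f s)) <=
  n%:R%:E * \int[mu]_(y in `[fine (rstar f t), +oo[)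
     (distrib (@lebRn R n) (fun x => (f x)%:E) y) `^ ((n%:R - 1) / n%:R)%R.
Proof.
move=> n2 bsf t0; have [bf _] := bsf; have dl := distr_like_lebRn bf.
set l := distrib _ _ in dl *; set a := fine _.
have n0 : (0 < n%:R :> R)%R by rewrite ltr0n (leq_trans _ n2).
pose q := (n%:R^-1 : R)%R; have q0 : (0 < q)%R by rewrite invr_gt0.
have -> : ((n%:R - 1) / n%:R = 1 - q :> R)%R by rewrite mulrBl divff ?gt_eqF// mul1r.
have q1 : (q < 1)%R by rewrite invf_lt1// ltr1n.
have fa : rstar f t = a%:E by rewrite fineK// bounded_support_rstar_fin// ltW.
have a0 : (0 <= a)%R by rewrite -lee_fin -fa; exact: ginv_ge0.
have mp := @measurable_pos_itv R.
have ml := distr_like_measurable dl.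
pose k (s : R) := (s `^ (- q - 1))%R%:E.
have mk : measurable_fun (@pos_itv R) k.
  by apply/measurable_EFinP; apply: measurable_funS (measurable_powR _).
have k0 s : 0 <= k s by rewrite lee_fin powR_ge0.
pose lp := l \_ (@pos_itv R).
have mlp : measurable_fun setT lp by apply/(measurable_restrictT _ _).1.
(* The restriction s <= t is part of [B]; [lp] extends [l] by zero so that [B] is measurable in the
   whole plane. *)
pose B := [set sy : R * R | (sy.1 <= t)%R /\ lp sy.2 <= sy.1%:E].
have mB : measurable B.
  have -> : B = (setT `&` [set sy | (sy.1)%:E <= cst t%:E sy]) `&`
                (setT `&` [set sy | lp sy.2 <= (sy.1)%:E]).
    by rewrite /B; apply/seteqP; split=> -[x y]/=; rewrite lee_fin; tauto.
  apply: measurableI; apply: measurable_lee => //.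
  - by apply/measurable_EFinP; exact: measurable_fst.
  - by apply: measurableT_comp => //; exact: measurable_snd.
  - by apply/measurable_EFinP; exact: measurable_fst.
have lpE y : (0 < y)%R -> lp y = l y.
  by move=> y0; rewrite /lp patchE mem_set// pos_itvE.
have step1 : \int[mu]_(s in `]0%R, t])
     ((s `^ (- n%:R^-1))%R%:E * (rstarstar f s - rstar f s)) =
   \int[mu]_(s in @pos_itv R) (k s * \int[mu]_(y in @pos_itv R `&` xsection B s) l y).
  rewrite [LHS]integral_mkcond [RHS]integral_mkcond; apply: eq_integral => s _.
  rewrite !patchE mem_setE in_itv/= mem_setE in_itv/= andbT.
  have [s0|//] := ltP 0%R s; rewrite /=; case: ifPn => st.
    rewrite mean_fun_sub//; last exact: (bounded_support_rstar_fin bsf (ltW s0)).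
    rewrite muleA -EFinM; congr (_ * _).
      congr (_%:E); rewrite powRD ?(gt_eqF s0) ?implybT//.
      by rewrite powR_inv1// ltW.
    congr integral; apply/seteqP; split => y /= [yp] H; split => //;
      move: yp H; rewrite /xsection/= pos_itvE => y0; rewrite ?inE /B/= ?lpE// => H.
    by case: H.
  rewrite (_ : _ `&` _ = set0) ?integral_set0 ?mule0//.
  by apply/seteqP; split => y //= -[_]; rewrite /xsection/= inE => -[/= st'] _;
    rewrite st' in st.
rewrite step1 tonelli_pos//; last by move=> s _; exact: dl.1.
rewrite -ge0_integralZl//; last 2 first.
- apply: nonincreasing_emeasurable; first exact: interval_is_interval.
  move=> y z _ _ yz; apply: (gt0_ler_poweR (r := (1 - q)%R)); rewrite ?in_itv/= ?leey ?andbT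
    ?dl.1//; [by rewrite subr_ge0 ltW|exact: dl.2.1].
- by move=> y _; exact: poweR_ge0.
pose J y := \int[mu]_(s in @pos_itv R `&` ysection B y) k s.
have mBy y : measurable (@pos_itv R `&` ysection B y).
  by apply: measurableI => //; exact: measurable_ysection.
have J0 y : 0 <= J y by exact: integral_ge0.
have mJ : measurable_fun (@pos_itv R) J.
  rewrite (_ : J = -%E \o (fun y => - J y)); last first.
    by apply/funext => y /=; rewrite oppeK.
  apply: measurableT_comp => //.
  apply: nonincreasing_emeasurable; first exact: interval_is_interval.
  move=> y z; rewrite !pos_itvE => y0 z0 yz; rewrite leeN2.
  apply: ge0_subset_integral; [exact: mBy|exact: mBy| |by []|].
    by apply: measurable_funS mk => //; exact: subIsetl.
  apply: setIS => s; rewrite /ysection/= !inE /B/= !lpE// => -[-> ls]; split => //.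
  by apply: le_trans ls; exact: dl.2.1.
rewrite -/J [leLHS]integral_mkcond [leRHS]integral_mkcond.
apply: ge0_le_integral => //.
- move=> y _; rewrite patchE; case: ifPn => // _.
  by rewrite mule_ge0 ?dl.1//; exact: J0.
- apply/(measurable_restrictT _ _).1 => //; exact: emeasurable_funM.
- apply/(measurable_restrictT _ _).1 => //; apply: emeasurable_funM => //.
  apply: nonincreasing_emeasurable; first exact: interval_is_interval.
  move=> y z _ _ yz; apply: (gt0_ler_poweR (r := (1 - q)%R)); rewrite ?in_itv/= ?leey ?andbT
    ?dl.1//; [by rewrite subr_ge0 ltW|exact: dl.2.1].
move=> y _; rewrite !patchE !mem_setE !in_itv/= !andbT.
case: ifPn => y0; last first.
  by case: ifPn => // _; rewrite mule_ge0 ?lee_fin ?poweR_ge0// ltW.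
(* Levels with lambda(y) > t admit no s in (lambda(y), t] and contribute nothing. The others satisfy
   y >= f^*(t), which gives the lower limit of integration. *)
have [lt|tl] := leP (l y) t%:E; last first.
  rewrite /J (_ : _ `&` _ = set0) ?integral_set0 ?mule0.
    by case: ifPn => // _; rewrite mule_ge0 ?lee_fin ?poweR_ge0// ltW.
  apply/seteqP; split => s //= -[_]; rewrite /ysection/= inE /B/= lpE// => -[st ls].
  by move: (lt_le_trans tl ls); rewrite lte_fin ltNge st.
have -> : (a <= y)%R.
  by rewrite -lee_fin -fa; rewrite /rstar rearrE ginv_le// ltW.
have lf : l y \is a fin_num.
  by rewrite ge0_fin_numE ?dl.1//; apply: le_lt_trans lt _; rewrite ltry.
have [r lr] : exists r, l y = r%:E by exists (fine (l y)); rewrite fineK.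
have r0 : (0 <= r)%R by rewrite -lee_fin -lr dl.1.
rewrite lr poweR_EFin; move: r0; rewrite le_eqVlt => /predU1P[<-|r0].
  by rewrite mul0e mule_ge0 ?lee_fin ?powR_ge0// ltW.
have rt : (r <= t)%R by rewrite -lee_fin -lr.
(* Integrating s^(-q-1) from r on gives r^(-q)/q, and 1/q = n is the factor in the statement. *)
apply: (@le_trans _ _ (r%:E * (q^-1 * r `^ (- q))%R%:E)).
  apply: lee_wpmul2l; first by rewrite lee_fin ltW.
  apply: le_trans (integral_powR_tail q0 r0 rt).
  apply: ge0_subset_integral; [exact: mBy|exact: measurable_itv| |by []|].
  - apply: measurable_funS mk => // s /=; rewrite pos_itvE in_itv/= => /andP[rs _].
    exact: lt_le_trans rs.
  - move=> s /= [_]; rewrite /ysection/= inE /B/= lpE// lr lee_fin in_itv/= => -[-> ->].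
    by [].
rewrite -!EFinM lee_fin /q invrK mulrCA; apply: ler_wpM2l; first exact: ltW.
by rewrite powRD ?(gt_eqF r0) ?implybT// powRr1// ltW.
Qed.

Lemma stmt_i_ii n : (2 <= n)%N -> stmt_i R n -> stmt_ii R n.
Proof.
move=> n2 [c [c0 Hi]]; exists (2 * c)%R; split; first by rewrite mulr_gt0.
move=> f cf t t0.
have bsf := Cc_bounded_support cf; have [bf _] := bsf.
have dl := distr_like_lebRn bf.
have n0 : (0 < n%:R :> R)%R by rewrite ltr0n (leq_trans _ n2).
have p0 : (0 < (n%:R - 1) / n%:R :> R)%R.
  by rewrite divr_gt0// subr_gt0 ltr1n.
apply: le_trans (integral_oscillation_le n2 bsf t0) _.
set a := fine _.
have fa : rstar f t = a%:E by rewrite fineK// bounded_support_rstar_fin// ltW.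
have a0 : (0 <= a)%R by rewrite -lee_fin -fa; exact: ginv_ge0.
have := isocapacitary_integral c0 p0 Hi cf a0.
move=> /(lee_wpmul2l (x := n%:R%:E)); rewrite lee_fin => /(_ (ltW n0)).
move=> /le_trans; apply; rewrite muleA -EFinM mulrC.
apply: lee_wpmul2l; first by rewrite lee_fin !mulr_ge0// ltW.
(* The set where |f| exceeds f^*(t) has measure at most t, so [integral_superlevel_le] applies to
   it. *)
set E := [set _ | _].
have EE : E = [set x : n.-tuple R | a%:E < `|(f (row_of_tuple x))%:E|].
  by apply/seteqP; split => u /=; rewrite lte_fin.
apply: integral_superlevel_le => //.
- exact: Cc_grad_norm_borel.
- by move=> x; exact: grad_norm_ge0.
- rewrite EE -[X in measurable X]setTI; apply: emeasurable_fun_o_infty => //.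
  by apply: measurableT_comp => //; exact: (borel_EFin bf).
- exact: ltW.
- have : rstar f t <= a%:E by rewrite fa.
  rewrite /rstar rearrE ginv_le// distrib_lebRnE// /distrib setIT.
  by rewrite EE.
Qed.

End SymmetrizationInequality.

(** * The Hardy--Littlewood--Polya principle *)

Section Majorization.
Context {R : realType}.

(* Hardy--Littlewood--Polya through Robin Hood transfers: each transfer is a
   convex combination of y with one of its transpositions and decreases the
   number of indices where x and y differ. *)
Lemma majorization_le N (Phi : ('I_N -> R) -> \bar R) (x y : 'I_N -> R) :
  (forall u v : 'I_N -> R, (forall j, 0 <= u j <= v j) -> (Phi u <= Phi v)%E) ->
  (forall (u : 'I_N -> R) (i k : 'I_N) (w : R), (forall j, 0 <= u j) -> 0 <= w <= 1 ->
     (Phi (fun j => w * u (tperm i k j) + (1 - w) * u j)%R <= Phi u)%E) ->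
  (forall j, 0 <= x j) -> (forall j, 0 <= y j) ->
  (forall i k : 'I_N, (i <= k)%N -> x k <= x i) ->
  (forall m : nat, \sum_(j < N | (j < m)%N) x j <= \sum_(j < N | (j < m)%N) y j) ->
  (Phi x <= Phi y)%E.
Proof.
move=> Pmono Pconv x0 + xni.
have [c] := ubnP #|[pred j | x j != y j]|.
elim: c y => // c IH y /ltnSE yc y0 maj.
have [xy|/existsP[k0 k0P]] := boolP [forall j, x j <= y j].
  by apply: Pmono => j; rewrite x0/=; exact: (forallP xy).
have Pk0 : y k0 < x k0 by rewrite ltNge.
(* k is the first index where y falls below x. The prefix sum up to k then forces an earlier j with
   y_j > x_j. *)
case: (@arg_minnP _ k0 (fun k => y k < x k) val Pk0) => k yk kmin.
have ltk (i : 'I_N) : (i < k)%N -> x i <= y i.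
  by move=> ik; rewrite leNgt; apply/negP => /kmin; rewrite leqNgt ik.
have [j [jk xj]] : exists j : 'I_N, (j < k)%N /\ x j < y j.
  apply: contrapT => /forallNP H.
  have eqk (i : 'I_N) : (i < k)%N -> x i = y i.
    move=> ik; apply/eqP; rewrite eq_le ltk//= leNgt; apply/negP => xy.
    by apply: (H i).
  have := maj k.+1.
  rewrite (bigD1 k)//= [leRHS](bigD1 k)//=.
  rewrite (eq_bigr y); last first.
    move=> i /andP[ik nik]; apply: eqk; rewrite ltn_neqAle -ltnS ik andbT.
    by apply: contra nik => /eqP ik'; apply/eqP/val_inj.
  by rewrite lerD2r leNgt yk.
have njk : j != k by apply: contraTneq jk => ->; rewrite ltnn.
(* The largest transfer from j to k that overshoots neither x_j nor x_k: after it one of these two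
   entries agrees with x. *)
pose d := Num.min (y j - x j) (x k - y k).
have d0 : 0 < d by rewrite lt_min !subr_gt0 xj yk.
have dj : d <= y j - x j by rewrite ge_min lexx.
have dk : d <= x k - y k by rewrite ge_min lexx orbT.
have xkj : x k <= x j by apply: xni; exact: ltnW.
have yjk : 0 < y j - y k by rewrite subr_gt0 (lt_trans yk)// (le_lt_trans xkj).
pose w := d / (y j - y k).
have w01 : 0 <= w <= 1.
  by rewrite divr_ge0 ?(ltW d0) ?(ltW yjk)//= ler_pdivrMr// mul1r; lra.
have wd : w * (y j - y k) = d by rewrite divfK// gt_eqF.
pose y' i := w * y (tperm j k i) + (1 - w) * y i.
have y'j : y' j = y j - d by rewrite /y' tpermL -wd; ring.
have y'k : y' k = y k + d by rewrite /y' tpermR -wd; ring.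
have y'D i : i != j -> i != k -> y' i = y i.
  by move=> ij ik; rewrite /y' tpermD 1?eq_sym//; ring.
apply: le_trans (Pconv y j k w y0 w01).
rewrite -/y'; apply: IH.
- apply: leq_trans yc; apply: proper_card; apply/properP; split.
    apply/fintype.subsetP => i; rewrite !inE; apply: contra => /eqP xyi.
    have [ij|ij] := eqVneq i j; first by move: xyi xj; rewrite ij => ->; rewrite ltxx.
    have [ik|ik] := eqVneq i k; first by move: xyi yk; rewrite ik => ->; rewrite ltxx.
    by rewrite y'D// xyi.
  have : (d == y j - x j) || (d == x k - y k) by rewrite /d; case: leP; rewrite eqxx ?orbT.
  case/orP => /eqP dE; [exists j|exists k]; rewrite inE.
  + by rewrite lt_eqF.
  + by rewrite y'j dE negbK subKr.
  + by rewrite gt_eqF.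
  + by rewrite y'k dE negbK addrC subrK.
- move=> i; have [->|ij] := eqVneq i j; first by rewrite y'j; have := x0 j; lra.
  have [->|ik] := eqVneq i k; first by rewrite y'k; have := y0 k; lra.
  by rewrite y'D.
(* A prefix containing both j and k keeps its sum. A shorter one is compared termwise, since x_i <=
   y_i before k and y_j still dominates x_j after the transfer. *)
move=> m; have [km|mk] := ltnP k m.
  have jm := ltn_trans jk km.
  apply: le_trans (maj m) _.
  rewrite (bigD1 j)//= (bigD1 k)//=; last by rewrite km eq_sym.
  rewrite [leRHS](bigD1 j)//= [X in _ <= _ + X](bigD1 k)//=; last by rewrite km eq_sym.
  rewrite y'j y'k (eq_bigr y'); first by lra.
  by move=> i /andP[/andP[_ ij] ik]; rewrite y'D.
have [jm|mj] := ltnP j m.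
  rewrite (bigD1 j)//= [leRHS](bigD1 j)//=; apply: lerD; first by rewrite y'j; lra.
  apply: ler_sum => i /andP[im ij]; rewrite y'D//; first by apply: ltk; exact: leq_trans mk.
  by apply: contraTneq im => ->; rewrite -leqNgt.
apply: ler_sum => i im; rewrite y'D; first by apply: ltk; exact: leq_trans mk.
- by apply: contraTneq im => ->; rewrite -leqNgt.
- by apply: contraTneq im => ->; rewrite -leqNgt.
Qed.

End Majorization.

(** * Step functions on equal cells *)

Section StepFunctions.
Local Open Scope ereal_scope.
Context {R : realType}.
Local Notation mu := (@lebesgue_measure R).
Variables (d : R) (N : nat).
Hypothesis d0 : (0 < d)%R.
Implicit Types (x : 'I_N -> R) (j : 'I_N).

Definition cell (j : nat) : set R := `](j%:R * d)%R, (j.+1%:R * d)%R]%classic.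

Definition step x (s : R) : R := (\sum_(j < N) x j * \1_(cell j) s)%R.

Lemma cellE (j : nat) s : cell j s = (j%:R * d < s <= j.+1%:R * d)%R :> Prop.
Proof. by rewrite /cell/= in_itv. Qed.

Lemma cell_inj (i j : nat) s : cell i s -> cell j s -> i = j.
Proof.
rewrite !cellE => /andP[i1 i2] /andP[j1 j2].
have := lt_le_trans i1 j2; have := lt_le_trans j1 i2.
by rewrite !ltr_pM2r// !ltr_nat !ltnS => ij ji; apply/eqP; rewrite eqn_leq ij ji.
Qed.

Lemma cell_exists s : (0 < s)%R -> (s <= N%:R * d)%R -> exists j : 'I_N, cell j s.
Proof.
move=> s0; elim: N => [|M IH]; first by rewrite mul0r leNgt s0.
have [sM _|sM sM1] := leP s (M%:R * d)%R.
  by have [j jP] := IH sM; exists (widen_ord (leqnSn M) j).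
by exists ord_max; rewrite cellE sM sM1.
Qed.

Lemma cell_pos (j : nat) s : cell j s -> (0 < s)%R.
Proof. by rewrite cellE => /andP[+ _]; apply: le_lt_trans; rewrite mulr_ge0// ltW. Qed.

Lemma measurable_cell (j : nat) : measurable (cell j).
Proof. exact: measurable_itv. Qed.

Lemma cell_measure (j : nat) : mu (cell j) = d%:E.
Proof.
rewrite /cell lebesgue_measure_itv/= lte_fin ltr_pM2r// ltr_nat ltnSn -EFinD.
by congr (_%:E); rewrite -natr1; ring.
Qed.

Lemma step_in x j s : cell j s -> step x s = x j.
Proof.
move=> js; rewrite /step (bigD1 j)//= indicE mem_set// mulr1 big1 ?addr0// => i ij.
rewrite indicE memNset ?mulr0// => is_; move/eqP: ij; apply.
by apply/val_inj; exact: cell_inj js.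
Qed.

Lemma step_out x s : (forall j : 'I_N, ~ cell j s) -> step x s = 0%R.
Proof. by move=> H; rewrite /step big1// => j _; rewrite indicE memNset ?mulr0. Qed.

Lemma step_ge0 x s : (forall j, 0 <= x j)%R -> (0 <= step x s)%R.
Proof. by move=> x0; apply: sumr_ge0 => j _; rewrite mulr_ge0. Qed.

Lemma measurable_step x (D : set R) : measurable_fun D (step x).
Proof.
apply: (@measurable_funS _ _ _ _ setT) => //.
apply: measurable_sum => j; apply: measurable_funM => //.
by apply: measurable_indic; exact: measurable_cell.
Qed.

Lemma Mplus_step x : (forall j, 0 <= x j)%R -> Mplus (fun s => (step x s)%:E).
Proof.
move=> x0; split; first by apply/measurable_EFinP; exact: measurable_step.
by move=> s _; rewrite lee_fin step_ge0.
Qed.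

Lemma integral_step x : (forall j, 0 <= x j)%R ->
  \int[mu]_(s in @pos_itv R) (step x s)%:E = (\sum_(j < N) x j * d)%R%:E.
Proof.
move=> x0; under eq_integral do rewrite /step -sumEFin.
have mI (j : 'I_N) : measurable_fun (@pos_itv R) (fun s => (\1_(cell j) s : R)%:E).
  apply: (@measurable_funS _ _ _ _ setT) => //.
  by apply/measurable_EFinP; apply: measurable_indic; exact: measurable_cell.
rewrite ge0_integral_sum//=; last 3 first.
- exact: measurable_pos_itv.
- move=> j; apply/measurable_EFinP; apply: measurable_funM => //.
  by apply/measurable_EFinP; exact: mI.
- by move=> j s _; rewrite lee_fin mulr_ge0.
rewrite -sumEFin; apply: eq_bigr => j _.
under eq_integral do rewrite EFinM.
rewrite ge0_integralZl; last 4 first.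
- exact: measurable_pos_itv.
- exact: mI.
- by move=> s _; rewrite lee_fin.
- by rewrite lee_fin.
rewrite integral_indic//; last 2 first.
- exact: measurable_pos_itv.
- exact: measurable_cell.
rewrite EFinM; congr (_ * _); rewrite -[RHS](cell_measure j); congr (mu _).
by apply: setIidl => s /cell_pos; rewrite pos_itvE.
Qed.

(** Only the multiset of values enters, whence rearrangement invariance will give permutation
    invariance. *)
Lemma distrib_step x y : (forall j, 0 <= x j)%R -> (0 <= y)%R ->
  distrib (@leb_pos R) (fun s => (step x s)%:E) y = (\sum_(j < N) (y < x j)%R%:R * d)%R%:E.
Proof.
move=> x0 y0; rewrite -integral_step//.
have mS : measurable ([set s | y%:E < `|(step x s)%:E|] `&` @pos_itv R).
  rewrite setIC; apply: emeasurable_fun_o_infty; first exact: measurable_pos_itv.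
  by apply: measurableT_comp => //; apply/measurable_EFinP; exact: measurable_step.
rewrite /distrib /leb_pos -[X in mu X]setIT -integral_indic//.
rewrite [RHS]integral_mkcond; apply: eq_integral => s _.
rewrite patchE indicE in_setI; case: ifPn => [sp|_]; last by rewrite andbF.
rewrite andbT; congr (_%:E).
have [[j js]|nj] := pselect (exists j : 'I_N, cell j s).
  rewrite (step_in _ js); congr (nat_of_bool _)%:R; apply/idP/idP; rewrite inE/= (step_in _ js) lte_fin ger0_norm//.
rewrite step_out; last by move=> j js; apply: nj; exists j.
rewrite memNset//= step_out; last by move=> j js; apply: nj; exists j.
by rewrite normr0 lte_fin ltNge y0.
Qed.

End StepFunctions.

(** Clear the denominator and split the inner sums at m: pairs inside the prefix match by symmetry,
    and an entry after the prefix is at most any entry inside it. *)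
Lemma prefix_average {R : realType} N (y : 'I_N -> R) (m : nat) :
  (forall i k : 'I_N, (i <= k)%N -> y k <= y i) ->
  \sum_(j < N | (j < m)%N) (\sum_k y k) / N%:R <= \sum_(j < N | (j < m)%N) y j.
Proof.
move=> yni; case: N y yni => [|N] y yni; first by rewrite !big_ord0.
have N0 : (0 < N.+1%:R :> R) by rewrite ltr0n.
rewrite -mulr_suml ler_pdivrMr// mulr_suml.
have -> : \sum_(i < N.+1 | (i < m)%N) y i * N.+1%:R =
          \sum_(i < N.+1 | (i < m)%N) \sum_(k < N.+1) y i.
  by apply: eq_bigr => i _; rewrite sumr_const card_ord mulr_natr.
under eq_bigr do rewrite (bigID (fun k : 'I_N.+1 => (k < m)%N))/=.
under [leRHS]eq_bigr do rewrite (bigID (fun k : 'I_N.+1 => (k < m)%N))/=.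
rewrite big_split [leRHS]big_split/=; apply: lerD.
  by rewrite [leLHS]exchange_big.
apply: ler_sum => i im; apply: ler_sum => k mk; apply: yni.
by rewrite ltnW// (leq_trans im)// leqNgt.
Qed.

(** * Rearrangement invariant norms of step functions *)

Section RiNorm.
Local Open Scope ereal_scope.
Context {R : realType}.
Local Notation mu := (@lebesgue_measure R).
Variable rho : (R -> \bar R) -> \bar R.
Hypothesis Hr : ri_norm rho.
Implicit Types (f g a b : R -> \bar R).

Lemma rho_ge0 f : Mplus f -> 0 <= rho f.
Proof. by case: Hr => + _; exact. Qed.

Lemma rho_homog f (c : R) : Mplus f -> (0 <= c)%R ->
  rho (fun s => c%:E * f s) = c%:E * rho f.
Proof. by case: Hr => _ [_ [+ _]]; exact. Qed.

Lemma rho_triangle f g : Mplus f -> Mplus g ->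
  rho (fun s => f s + g s) <= rho f + rho g.
Proof. by case: Hr => _ [_ [_ [+ _]]]; exact. Qed.

Lemma rho_mono f g : Mplus f -> Mplus g -> (forall s, (0 < s)%R -> g s <= f s) ->
  rho g <= rho f.
Proof.
move=> Mf Mg gf; case: Hr => _ [_ [_ [_ [H _]]]]; apply: H => //.
by apply: aeW => s; rewrite pos_itvE; exact: gf.
Qed.

Lemma rho_eq f g : Mplus f -> Mplus g -> (forall s, (0 < s)%R -> f s = g s) ->
  rho f = rho g.
Proof.
move=> Mf Mg fg; apply/eqP; rewrite eq_le.
by apply/andP; split; apply: rho_mono => // s s0; rewrite fg.
Qed.

Lemma rho_ri f g : Mplus f -> Mplus g -> rstar_pos f = rstar_pos g -> rho f = rho g.
Proof. by case: Hr => _ [_ [_ [_ [_ [_ [_ [_ +]]]]]]]; exact. Qed.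

Lemma rho_fatou_le (fk : nat -> R -> \bar R) f (M : \bar R) :
  (forall k, Mplus (fk k)) -> Mplus f ->
  (forall s, (0 < s)%R -> (forall k, fk k s <= fk k.+1 s) /\
     fk k s @[k --> \oo] --> f s) ->
  (forall k, rho (fk k) <= M) -> rho f <= M.
Proof.
move=> Mfk Mf mono le; case: Hr => _ [_ [_ [_ [_ [H _]]]]].
have cv : rho (fk k) @[k --> \oo] --> rho f.
  by apply: H => //; apply: aeW => s; rewrite pos_itvE; exact: mono.
rewrite -(cvg_lim _ cv)//; apply: lime_le; first by apply/cvg_ex; eexists; exact: cv.
exact: nearW.
Qed.

Lemma rho_fin_indic (E : set R) : measurable E -> E `<=` @pos_itv R ->
  mu E < +oo -> rho (fun s => (\1_E s : R)%:E) < +oo.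
Proof. by case: Hr => _ [_ [_ [_ [_ [_ [+ _]]]]]]; exact. Qed.

Lemma rho_local f (E : set R) : measurable E -> E `<=` @pos_itv R ->
  mu E < +oo -> Mplus f -> rho f < +oo -> \int[mu]_(s in E) f s < +oo.
Proof.
move=> mE Ep Ef Mf rf; case: Hr => _ [_ [_ [_ [_ [_ [_ [+ _]]]]]]].
move=> /(_ E mE Ep Ef)[C [C0 /(_ f Mf)]] /le_lt_trans; apply.
by apply: lte_mul_pinfty; rewrite ?lee_fin.
Qed.

Section Steps.
Variables (d : R) (N : nat).
Hypothesis d0 : (0 < d)%R.
Local Notation st := (@step R d N).

Lemma rho_step_tperm (x : 'I_N -> R) i k : (forall j, 0 <= x j)%R ->
  rho (fun s => (st (x \o tperm i k) s)%:E) = rho (fun s => (st x s)%:E).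
Proof.
move=> x0; apply: rho_ri; try exact: Mplus_step.
  by apply: Mplus_step => // j; exact: x0.
rewrite /rstar_pos !rearrE; apply: eq_ginv => y y0.
rewrite !distrib_step//; last by move=> j; exact: x0.
rewrite (reindex_inj (@perm_inj _ (tperm i k)))/=; congr (_%:E).
by apply: eq_bigr => j _; rewrite /= tpermK.
Qed.

(** Permutation invariance makes the norm symmetric in the values; homogeneity and the triangle
    inequality make it convex. *)
Lemma rho_step_majorization (x y : 'I_N -> R) :
  (forall j, 0 <= x j)%R -> (forall j, 0 <= y j)%R ->
  (forall i k : 'I_N, (i <= k)%N -> x k <= x i)%R ->
  (forall m : nat, \sum_(j < N | (j < m)%N) x j <= \sum_(j < N | (j < m)%N) y j)%R ->
  rho (fun s => (st x s)%:E) <= rho (fun s => (st y s)%:E).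
Proof.
move=> x0 y0 xni maj.
apply: (@majorization_le _ _ (fun x => rho (fun s => (st x s)%:E)) x y) => //.
- move=> u v uv; have u0 j : (0 <= u j)%R by have /andP[] := uv j.
  have v0 j : (0 <= v j)%R by have /andP[/le_trans] := uv j; apply.
  apply: rho_mono; try exact: Mplus_step.
  move=> s _; rewrite lee_fin; apply: ler_sum => j _.
  by apply: ler_wpM2r => //; have /andP[] := uv j.
- move=> u i k w u0 /andP[w0 w1].
  have w1' : (0 <= 1 - w)%R by rewrite subr_ge0.
  have u0' j : (0 <= (u \o tperm i k) j)%R by exact: u0.
  have M1 := Mplus_step d u0; have M2 := Mplus_step d u0'.
  have Msc (z : 'I_N -> R) (c : R) : (forall j, 0 <= z j)%R -> (0 <= c)%R ->
      Mplus (fun s => c%:E * (st z s)%:E).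
    move=> z0 c0; split; last by move=> s _; rewrite -EFinM lee_fin mulr_ge0 ?step_ge0.
    by apply/measurable_EFinP; apply: measurable_funM => //; exact: measurable_step.
  have -> : (fun s => (st (fun j => (w * u (tperm i k j) + (1 - w) * u j)%R) s)%:E) =
      (fun s => w%:E * (st (u \o tperm i k) s)%:E + (1 - w)%R%:E * (st u s)%:E).
    apply/funext => s; rewrite -!EFinM -EFinD /step !mulr_sumr -big_split/=.
    by congr (_%:E); apply: eq_bigr => j _; rewrite mulrDl !mulrA.
  apply: le_trans (rho_triangle (Msc _ _ u0' w0) (Msc _ _ u0 w1')) _.
  rewrite !rho_homog// rho_step_tperm//.
  have r0 := rho_ge0 M1.
  by rewrite -ge0_muleDl ?lee_fin// -EFinD addrC subrK mul1e.
Qed.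

End Steps.

(** Averaging a nonincreasing function over (0,d] does not increase its norm: on a grid the constant
    mean is majorized by the values themselves. *)
Lemma rho_indic_average b (d c : R) : Mplus b ->
  (forall s t, (0 < s)%R -> (s <= t)%R -> b t <= b s) ->
  (forall s, (0 < s)%R -> b s \is a fin_num) ->
  (0 < d)%R -> (0 <= c)%R -> (c * d)%R%:E <= \int[mu]_(s in `]0%R, d]) b s ->
  rho (fun s => (c * \1_(`]0%R, d]) s)%R%:E) <= rho b.
Proof.
move=> Mb bni bf d0 c0 cd.
have b0 s : (0 < s)%R -> 0 <= b s by exact: Mb.2.
have sub : `]0%R, d] `<=` @pos_itv R.
  by move=> s /=; rewrite pos_itvE in_itv/= => /andP[].
have MI : Mplus (fun s => (\1_(`]0%R, d]) s : R)%:E).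
  split; last by move=> s _; rewrite lee_fin.
  by apply/measurable_EFinP; apply: measurable_indic; exact: measurable_itv.
have phi0 := rho_ge0 MI.
have phif : rho (fun s => (\1_(`]0%R, d]) s : R)%:E) < +oo.
  apply: rho_fin_indic; [exact: measurable_itv|exact: sub|].
  by rewrite lebesgue_measure_itv0c ?(ltW d0)// ltry.
have homI (x : R) : (0 <= x)%R -> rho (fun s => (x * \1_(`]0%R, d]) s)%R%:E) =
    x%:E * rho (fun s => (\1_(`]0%R, d]) s : R)%:E).
  by move=> x0; rewrite -rho_homog.
rewrite homI//.
set phi := rho _ in phi0 phif *.
have phiE : phi = (fine phi)%:E by rewrite fineK// ge0_fin_numE.
have [brho|] := ltP (rho b) +oo; last by rewrite leye_eq => /eqP ->; rewrite leey.
have rE : rho b = (fine (rho b))%:E by rewrite fineK// ge0_fin_numE// rho_ge0.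
rewrite phiE rE -EFinM lee_fin.
have [p0|p0] := eqVneq (fine phi) 0%R.
  by rewrite p0 mulr0 fine_ge0// rho_ge0.
have pp : (0 < fine phi)%R by rewrite lt_def p0 fine_ge0.
(* The interval starts at d/(M+1) because b may blow up at 0. There the left-endpoint sum uses
   exactly the values y_j of the lower step function on (0,d]. *)
have key (M : nat) : \int[mu]_(s in `[(d / M.+1%:R)%R, d]) b s <=
    (d * fine (rho b) / fine phi)%R%:E.
  pose e := (d / M.+1%:R)%R; have e0 : (0 < e)%R by rewrite divr_gt0.
  have eM : (M.+1%:R * e = d)%R by rewrite mulrC divfK.
  pose y (j : nat) := fine (b (j.+1%:R * e)%R).
  have bE (j : nat) : b (j.+1%:R * e)%R = (y j)%:E by rewrite fineK// bf// mulr_gt0.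
  have y0 (j : nat) : (0 <= y j)%R by rewrite -lee_fin -bE b0// mulr_gt0.
  have yni (i j : nat) : (i <= j)%N -> (y j <= y i)%R.
    by move=> ij; rewrite -lee_fin -!bE bni ?mulr_gt0// ler_pM2r// ler_nat.
  pose S := (\sum_(j < M.+1) y j)%R.
  have S0 : (0 <= S)%R by apply: sumr_ge0.
  have le1 : rho (fun s => (step e (fun j : 'I_M.+1 => y j) s)%:E) <= rho b.
    apply: rho_mono => //; first exact: Mplus_step.
    move=> s s0; have [[j js]|nj] := pselect (exists j : 'I_M.+1, cell e j s).
      rewrite (step_in e0 _ js) -bE; apply: bni => //.
      by move: js; rewrite cellE => /andP[].
    by rewrite step_out ?b0// => j js; apply: nj; exists j.
  have le2 : rho (fun s => (step e (fun j : 'I_M.+1 => S / M.+1%:R)%R s)%:E) <=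
             rho (fun s => (step e (fun j : 'I_M.+1 => y j) s)%:E).
    apply: rho_step_majorization => //; first by move=> j; rewrite divr_ge0.
    move=> m; apply: (@prefix_average _ M.+1 (fun j => y j)) => i k; exact: yni.
  have c'0 : (0 <= S / M.+1%:R)%R by rewrite divr_ge0.
  have le3 : ((S / M.+1%:R) * fine phi <= fine (rho b))%R.
    rewrite -lee_fin EFinM -phiE -rE -homI//; apply: le_trans le1; apply: le_trans le2.
    rewrite le_eqVlt; apply/orP; left; apply/eqP; apply: rho_eq.
    - split; last by move=> s _; rewrite lee_fin mulr_ge0.
      by apply/measurable_EFinP; apply: measurable_funM => //; apply: measurable_indic;
         exact: measurable_itv.
    - exact: Mplus_step.
    - move=> s s0; congr (_%:E); rewrite indicE.
      have [sd|ds] := leP s d.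
        rewrite mem_set ?mulr1; last by rewrite /= in_itv/= s0.
        have [|j js] := @cell_exists _ e M.+1 s s0; first by rewrite eM.
        by rewrite (step_in e0 _ js).
      rewrite memNset ?mulr0; last by rewrite /= in_itv/= leNgt ds andbF.
      rewrite step_out// => j; rewrite cellE => /andP[_].
      apply/negP; rewrite -ltNge (le_lt_trans _ ds)// -eM ler_pM2r// ler_nat.
      exact: ltn_ord.
  apply: (@le_trans _ _ (\int[mu]_(s in `[e, (e + M.+1%:R * e)%R[) b s)).
    apply: ge0_subset_integral; [exact: measurable_itv|exact: measurable_itv| | |].
    - apply: nonincreasing_emeasurable; first exact: interval_is_interval.
      move=> s t /=; rewrite !in_itv/= => /andP[es _] _; apply: bni.
      exact: lt_le_trans es.
    - by move=> s /=; rewrite in_itv/= => /andP[es _]; apply: b0; exact: lt_le_trans es.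
    - by move=> s /=; rewrite !in_itv/= => /andP[-> sd]/=; rewrite eM (le_lt_trans sd)// ltrDr.
  apply: le_trans (riemann_sum_ge M.+1 _ _ e0) _.
  - by move=> s es; apply: b0; exact: lt_le_trans es.
  - by move=> s t es; apply: bni; exact: lt_le_trans es.
  rewrite (eq_bigr (fun k : 'I_M.+1 => (y k)%:E)); last first.
    by move=> k _; rewrite -bE -natr1 mulrDl mul1r addrC.
  rewrite sumEFin -EFinM lee_fin -/S.
  rewrite ler_pdivlMr//; apply: le_trans (ler_wpM2l (ltW d0) le3).
  by rewrite /e le_eqVlt; apply/orP; left; apply/eqP; ring.
have cdk : (c * d)%R%:E <= (d * fine (rho b) / fine phi)%R%:E.
  apply: le_trans cd _.
  (* Monotone convergence as M grows recovers the piece near 0. *)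
  have UE : \bigcup_(M : nat) `[(d / M.+1%:R)%R, d]%classic = `]0%R, d]%classic.
    apply/seteqP; split => s /=.
      move=> [M _]; rewrite /= !in_itv/= => /andP[ds ->]; rewrite andbT.
      by apply: lt_le_trans ds; rewrite divr_gt0.
    rewrite in_itv/= => /andP[s0 sd].
    have [M MP] : exists M : nat, (d / s < M%:R)%R.
      by exists (Num.Def.archi_bound (d / s)); apply: archi_boundP; rewrite divr_ge0 ?ltW.
    exists M => //=; rewrite in_itv/= sd andbT ler_pdivrMr//.
    move: MP; rewrite ltr_pdivrMr// => /ltW/le_trans; apply.
    by rewrite mulrC ler_pM2l// ler_nat.
  have cv : \int[mu]_(s in `[(d / M.+1%:R)%R, d]) b s @[M --> \oo] -->
             \int[mu]_(s in `]0%R, d]) b s.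
    rewrite -UE; apply: ge0_nondecreasing_set_cvg_integral.
    - move=> i j ij; apply/subsetPset => s /=; rewrite !in_itv/= => /andP[ds ->].
      rewrite andbT; apply: le_trans ds; rewrite ler_pM2l// lef_pV2 ?posrE//.
      by rewrite ler_nat.
    - by move=> i; exact: measurable_itv.
    - move=> i; apply: nonincreasing_emeasurable; first exact: interval_is_interval.
      move=> s t /=; rewrite !in_itv/= => /andP[es _] _; apply: bni.
      by apply: lt_le_trans es; rewrite divr_gt0.
    - move=> i s /=; rewrite in_itv/= => /andP[es _]; apply: b0.
      by apply: lt_le_trans es; rewrite divr_gt0.
  rewrite -(cvg_lim _ cv)//; apply: lime_le; first by apply/cvg_ex; eexists; exact: cv.
  by apply: nearW => M; exact: key.
move: cdk; rewrite lee_fin ler_pdivlMr// => cdk.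
by rewrite -(ler_pM2l d0) mulrA [(d * c)%R]mulrC.
Qed.

End RiNorm.

(** * From step functions to nonincreasing functions *)

Section HardyLittlewoodPolya.
Local Open Scope ereal_scope.
Context {R : realType}.
Local Notation mu := (@lebesgue_measure R).

Lemma riemann_sum_le (h : R -> \bar R) (d : R) N :
  measurable_fun (@pos_itv R) h ->
  (forall y, (0 < y)%R -> 0 <= h y) ->
  (forall y z, (0 < y)%R -> (y <= z)%R -> h z <= h y) -> (0 < d)%R ->
  d%:E * \sum_(k < N) h (k.+1%:R * d)%R <= \int[mu]_(y in `]0%R, (N%:R * d)%R]) h y.
Proof.
move=> mh h0 hni d0.
have sub (x y : R) : (0 <= x)%R -> `]x, y] `<=` @pos_itv R.
  by move=> x0 z /=; rewrite pos_itvE in_itv/= => /andP[/(le_lt_trans x0)].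
elim: N => [|N IH]; first by rewrite mul0r set_itvoc0 integral_set0 big_ord0 mule0.
have N0 : (0 <= N%:R * d)%R by rewrite mulr_ge0// ltW.
have NN : (N%:R * d <= N.+1%:R * d)%R by rewrite ler_pM2r// ler_nat.
have N1 : (0 < N.+1%:R * d)%R by rewrite mulr_gt0.
rewrite (@itv_bndbnd_setU _ _ _ (BRight (N%:R * d)%R)) ?bnd_simp//.
rewrite ge0_integral_setU//=; last 3 first.
- rewrite -itv_bndbnd_setU ?bnd_simp//; apply: measurable_funS mh; last exact: sub.
  exact: measurable_pos_itv.
- by move=> x [/sub|/sub]; rewrite pos_itvE => H; apply: h0; exact: H.
- apply/disj_setPS => x [] /=; rewrite !in_itv/= => /andP[_ xa] /andP[ax _].
  by move: xa; rewrite leNgt ax.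
rewrite big_ord_recr/= ge0_muleDr; last 2 first.
- by apply: sume_ge0 => k _; apply: h0; rewrite mulr_gt0.
- exact: h0.
apply: leeD => //.
apply: (@le_trans _ _ (\int[mu]_(y in `](N%:R * d)%R, (N.+1%:R * d)%R]) h (N.+1%:R * d)%R)).
  rewrite integral_cst//= muleC -[X in _ <= _ * X]/(mu `](N%:R * d)%R, (N.+1%:R * d)%R]).
  by rewrite [mu _](cell_measure d0 N).
apply: ge0_le_integral => //=.
- by move=> x _; exact: h0.
- by apply: measurable_funS mh; [exact: measurable_pos_itv|exact: sub].
- move=> x; rewrite /= in_itv/= => /andP[Nx xN]; apply: hni => //.
  exact: le_lt_trans Nx.
Qed.

Section HLP.
Variable rho : (R -> \bar R) -> \bar R.
Hypothesis Hr : ri_norm rho.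
Variables (a b F : R -> \bar R).
Hypotheses (Ma : Mplus a) (Mb : Mplus b) (MF : Mplus F).
Hypothesis ani : forall s t, (0 < s)%R -> (s <= t)%R -> a t <= a s.
Hypothesis bni : forall s t, (0 < s)%R -> (s <= t)%R -> b t <= b s.
Hypothesis bf : forall s, (0 < s)%R -> b s \is a fin_num.
Hypothesis ab : forall t, (0 < t)%R ->
  \int[mu]_(s in `]0%R, t]) a s <= \int[mu]_(s in `]0%R, t]) b s.
Hypothesis bint : forall t, (0 < t)%R -> \int[mu]_(s in `]0%R, t]) b s < +oo.

Let a0 s : (0 < s)%R -> 0 <= a s. Proof. exact: Ma.2. Qed.
Let b0 s : (0 < s)%R -> 0 <= b s. Proof. exact: Mb.2. Qed.

Let sub0 (t : R) : `]0%R, t] `<=` @pos_itv R.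
Proof. by move=> z /=; rewrite pos_itvE in_itv/= => /andP[]. Qed.

Let af s : (0 < s)%R -> a s \is a fin_num.
Proof.
move=> s0; rewrite ge0_fin_numE ?a0//.
have : s%:E * a s < +oo.
  apply: le_lt_trans (bint s0); apply: le_trans (ab s0).
  have := @riemann_sum_le a s 1%N Ma.1 a0 ani s0.
  by rewrite big_ord1 mul1r.
by case: (a s) => // [r _|]; [rewrite ltry|rewrite gt0_muley ?lte_fin].
Qed.

Let lower (h : R -> \bar R) d N := step d (fun j : 'I_N => fine (h (j.+1%:R * d)%R)).

(** Lower sums of a are below its integrals, hence below those of b. On [d, oo) the integrals of b
    are below left-endpoint sums, which reuse the values of b at right ends of cells; the mass on
    (0,d] becomes a spike of height [beta], its mean, in the first cell. The spike costs at most rho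
    b by [rho_indic_average]. *)
Let rho_lower_le d N : (0 < d)%R ->
  rho (fun s => (lower a d N s)%:E) <= rho b + rho b.
Proof.
move=> d0.
have pj (j : nat) : (0 < j.+1%:R * d)%R by rewrite mulr_gt0.
pose beta := (fine (\int[mu]_(s in `]0%R, d]) b s) / d)%R.
have ib0 t : 0 <= \int[mu]_(s in `]0%R, t]) b s.
  by apply: integral_ge0 => s /sub0; rewrite pos_itvE => /b0.
have beta0 : (0 <= beta)%R by rewrite divr_ge0 ?fine_ge0// ltW.
have betaE : (beta * d)%R%:E = \int[mu]_(s in `]0%R, d]) b s.
  by rewrite divfK ?gt_eqF// fineK// ge0_fin_numE// bint.
pose x (j : 'I_N) := fine (a (j.+1%:R * d)%R).
pose y (j : 'I_N) := fine (b (j.+1%:R * d)%R).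
have x0 j : (0 <= x j)%R by rewrite fine_ge0 ?a0.
have y0 j : (0 <= y j)%R by rewrite fine_ge0 ?b0.
pose sp (j : 'I_N) : R := if val j == 0%N then beta else 0%R.
have sp0 j : (0 <= sp j)%R by rewrite /sp; case: ifP.
have aE (j : nat) : a (j.+1%:R * d)%R = (fine (a (j.+1%:R * d)%R))%:E.
  by rewrite fineK// af.
have bE (j : nat) : b (j.+1%:R * d)%R = (fine (b (j.+1%:R * d)%R))%:E.
  by rewrite fineK// bf.
have maj (m : nat) : (\sum_(j < N | (j < m)%N) x j <=
                      \sum_(j < N | (j < m)%N) (y j + sp j))%R.
  wlog mN : m / (m <= N)%N.
    move=> H; have [/H//|Nm] := leqP m N.
    have E (z : 'I_N -> R) : (\sum_(j < N | (j < m)%N) z j = \sum_(j < N | (j < N)%N) z j)%R.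
      by apply: eq_bigl => j; rewrite ltn_ord (ltn_trans (ltn_ord j) Nm).
    by rewrite !E; exact: H.
  rewrite -(big_ord_widen N (fun j => fine (a (j.+1%:R * d)%R)) mN).
  rewrite -(big_ord_widen N (fun j => fine (b (j.+1%:R * d)%R) +
     (if j == 0%N then beta else 0))%R mN).
  case: m mN => [|m] mN; first by rewrite !big_ord0.
  rewrite -(ler_pM2l d0) -lee_fin.
  have -> : (d * \sum_(i < m.+1) fine (a (i.+1%:R * d)))%R%:E =
      d%:E * \sum_(i < m.+1) a (i.+1%:R * d)%R.
    by rewrite EFinM -sumEFin; congr (_ * _); apply: eq_bigr => i _.
  apply: le_trans (riemann_sum_le m.+1 Ma.1 a0 ani d0) _.
  apply: le_trans (ab _) _ => //.
  rewrite big_split/= mulrDr EFinD.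
  have -> : (\sum_(i < m.+1) (if i == 0%N :> nat then beta else 0) = beta)%R.
    by rewrite big_ord_recl/= big1 ?addr0.
  rewrite [(d * beta)%R]mulrC betaE addeC.
  rewrite (@itv_bndbnd_setU _ _ _ (BRight d)) ?bnd_simp ?(ltW d0)//; last first.
    by rewrite -[leLHS]mul1r ler_pM2r// ler1n.
  have subd : `]d, (m.+1%:R * d)%R] `<=` @pos_itv R.
    by move=> z /=; rewrite pos_itvE in_itv/= => /andP[/(lt_trans d0)].
  rewrite ge0_integral_setU//=; last 3 first.
  - apply: (measurable_funS _ _ Mb.1); first exact: measurable_pos_itv.
    by move=> z [/sub0|/subd].
  - by move=> z [/sub0|/subd]; rewrite pos_itvE; exact: b0.
  - apply/disj_setPS => z [] /=; rewrite !in_itv/= => /andP[_ xa] /andP[ax _].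
    by move: xa; rewrite leNgt ax.
  apply: leeD => //.
  apply: (@le_trans _ _ (\int[mu]_(z in `[d, (d + m.+1%:R * d)%R[) b z)).
    apply: ge0_subset_integral; [exact: measurable_itv|exact: measurable_itv| | |].
    - apply: (measurable_funS _ _ Mb.1); first exact: measurable_pos_itv.
      by move=> z /=; rewrite pos_itvE in_itv/= => /andP[/(lt_le_trans d0)].
    - by move=> z /=; rewrite in_itv/= => /andP[/(lt_le_trans d0)/b0].
    - move=> z /=; rewrite !in_itv/= => /andP[/ltW -> zm]/=.
      by rewrite (le_lt_trans zm)// ltrDr.
  apply: le_trans (riemann_sum_ge m.+1 _ _ d0) _.
  - by move=> z dz; apply: b0; exact: lt_le_trans dz.
  - by move=> z w dz; apply: bni; exact: lt_le_trans dz.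
  rewrite EFinM -sumEFin; apply: lee_wpmul2l; first by rewrite lee_fin ltW.
  by apply: lee_sum => i _; rewrite -bE -natr1 mulrDl mul1r addrC.
have ys0 j : (0 <= y j + sp j)%R by rewrite addr_ge0.
apply: (@le_trans _ _ (rho (fun s => (step d (fun j => y j + sp j)%R s)%:E))).
  apply: rho_step_majorization => // i k ik.
  by rewrite -lee_fin -!aE ani// ler_pM2r// ler_nat.
have -> : (fun s => (step d (fun j => y j + sp j)%R s)%:E) =
          (fun s => (step d y s)%:E + (step d sp s)%:E).
  apply/funext => s; rewrite -EFinD /step -big_split/=; congr (_%:E).
  by apply: eq_bigr => j _; rewrite mulrDl.
apply: le_trans (rho_triangle Hr (Mplus_step _ y0) (Mplus_step _ sp0)) _.
apply: leeD.
- apply: rho_mono => //; first exact: Mplus_step.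
  move=> s s0; have [[j js]|nj] := pselect (exists j : 'I_N, cell d j s).
    rewrite (step_in d0 _ js) -bE; apply: bni => //.
    by move: js; rewrite cellE => /andP[].
  by rewrite step_out ?b0// => j js; apply: nj; exists j.
- apply: le_trans (rho_indic_average Hr Mb bni bf d0 beta0 _); last by rewrite betaE.
  apply: rho_mono => //.
  + split; last by move=> s _; rewrite lee_fin mulr_ge0.
    by apply/measurable_EFinP; apply: measurable_funM => //; apply: measurable_indic;
       exact: measurable_itv.
  + exact: Mplus_step.
  move=> s s0; rewrite lee_fin.
  have [[j js]|nj] := pselect (exists j : 'I_N, cell d j s); last first.
    rewrite step_out; first by rewrite mulr_ge0.
    by move=> j js; apply: nj; exists j.
  rewrite (step_in d0 _ js) /sp; case: eqP => [j0|_]; last by rewrite mulr_ge0.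
  rewrite indicE mem_set ?mulr1//=.
  by move: js; rewrite j0 cellE mul0r mul1r in_itv.
Qed.

(* F is dominated by the increasing limit of the dyadic lower step functions of a;
   the second [rho b] pays for the mass of b on the first cell. *)
Lemma hardy_littlewood_polya :
  (forall s, (0 < s)%R -> exists2 r, (s < r)%R & F s <= a r) ->
  rho F <= rho b + rho b.
Proof.
move=> Fa.
pose d (m : nat) := (2 ^- m : R)%R; have d0 m : (0 < d m)%R by rewrite invr_gt0 exprn_gt0.
have dS m : (d m = 2 * d m.+1)%R.
  by rewrite /d exprS invfM mulrA divff ?mul1r.
(* With m 2^m cells the step function reaches up to m. Halving the mesh nests the cells, so the
   lower step functions increase with m. *)
pose N m := (m * 2 ^ m)%N.
have Nd m : ((N m)%:R * d m = m%:R)%R.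
  by rewrite /N natrM natrX /d mulfK// expf_neq0.
pose am m s := (lower a (d m) (N m) s)%:E.
have ama m s (j : 'I_(N m)) : cell (d m) j s -> am m s = a (j.+1%:R * d m)%R.
  by move=> js; rewrite /am /lower (step_in (d0 m) _ js) fineK// af// mulr_gt0.
have am0 m s : 0 <= am m s.
  by rewrite lee_fin; apply: step_ge0 => j; rewrite fine_ge0// a0// mulr_gt0.
have Mam m : Mplus (am m).
  by apply: Mplus_step => j; rewrite fine_ge0// a0// mulr_gt0.
have amS m s : (0 < s)%R -> am m s <= am m.+1 s.
  move=> s0; have [[j js]|nj] := pselect (exists j : 'I_(N m), cell (d m) j s); last first.
    by rewrite {1}/am /lower step_out ?am0// => j js; apply: nj; exists j.
  have sm1 : (s <= (N m.+1)%:R * d m.+1)%R.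
    move: (js); rewrite cellE => /andP[_ /le_trans]; apply.
    rewrite Nd; apply: (@le_trans _ _ ((N m)%:R * d m)%R).
      by rewrite ler_pM2r// ler_nat ltn_ord.
    by rewrite Nd ler_nat.
  have [j' j's] := cell_exists s0 sm1.
  rewrite (ama _ _ _ js) (ama _ _ _ j's); apply: ani; first by rewrite mulr_gt0.
  move: js j's; rewrite !cellE => /andP[_ sj] /andP[js _].
  have := lt_le_trans js sj; rewrite (dS m) mulrA ltr_pM2r// -natrM ltr_nat => h.
  by rewrite ler_pM2r// ler_nat.
(* A lower step function takes the value of a at the right end of the cell of s. The margin r > s
   absorbs this once the mesh is below r - s. *)
have amF s : (0 < s)%R -> exists m, F s <= am m s.
  move=> s0; have [r sr Fr] := Fa s s0.
  have [m [sm dm]] : exists m : nat, (s <= m%:R)%R /\ (d m < r - s)%R.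
    pose M := maxn (Num.Def.archi_bound s) (Num.Def.archi_bound (r - s)^-1).
    exists M; split.
      apply: le_trans (ltW (archi_boundP (ltW s0))) _.
      by rewrite ler_nat leq_maxl.
    have rs : (0 < r - s)%R by rewrite subr_gt0.
    rewrite /d -[ltRHS]invrK ltf_pV2 ?posrE ?exprn_gt0 ?invr_gt0//.
    have h : (0 <= (r - s)^-1)%R by rewrite invr_ge0 ltW.
    apply: lt_le_trans (archi_boundP h) _; rewrite -natrX ler_nat.
    by apply: leq_trans (leq_maxr _ _) (ltnW (ltn_expl _ _)).
  exists m; have [|j js] := @cell_exists _ (d m) (N m) s s0; first by rewrite Nd.
  rewrite (ama _ _ _ js); apply: le_trans Fr _; apply: ani; first by rewrite mulr_gt0.
  move: js; rewrite cellE => /andP[js _].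
  by rewrite -natr1 mulrDl mul1r; move: js dm; lra.
pose ainf s := ereal_sup (range (am ^~ s)).
have cv s : (0 < s)%R -> am m s @[m --> \oo] --> ainf s.
  move=> s0; apply: ereal_nondecreasing_cvgn; apply/nondecreasing_seqP => m.
  exact: amS.
have Minf : Mplus ainf.
  split; last first.
    by move=> s _; apply: le_trans (am0 0%N s) _; apply: ereal_sup_ubound; exists 0%N.
  apply: (emeasurable_fun_cvg am).
    by move=> m; exact: (Mam m).1.
  by move=> s; rewrite pos_itvE; exact: cv.
apply: (@le_trans _ _ (rho ainf)).
  apply: rho_mono => // s s0; have [m Fm] := amF s s0.
  by apply: le_trans Fm _; apply: ereal_sup_ubound; exists m.
apply: (rho_fatou_le Hr Mam Minf).
  by move=> s s0; split; [move=> k; exact: amS|exact: cv].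
by move=> m; exact: rho_lower_le.
Qed.

End HLP.

End HardyLittlewoodPolya.

(** * Rearrangement invariant spaces of positive Boyd index *)

Section BoydIndex.
Local Open Scope ereal_scope.
Context {R : realType}.
Local Notation mu := (@lebesgue_measure R).
Implicit Types (l u F : R -> \bar R).

Lemma distr_likeZ l (c : R) : distr_like l -> (0 < c)%R ->
  distr_like (fun y => c%:E * l y).
Proof.
move=> [l0 [lni lrc]] c0; split.
  by move=> y; rewrite mule_ge0// lee_fin ltW.
split=> [y z yz|y s sl].
  by apply: lee_wpmul2l; [rewrite lee_fin ltW|exact: lni].
have [|z yz sz] := lrc y ((c^-1)%:E * s); first by rewrite lte_pdivrMl.
by exists z => //; rewrite -lte_pdivrMl.
Qed.

(** Dilates of a rearrangement are rearrangements again, so the bound for one dilation can be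
    iterated. *)
Lemma ginv_dilate l (c s : R) : (0 < c)%R ->
  ginv (fun y => c%:E * l y) s = ginv l (s / c).
Proof.
move=> c0; congr ereal_inf; apply/seteqP.
by split=> _ [y [y0 ly] <-]; exists y => //; split => //; move: ly;
  rewrite mulrC EFinM lee_pdivlMl.
Qed.

Lemma Mplus_ginv l : Mplus (ginv l).
Proof. by split; [exact: ginv_measurable|move=> s _; exact: ginv_ge0]. Qed.

Lemma rstar_pos_ginv l : distr_like l -> rstar_pos (ginv l) = ginv l.
Proof.
move=> dl; rewrite /rstar_pos rearrE; apply: eq_ginv => y y0.
rewrite /distrib /leb_pos -[RHS](lebesgue_measure_itv_below (dl.1 y)).
congr (mu _); apply/seteqP; split=> s /=.
  by rewrite in_itv/= andbT gee0_abs ?ginv_ge0// ginv_gt// => -[].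
by rewrite in_itv/= andbT gee0_abs ?ginv_ge0// ginv_gt// => -[].
Qed.

(** For 0 < [sg] < 1, a discrete counterpart of the Hardy operator that integrates u(s)/s from t to
    infinity. *)
Definition dilation_series u (sg : R) (t : R) : \bar R :=
  \sum_(k <oo) u (t / sg ^+ k)%R.

Section Dilation.
Variable sg : R.
Hypotheses (sg0 : (0 < sg)%R) (sg1 : (sg < 1)%R).

Let sgk k : (0 < sg ^+ k)%R. Proof. exact: exprn_gt0. Qed.

Lemma measurable_dilate u k : measurable_fun (@pos_itv R) u ->
  measurable_fun (@pos_itv R) (fun t => u (t / sg ^+ k)%R).
Proof.
move=> mu_; pose w := u \_ (@pos_itv R).
have mw : measurable_fun setT w.
  by apply/(measurable_restrictT _ _).1 => //; exact: measurable_pos_itv.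
apply: (@eq_measurable_fun _ _ _ _ _ (w \o (fun t : R => t / sg ^+ k)%R)).
  by move=> t; rewrite inE pos_itvE => t0; rewrite /w/= patchE mem_set// pos_itvE divr_gt0.
apply: (@measurable_funS _ _ _ _ setT) => //.
apply: (measurableT_comp mw); exact: mulrr_measurable.
Qed.

Lemma Mplus_dilate u k : Mplus u -> Mplus (fun t => u (t / sg ^+ k)%R).
Proof.
move=> [mu_ u0]; split; first exact: measurable_dilate.
by move=> s s0; apply: u0; rewrite divr_gt0.
Qed.

Lemma Mplus_dilation_series u : Mplus u -> Mplus (dilation_series u sg).
Proof.
move=> Mu; split.
  apply: ge0_emeasurable_sum => // [k s|k _]; last exact: (Mplus_dilate k Mu).1.
  by rewrite pos_itvE => s0 _; exact: (Mplus_dilate k Mu).2.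
by move=> s s0; apply: nneseries_ge0 => k _ _; exact: (Mplus_dilate k Mu).2.
Qed.

Lemma dilation_series_nonincreasing u s t : Mplus u ->
  (forall s t, (0 < s)%R -> (s <= t)%R -> u t <= u s) ->
  (0 < s)%R -> (s <= t)%R -> dilation_series u sg t <= dilation_series u sg s.
Proof.
move=> Mu uni s0 st; apply: lee_nneseries.
  by move=> k _ _; apply: (Mplus_dilate k Mu).2; exact: lt_le_trans st.
move=> k _; apply: uni; first by rewrite divr_gt0.
by rewrite ler_pM2r// invr_gt0.
Qed.

Lemma dilation_series_ge u k t : Mplus u -> (0 < t)%R ->
  u (t / sg ^+ k)%R <= dilation_series u sg t.
Proof.
move=> Mu t0.
have up i : 0 <= u (t / sg ^+ i)%R by exact: (Mplus_dilate i Mu).2.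
apply: le_trans (nneseries_lim_ge (P := xpredT) k.+1 _) => //.
by rewrite big_nat_recr//= leeDr// sume_ge0.
Qed.

Lemma integral_dilation_series u t : Mplus u -> (0 < t)%R ->
  \int[mu]_(s in `]0%R, t]) dilation_series u sg s =
  \sum_(k <oo) ((sg ^+ k)%:E * \int[mu]_(s in `]0%R, (t / sg ^+ k)%R]) u s).
Proof.
move=> Mu t0; have sub (x : R) : `]0%R, x] `<=` @pos_itv R.
  by move=> z /=; rewrite pos_itvE in_itv/= => /andP[].
rewrite integral_nneseries//.
- apply: eq_eseriesr => k _.
  have c0 : (0 < (sg ^+ k)^-1)%R by rewrite invr_gt0.
  have := @ge0_integral_itv_scale _ (sg ^+ k)^-1 (t / sg ^+ k) u c0.
  rewrite invrK divfK ?gt_eqF// => <-.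
  + by apply: eq_integral => s _; rewrite mulrC.
  + by apply: measurable_funS Mu.1 => //; exact: measurable_pos_itv.
  + exact: Mu.2.
- move=> k; apply: measurable_funS (Mplus_dilate k Mu).1 => //.
  exact: measurable_pos_itv.
- by move=> k s /sub; rewrite pos_itvE; exact: (Mplus_dilate k Mu).2.
Qed.

End Dilation.

(** A positive quotient with ln s < 0 forces ln of the dilation norm to be negative. Since [ln] is 0
    at nonpositive arguments and [fine] sends infinities to 0, this excludes the default values and
    leaves a real number in (0,1). *)
Lemma lower_boyd_gt0 (rho : (R -> \bar R) -> \bar R) : 0 < lower_boyd rho ->
  exists sg th : R, [/\ (0 < sg)%R, (sg < 1)%R, (0 < th)%R, (th < 1)%R &
    dilation_norm rho sg = th%:E].
Proof.
move=> /ereal_sup_gt[_ [s s01 <-]]; rewrite lte_fin => H.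
move: s01; rewrite /= in_itv/= => /andP[s0 s1].
have lns : (ln s < 0)%R by rewrite ln_lt0// s0.
have lnD : (ln (fine (dilation_norm rho s)) < 0)%R.
  by rewrite -(ltr_nM2r (x := (ln s)^-1)%R) ?invr_lt0// mul0r.
have D0 : (0 < fine (dilation_norm rho s))%R.
  by rewrite ltNge; apply/negP => /ln0 h; rewrite h ltxx in lnD.
exists s, (fine (dilation_norm rho s)); split => //.
  by rewrite ltNge; apply/negP => /ln_ge0; rewrite leNgt lnD.
move: D0; case: (dilation_norm rho s) => //=; by rewrite ltxx.
Qed.

Section Boyd.
Variable rho : (R -> \bar R) -> \bar R.
Hypothesis Hr : ri_norm rho.
Variables (sg th : R).
Hypotheses (sg0 : (0 < sg)%R) (sg1 : (sg < 1)%R) (th0 : (0 < th)%R) (th1 : (th < 1)%R).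
Hypothesis Dsg : dilation_norm rho sg = th%:E.

(** The supremum in [dilation_norm] ranges over finite nonzero norms only. Norm 0 is settled by
    monotonicity, because t/sg >= t. *)
Lemma rho_dilate_le l : distr_like l ->
  rho (fun t => ginv l (t / sg)%R) <= th%:E * rho (ginv l).
Proof.
move=> dl; have M := Mplus_ginv l.
have [roo|] := ltP (rho (ginv l)) +oo; last first.
  by rewrite leye_eq => /eqP ->; rewrite gt0_muley ?lte_fin// leey.
have r0 := rho_ge0 Hr M.
move: (r0); rewrite le_eqVlt => /predU1P[rz|rpos].
  rewrite -rz mule0 {1}rz; apply: (rho_mono Hr M).
    by have := Mplus_dilate sg0 1 M; under eq_fun do rewrite expr1.
  move=> s s0; apply: ginv_nonincreasing.
  by rewrite ler_pdivlMr// ler_piMr ?ltW.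
have rE : rho (ginv l) = (fine (rho (ginv l)))%:E by rewrite fineK// ge0_fin_numE.
have fpos : (0 < fine (rho (ginv l)))%R by rewrite -lte_fin -rE.
have : rho (fun t => ginv l (t / sg)%R) * (fine (rho (ginv l)))^-1%:E <= th%:E.
  rewrite -Dsg; apply: ereal_sup_ubound; exists (ginv l) => /=.
    by rewrite rstar_pos_ginv// rpos roo.
  by rewrite rstar_pos_ginv.
by rewrite lee_pdivrMr// -rE.
Qed.

Lemma rho_dilate_iter l k : distr_like l ->
  rho (fun t => ginv l (t / sg ^+ k)%R) <= (th ^+ k)%:E * rho (ginv l).
Proof.
move=> dl; elim: k => [|k IH].
  by rewrite !expr0 mul1e; under eq_fun do rewrite divr1.
have sgk : (0 < sg ^+ k)%R by exact: exprn_gt0.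
have E : (fun t => ginv l (t / sg ^+ k)%R) = ginv (fun y => (sg ^+ k)%:E * l y).
  by apply/funext => t; rewrite ginv_dilate.
have -> : (fun t => ginv l (t / sg ^+ k.+1)%R) =
          (fun t => ginv (fun y => (sg ^+ k)%:E * l y) (t / sg)%R).
  by apply/funext => t; rewrite ginv_dilate// exprS invfM mulrA.
apply: le_trans (rho_dilate_le (distr_likeZ dl sgk)) _.
rewrite -E exprS EFinM -muleA; apply: lee_wpmul2l => //.
by rewrite lee_fin ltW.
Qed.

(** Partial sums are bounded by a geometric series in [th] < 1, and the Fatou property passes to the
    limit. *)
Lemma rho_dilation_series_le l : distr_like l -> rho (ginv l) < +oo ->
  rho (dilation_series (ginv l) sg) <= ((1 - th)^-1)%:E * rho (ginv l).
Proof.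
move=> dl roo; have M := Mplus_ginv l.
have r0 := rho_ge0 Hr M.
have rE : rho (ginv l) = (fine (rho (ginv l)))%:E by rewrite fineK// ge0_fin_numE.
pose S m t := \sum_(k < m) ginv l (t / sg ^+ k)%R.
have MS m : Mplus (S m).
  split; last by move=> s _; apply: sume_ge0 => k _; exact: ginv_ge0.
  by apply: emeasurable_sum => k; exact: (Mplus_dilate sg0 k M).1.
have thk m : (\sum_(k < m) th ^+ k <= (1 - th)^-1)%R.
  have h : (0 < 1 - th)%R by rewrite subr_gt0.
  rewrite -[leRHS]mul1r ler_pdivlMr// mulrC.
  have -> : ((1 - th) * \sum_(k < m) th ^+ k = 1 - th ^+ m)%R.
    by rewrite -opprB mulNr -subrX1 opprB.
  by rewrite lerBlDr lerDl exprn_ge0// ltW.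
apply: (rho_fatou_le Hr MS (Mplus_dilation_series sg0 M)).
  move=> s s0; split => [k|].
    by rewrite /S big_ord_recr/= leeDl// ginv_ge0.
  have -> : (fun k => S k s) = (fun k => \sum_(0 <= i < k) ginv l (s / sg ^+ i)%R).
    by apply/funext => k; rewrite big_mkord.
  by apply: is_cvg_nneseries => k _ _; exact: ginv_ge0.
move=> m; apply: (@le_trans _ _ ((\sum_(k < m) th ^+ k)%R%:E * rho (ginv l))); last first.
  by apply: lee_wpmul2r => //; rewrite lee_fin.
elim: m => [|m IH].
  rewrite big_ord0 mul0e.
  have -> : S 0%N = (fun s => 0%:E * ginv l s).
    by apply/funext => s; rewrite /S big_ord0 mul0e.
  by rewrite rho_homog// mul0e.
have -> : S m.+1 = (fun s => S m s + ginv l (s / sg ^+ m)%R).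
  by apply/funext => s; rewrite /S big_ord_recr.
apply: le_trans (rho_triangle Hr (MS m) (Mplus_dilate sg0 m M)) _.
have thk0 k : (0 <= th ^+ k)%R by rewrite exprn_ge0// ltW.
rewrite big_ord_recr/= EFinD ge0_muleDl ?lee_fin ?sumr_ge0//.
by apply: leeD; [exact: IH|exact: rho_dilate_iter].
Qed.

End Boyd.

End BoydIndex.

(** * From integral inequalities to norm inequalities *)

Section BoydTransfer.
Local Open Scope ereal_scope.
Context {R : realType}.
Local Notation mu := (@lebesgue_measure R).

(** k is the last exponent with t/sg^k <= s. *)
Lemma geometric_bracket (sg t s : R) : (0 < sg)%R -> (sg < 1)%R -> (0 < t)%R ->
  (t <= s)%R -> exists k, (t / sg ^+ k <= s)%R /\ (sg * s <= t / sg ^+ k)%R.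
Proof.
move=> sg0 sg1 t0 ts; have s0 := lt_le_trans t0 ts.
have sgk k : (0 < sg ^+ k)%R by exact: exprn_gt0.
have ex : exists k, (s < t / sg ^+ k.+1)%R.
  have /cvgrPdist_lt/(_ (t / s)%R) : (fun k => sg ^+ k)%R @ \oo --> (0 : R)%R.
    by apply: cvg_expr; rewrite gtr0_norm.
  rewrite divr_gt0// => /(_ isT)[k _ /(_ k.+1 (leqnSn k))] /=.
  rewrite sub0r normrN gtr0_norm// => H; exists k.
  by rewrite ltr_pdivlMr// mulrC -ltr_pdivlMr.
have k0 := ex_minnP ex; case: k0 => k kP kmin; exists k; split.
  case: k kP kmin => [_ _|k _ kmin]; first by rewrite expr0 divr1.
  by rewrite leNgt; apply/negP => /kmin; rewrite ltnn.
apply: ltW; move: kP; rewrite exprS invfM mulrCA mulrC ltr_pdivlMr//.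
by rewrite mulrC.
Qed.

Section Transfer.
Variable rho : (R -> \bar R) -> \bar R.
Hypothesis Hr : ri_norm rho.
Variables (sg th K c : R).
Hypotheses (sg0 : (0 < sg)%R) (sg1 : (sg < 1)%R) (th0 : (0 < th)%R) (th1 : (th < 1)%R).
Hypothesis Dsg : dilation_norm rho sg = th%:E.
Hypotheses (K0 : (0 < K)%R) (c0 : (0 < c)%R).

(** The condition with [K] stands in for monotonicity: a value of F is controlled by its value at
    any point at most a factor 1/sg to the right. A supremum of F over a half-line is therefore
    controlled by the values on a geometric grid. *)
Lemma boyd_transfer (F l : R -> \bar R) : Mplus F -> distr_like l ->
  (forall x y, (0 < x)%R -> (sg * x <= y)%R -> (y <= x)%R -> F y <= K%:E * F x) ->
  (forall t, (0 < t)%R -> \int[mu]_(s in `]0%R, t]) F s <=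
                          c%:E * \int[mu]_(s in `]0%R, t]) ginv l s) ->
  rho F <= (2 * K * c / (1 - th))%R%:E * rho (ginv l).
Proof.
move=> MF dl HF FI; have Mu := Mplus_ginv l.
have Kc0 : (0 < K * c)%R by rewrite mulr_gt0.
have th10 : (0 < (1 - th)^-1)%R by rewrite invr_gt0 subr_gt0.
have sgk k : (0 < sg ^+ k)%R by exact: exprn_gt0.
have [roo|] := ltP (rho (ginv l)) +oo; last first.
  by rewrite leye_eq => /eqP ->; rewrite gt0_muley ?leey// lte_fin !mulr_gt0.
(* The least nonincreasing majorant of F(sg .); each value F(sg s) with s >= t is
   at most K times a term of the dilation series of F at t. *)
pose a t := ereal_sup [set F (sg * s)%R | s in [set s | (t <= s)%R]].
have ani s t : (0 < s)%R -> (s <= t)%R -> a t <= a s.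
  move=> s0 st; apply: ereal_sup_le => _ [r /= tr <-]; exists r => //=.
  exact: le_trans tr.
have Ma : Mplus a.
  split.
    apply: nonincreasing_emeasurable; first exact: interval_is_interval.
    by move=> s t; rewrite !pos_itvE => s0 _; exact: ani.
  move=> s s0; apply: (@le_trans _ _ (F (sg * s)%R)); first by rewrite MF.2// mulr_gt0.
  by apply: ereal_sup_ubound; exists s => /=.
have MSF := Mplus_dilation_series sg0 MF.
have MSu := Mplus_dilation_series sg0 Mu.
pose b t := (K * c)%:E * dilation_series (ginv l) sg t.
have Mb : Mplus b.
  split; last by move=> s s0; rewrite mule_ge0 ?MSu.2// lee_fin ltW.
  by apply: emeasurable_funM => //; exact: MSu.1.
have bni s t : (0 < s)%R -> (s <= t)%R -> b t <= b s.
  move=> s0 st; apply: lee_wpmul2l; first by rewrite lee_fin ltW.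
  by apply: dilation_series_nonincreasing => // x y _; exact: ginv_nonincreasing.
have aSF t : (0 < t)%R -> a t <= K%:E * dilation_series F sg t.
  move=> t0; apply/ereal_supP => _ [s /= ts <-].
  have [k [ks sk]] := geometric_bracket sg0 sg1 t0 ts.
  apply: (@le_trans _ _ (K%:E * F (t / sg ^+ k)%R)).
    apply: HF => //; first by rewrite divr_gt0.
    by rewrite ler_pM2l.
  apply: lee_wpmul2l; first by rewrite lee_fin ltW.
  exact: dilation_series_ge.
have sub (t : R) : `]0%R, t] `<=` @pos_itv R.
  by move=> z /=; rewrite pos_itvE in_itv/= => /andP[].
have mp := @measurable_pos_itv R.
have ab t : (0 < t)%R ->
    \int[mu]_(s in `]0%R, t]) a s <= \int[mu]_(s in `]0%R, t]) b s.
  move=> t0.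
  apply: (@le_trans _ _ (\int[mu]_(s in `]0%R, t]) (K%:E * dilation_series F sg s))).
    apply: ge0_le_integral => //.
    - by move=> s /sub; rewrite pos_itvE; exact: Ma.2.
    - by apply: measurable_funS Ma.1.
    - by apply: emeasurable_funM => //; apply: measurable_funS MSF.1.
    - by move=> s /sub; rewrite pos_itvE; exact: aSF.
  rewrite ge0_integralZl//; last 3 first.
  - by apply: measurable_funS MSF.1.
  - by move=> s /sub; rewrite pos_itvE; exact: MSF.2.
  - by rewrite lee_fin ltW.
  rewrite /b ge0_integralZl//; last 3 first.
  - by apply: measurable_funS MSu.1.
  - by move=> s /sub; rewrite pos_itvE; exact: MSu.2.
  - by rewrite lee_fin ltW.
  rewrite EFinM -muleA; apply: lee_wpmul2l; first by rewrite lee_fin ltW.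
  (* Termwise, dilation only lengthens the interval to (0, t/sg^k], where the hypothesis on
     integrals applies. *)
  rewrite !integral_dilation_series//.
  have I0 k : 0 <= (sg ^+ k)%:E * \int[mu]_(s in `]0%R, (t / sg ^+ k)%R]) ginv l s.
    apply: mule_ge0; first by rewrite lee_fin ltW.
    by apply: integral_ge0 => s _; exact: ginv_ge0.
  rewrite -nneseriesZl//.
  apply: lee_nneseries => [k _ _|k _].
    apply: mule_ge0; first by rewrite lee_fin ltW.
    apply: integral_ge0 => s /sub.
    by rewrite pos_itvE; exact: MF.2.
  rewrite muleCA; apply: lee_wpmul2l; first by rewrite lee_fin ltW.
  by apply: FI; rewrite divr_gt0.
have rb : rho b <= (K * c / (1 - th))%R%:E * rho (ginv l).
  rewrite /b rho_homog//; last exact: ltW.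
  rewrite [X in _ <= X * _]EFinM -muleA; apply: lee_wpmul2l; first by rewrite lee_fin ltW.
  exact: rho_dilation_series_le.
have rboo : rho b < +oo.
  apply: le_lt_trans rb _; apply: lte_mul_pinfty => //.
  by rewrite lee_fin mulr_ge0// ltW.
have bint t : (0 < t)%R -> \int[mu]_(s in `]0%R, t]) b s < +oo.
  move=> t0; apply: (rho_local Hr) => //.
  by rewrite lebesgue_measure_itv/= lte_fin t0 -EFinD ltry.
have bf s : (0 < s)%R -> b s \is a fin_num.
  move=> s0; rewrite ge0_fin_numE ?Mb.2//.
  have := riemann_sum_le 1 Mb.1 Mb.2 bni s0.
  rewrite big_ord1 mul1r => /le_lt_trans/(_ (bint _ s0)).
  by case: (b s) => [r| |]; rewrite ?ltry ?ltNyr// gt0_muley ?lte_fin.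
have := hardy_littlewood_polya Hr Ma Mb MF ani bni bf ab bint.
move=> /(_ _)/le_trans; apply.
  (* This is why [a] majorizes F(sg s) instead of F(s): the shift from s to s/sg provides the strict
     margin. *)
  move=> s s0; exists (s / sg)%R; first by rewrite ltr_pdivlMr// gtr_pMr.
  by apply: ereal_sup_ubound; exists (s / sg)%R => //=; rewrite mulrC divfK// gt_eqF.
apply: le_trans (leeD rb rb) _.
have h0 : (0 <= K * c / (1 - th))%R by rewrite mulr_ge0 ?(ltW Kc0) ?(ltW th10).
rewrite -ge0_muleDl ?lee_fin// -EFinD.
rewrite le_eqVlt; apply/orP; left; apply/eqP; congr (_%:E * _).
by rewrite -!mulrA mulr_natl mulr2n.
Qed.

End Transfer.

Lemma stmt_ii_iii n : (2 <= n)%N -> stmt_ii R n -> stmt_iii R n.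
Proof.
move=> n2 [c [c0 Hii]] rho Hr /lower_boyd_gt0[sg [th [sg0 sg1 th0 th1 Dsg]]].
have n0 : (0 < n%:R :> R)%R by rewrite ltr0n (leq_trans _ n2).
pose q := (n%:R^-1 : R)%R; have q0 : (0 < q)%R by rewrite invr_gt0.
have q1 : (q <= 1)%R by rewrite invf_le1// ler1n (leq_trans _ n2).
have cn0 : (0 < c * n%:R)%R by exact: mulr_gt0.
(* F is s^(-q-1) times the nondecreasing [tail]. Between sg x and x the power grows by at most
   sg^(-q-1) <= sg^(-2). *)
have K0 : (0 < sg ^- 2)%R by rewrite invr_gt0 exprn_gt0.
exists (2 * sg ^- 2 * (c * n%:R) / (1 - th))%R; split.
  by rewrite divr_gt0 ?subr_gt0// !mulr_gt0.
move=> f cf; have bsf := Cc_bounded_support cf; have [bf _] := bsf.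
have dl := distr_like_lebRn bf.
have dg := distr_like_lebRn (Cc_grad_norm_borel cf).
have FE s : (0 < s)%R -> (s `^ (- q))%:E * (rstarstar f s - rstar f s) =
   (s `^ (- q) * s^-1)%R%:E * tail (distrib (@lebRn R n) (fun x => (f x)%:E)) s.
  move=> s0; rewrite mean_fun_sub//; first by rewrite muleA.
  exact: (bounded_support_rstar_fin bsf (ltW s0)).
rewrite [rstar (grad_norm f)]rearrE.
apply: (boyd_transfer Hr sg0 sg1 th0 th1 Dsg K0 cn0) => //.
- split.
    apply: emeasurable_funM.
      by apply/measurable_EFinP; apply: measurable_funS (measurable_powR _).
    apply: emeasurable_funB; last exact: ginv_measurable.
    by apply: measurable_mean_fun; [exact: ginv_measurable|move=> s _; exact: ginv_ge0].
  move=> s s0; rewrite FE// mule_ge0 ?tail_ge0// lee_fin mulr_ge0 ?powR_ge0//.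
  by rewrite invr_ge0 ltW.
- move=> x y x0 xy yx; have y0 : (0 < y)%R by apply: lt_le_trans xy; rewrite mulr_gt0.
  rewrite !FE// muleA -EFinM.
  apply: (@le_trans _ _ ((sg ^- 2 * (x `^ (- q) * x^-1))%R%:E *
     tail (distrib (@lebRn R n) (fun x => (f x)%:E)) y)).
    apply: lee_wpmul2r; first exact: tail_ge0.
    rewrite lee_fin expr2 invfM mulrACA; apply: ler_pM.
    + exact: powR_ge0.
    + by rewrite invr_ge0 ltW.
    + apply: (@le_trans _ _ ((sg * x) `^ (- q)))%R.
        by apply: powRN_nonincreasing => //; [exact: ltW|rewrite mulr_gt0].
      rewrite powRM ?(ltW sg0) ?(ltW x0)//; apply: ler_wpM2r; first exact: powR_ge0.
      rewrite -powR_inv1 ?(ltW sg0)//.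
      by apply: ger_powR; rewrite ?sg0 ?lerN2// ltW.
    + by rewrite -invfM lef_pV2 ?posrE ?mulr_gt0.
  apply: lee_wpmul2l; last exact: tail_nondecreasing.
  by rewrite lee_fin !mulr_ge0 ?powR_ge0 ?invr_ge0 ?exprn_ge0 ?(ltW sg0) ?(ltW x0).
- by move=> t t0; have := Hii f cf t t0.
Qed.

End BoydTransfer.

(** * The Lorentz embedding *)

Section IntegralNorm.
Local Open Scope ereal_scope.
Context {R : realType}.
Local Notation mu := (@lebesgue_measure R).
Implicit Types (f g h : R -> \bar R).

Definition pos_integral h : \bar R := \int[mu]_(s in @pos_itv R) h s.

Lemma Mplus_on h : Mplus h -> forall s, pos_itv s -> 0 <= h s.
Proof. by move=> [_ h0] s; rewrite pos_itvE; exact: h0. Qed.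

Lemma distr_like_leb_pos h : Mplus h -> distr_like (distrib (@leb_pos R) h).
Proof. by move=> [mh _]; exact: (distr_like_distrib mu measurable_pos_itv mh). Qed.

Lemma pos_integral_rstar_pos h : Mplus h ->
  pos_integral (rstar_pos h) = pos_integral h.
Proof.
move=> Mh; rewrite /pos_integral /rstar_pos rearrE.
rewrite integral_pos_ginv; last exact: distr_like_leb_pos.
rewrite [RHS]layer_cake; last 3 first.
- exact: measurable_pos_itv.
- exact: Mh.1.
- exact: Mplus_on.
apply: eq_integral => y _; rewrite /distrib /leb_pos setIC; congr (mu _).
by apply/seteqP; split => s [sp] /= H; split => //; move: H; rewrite gee0_abs ?Mplus_on.
Qed.

Lemma pos_integral_ri_norm : ri_norm pos_integral.
Proof.
have mp := @measurable_pos_itv R.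
split; first by move=> f Mf; apply: integral_ge0; exact: Mplus_on.
split.
  move=> f Mf; have := ae_eq_integral_abs mu mp Mf.1.
  rewrite (_ : \int[mu]_(x in _) `|f x| = pos_integral f)//.
  by apply: eq_integral => s; rewrite inE => sp; rewrite gee0_abs ?Mplus_on.
split.
  move=> f a Mf a0; apply: ge0_integralZl => //; [exact: Mf.1|exact: Mplus_on].
split.
  move=> f g Mf Mg; rewrite /pos_integral ge0_integralD//;
    [exact: Mplus_on|exact: Mf.1|exact: Mplus_on|exact: Mg.1].
split.
  move=> f g Mf Mg gf; apply: ae_ge0_le_integral => //;
    [exact: Mplus_on|exact: Mg.1|exact: Mplus_on|exact: Mf.1].
split.
  move=> fk f Mfk Mf [N [mN muN HN]].
  have D s : (@pos_itv R `\` N) s -> pos_itv s /\ ((forall k, fk k s <= fk k.+1 s) /\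
      (fun k => fk k s) @ \oo --> f s).
    move=> [sp Ns]; split => //; have [//|nP] := pselect ((forall k, fk k s <= fk k.+1 s) /\
      (fun k => fk k s) @ \oo --> f s).
    by exfalso; apply: Ns; apply: HN => /= /(_ sp).
  have E h : Mplus h -> pos_integral h = \int[mu]_(s in @pos_itv R `\` N) h s.
    move=> Mh; apply: ge0_negligible_integral => //; [exact: Mh.1|exact: Mplus_on].
  rewrite E//; under eq_fun do rewrite E//.
  have -> : \int[mu]_(s in @pos_itv R `\` N) f s =
            \int[mu]_(s in @pos_itv R `\` N) limn (fk^~ s).
    apply: eq_integral => s; rewrite inE => /D[_ [_ fs]].
    by apply/esym; apply/cvg_lim.
  have mD : measurable (@pos_itv R `\` N) by exact: measurableD.
  apply: cvg_monotone_convergence => //.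
  - by move=> k; apply: measurable_funS (Mfk k).1.
  - by move=> k s /D[sp _]; exact: (Mplus_on (Mfk k)).
  - by move=> s /D[_ [fs _]]; exact/nondecreasing_seqP.
split.
  move=> E mE Ep Ef; rewrite /pos_integral integral_indic//.
  by rewrite (setIidl Ep).
split.
  move=> E mE Ep Ef; exists 1%R; split => // f Mf; rewrite mul1e.
  by apply: ge0_subset_integral => //; [exact: Mf.1|exact: Mplus_on].
move=> f g Mf Mg fg; rewrite -pos_integral_rstar_pos// fg.
exact: pos_integral_rstar_pos.
Qed.

(** Compression by 1/2 halves the L^1 norm, so the quotient at s = 1/2 is exactly 1. *)
Lemma lower_boyd_pos_integral : 0 < lower_boyd (@pos_integral).
Proof.
have mp := @measurable_pos_itv R.
have h0 : (0 < 2^-1 :> R)%R by rewrite invr_gt0.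
have dil h : Mplus h -> pos_integral (fun t => rstar_pos h (t / 2^-1)%R) =
    (2^-1)%:E * pos_integral (rstar_pos h).
  move=> Mh; rewrite /pos_integral -ge0_integral_pos_scale//.
  - by apply: eq_integral => s _; rewrite invrK mulrC.
  - exact: ginv_measurable.
  - by move=> s _; exact: ginv_ge0.
(* An admissible function of norm 1, so that the supremum in [dilation_norm] is not over the empty
   set. *)
pose e (s : R) := (\1_(`]0%R, 1%R] : set R) s : R)%:E.
have Me : Mplus e.
  split; last by move=> s _; rewrite lee_fin.
  by apply/measurable_EFinP; apply: measurable_indic.
have re : pos_integral (rstar_pos e) = 1.
  rewrite pos_integral_rstar_pos// /pos_integral integral_indic//.
  rewrite (setIidl _); last by move=> s /=; rewrite pos_itvE in_itv/= => /andP[].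
  by rewrite [LHS]lebesgue_measure_itv0c.
have D : dilation_norm pos_integral 2^-1%R = (2^-1)%:E.
  rewrite /dilation_norm.
  rewrite (_ : [set _ | _ in _] = [set (2^-1)%:E]) ?ereal_sup1//.
  apply/seteqP; split => [_ [h [Mh /andP[r0 roo]] <-]|_ ->] /=.
    rewrite dil//; have rf : pos_integral (rstar_pos h) \is a fin_num by rewrite ge0_fin_numE ?ltW.
    rewrite -(fineK rf) -!EFinM/= mulfK// gt_eqF// -lte_fin fineK//.
  by exists e; rewrite ?dil// re/= ?ltry ?lte01// invr1 !mule1.
have ln2 : (ln 2^-1 < 0 :> R)%R by rewrite ln_lt0// h0/= invf_lt1// ltr1n.
apply: (@lt_le_trans _ _ 1) => //.
apply: ereal_sup_ubound; exists 2^-1%R => /=.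
  by rewrite in_itv/= h0 invf_lt1// ltr1n.
by rewrite D/= divff ?lt_eqF.
Qed.

End IntegralNorm.

(** * The oscillation controls the rearrangement *)

Section HardyOscillation.
Local Open Scope ereal_scope.
Context {R : realType}.
Local Notation mu := (@lebesgue_measure R).

Lemma integral_powR_head (q t : R) : (q < 1)%R -> (0 < t)%R ->
  \int[mu]_(s in `]0%R, t]) (s `^ (- q))%R%:E <= ((1 - q)^-1 * t `^ (1 - q))%R%:E.
Proof.
move=> q1 t0; pose S (i : nat) := `[(t / i.+1%:R)%R, t]%classic.
have ti (i : nat) : (0 < t / i.+1%:R)%R by rewrite divr_gt0.
have SE : `]0%R, t]%classic = \bigcup_i S i.
  apply/seteqP; split => s.
    rewrite /= in_itv/= => /andP[s0 st].
    exists (Num.Def.archi_bound (t / s)) => //; rewrite /S /= in_itv/= st andbT.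
    rewrite ler_pdivrMr// mulrC -ler_pdivrMr//.
    apply: le_trans (ltW (archi_boundP _)) _; first by rewrite divr_ge0// ltW.
    by rewrite ler_nat leqnSn.
  move=> [i _]; rewrite /S /= !in_itv/= => /andP[si ->]; rewrite andbT.
  exact: lt_le_trans si.
have mS i : measurable (S i) by exact: measurable_itv.
have ndS : nondecreasing_seq S.
  move=> i j ij; apply/subsetPset => s; rewrite /S /= !in_itv/= => /andP[is_ ->].
  rewrite andbT; apply: le_trans is_; rewrite ler_pM2l// lef_pV2 ?posrE//.
  by rewrite ler_nat ltnS.
have mk i : measurable_fun (S i) (fun s : R => (s `^ (- q))%R%:E).
  by apply/measurable_EFinP; apply: measurable_funS (measurable_powR _).
have := @ge0_nondecreasing_set_cvg_integral _ (measurableTypeR R) R S (fun s => (s `^ (- q))%R%:E) mu ndS mS mk.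
move=> /(_ (fun i s _ => powR_ge0 _ _)); rewrite -SE => H.
rewrite -(cvg_lim _ H)//; apply: lime_le; first by apply/cvg_ex; eexists; exact: H.
apply: nearW => i.
have tit : (t / i.+1%:R <= t)%R.
  by rewrite ler_pdivrMr// ler_peMr ?(ltW t0)// ler1n.
have p0 : (1 - q != 0)%R by rewrite gt_eqF// subr_gt0.
have := integral_powR p0 (ti i) tit.
have -> : (1 - q - 1 = - q)%R by lra.
move=> ->.
rewrite lee_fin ler_wpM2l ?invr_ge0 ?subr_ge0 ?(ltW q1)//.
by rewrite gerBl powR_ge0.
Qed.

(* Both sides are integrals over the levels y, by Tonelli; at a fixed level the
   two inner integrals are comparable to (l y)^(1-q). *)
Lemma integral_ginv_le_tail (l : R -> \bar R) (q : R) : distr_like l ->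
  (forall y, (0 < y)%R -> l y < +oo) -> (0 < q)%R -> (q <= 2^-1)%R ->
  \int[mu]_(s in @pos_itv R) ((s `^ (- q))%R%:E * ginv l s) <=
  8%:E * \int[mu]_(s in @pos_itv R) ((s `^ (- q - 1))%R%:E * tail l s).
Proof.
move=> dl lf q0 q2; have mp := @measurable_pos_itv R.
have ml := distr_like_measurable dl.
have mpw (r : R) : measurable_fun (@pos_itv R) (fun s : R => (s `^ r)%R%:E).
  by apply/measurable_EFinP; apply: measurable_funS (measurable_powR _).
pose lp := l \_ (@pos_itv R).
have lpE y : (0 < y)%R -> lp y = l y.
  by move=> y0; rewrite /lp patchE mem_set// pos_itvE.
have mlp : measurable_fun setT lp by apply/(measurable_restrictT _ _).1.
have m1 : measurable_fun setT (fun sy : R * R => (sy.1)%:E).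
  by apply/measurable_EFinP; exact: measurable_fst.
have m2 : measurable_fun setT (fun sy : R * R => lp sy.2).
  by apply: measurableT_comp => //; exact: measurable_snd.
pose A := [set sy : R * R | sy.1%:E < lp sy.2].
pose B := [set sy : R * R | lp sy.2 <= sy.1%:E].
have mA : measurable A by rewrite -[A]setTI; exact: measurable_lte.
have mB : measurable B by rewrite -[B]setTI; exact: measurable_lee.
have -> : \int[mu]_(s in @pos_itv R) ((s `^ (- q))%R%:E * ginv l s) =
    \int[mu]_(s in @pos_itv R) ((s `^ (- q))%R%:E *
       \int[mu]_(y in @pos_itv R `&` xsection A s) cst 1 y).
  apply: eq_integral => s; rewrite inE pos_itvE => s0; congr (_ * _).
  rewrite integral_cst; last by apply: measurableI => //; exact: measurable_xsection.
  rewrite mul1e -[LHS](lebesgue_measure_itv_below (ginv_ge0 l s)); congr (mu _).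
  apply/seteqP; split => y /=; rewrite pos_itvE /xsection/= inE /A/= => -[y0];
    by rewrite ?lpE// ginv_gt ?(ltW y0).
have -> : \int[mu]_(s in @pos_itv R) ((s `^ (- q - 1))%R%:E * tail l s) =
    \int[mu]_(s in @pos_itv R) ((s `^ (- q - 1))%R%:E *
       \int[mu]_(y in @pos_itv R `&` xsection B s) l y).
  apply: eq_integral => s; rewrite inE pos_itvE => s0; congr (_ * _).
  congr integral; apply/seteqP; split => y /=; rewrite pos_itvE /xsection/= inE /B/= => -[y0];
    by rewrite lpE.
have k0 (r s : R) : (0 < s)%R -> 0 <= (s `^ r)%R%:E by rewrite lee_fin powR_ge0.
have l0 y : (0 < y)%R -> 0 <= l y by move=> _; exact: dl.1.
rewrite (tonelli_pos (mpw (- q)%R) (measurable_cst 1) (k0 _) (fun _ _ => lee01) mA).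
rewrite (tonelli_pos (mpw (- q - 1)%R) ml (k0 _) l0 mB).
have mAy y : measurable (@pos_itv R `&` ysection A y).
  by apply: measurableI => //; exact: measurable_ysection.
have mBy y : measurable (@pos_itv R `&` ysection B y).
  by apply: measurableI => //; exact: measurable_ysection.
pose I y := \int[mu]_(s in @pos_itv R `&` ysection A y) (s `^ (- q))%R%:E.
pose J y := \int[mu]_(s in @pos_itv R `&` ysection B y) (s `^ (- q - 1))%R%:E.
have I0 y : 0 <= I y by apply: integral_ge0 => s _; rewrite lee_fin powR_ge0.
have J0 y : 0 <= J y by apply: integral_ge0 => s _; rewrite lee_fin powR_ge0.
have mI : measurable_fun (@pos_itv R) I.
  apply: nonincreasing_emeasurable; first exact: interval_is_interval.
  move=> y z; rewrite !pos_itvE => y0 z0 yz.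
  apply: ge0_subset_integral; [exact: mAy|exact: mAy| | |].
  - by apply: measurable_funS (mpw _) => //; exact: subIsetl.
  - by move=> s _; rewrite lee_fin powR_ge0.
  - apply: setIS => s; rewrite /ysection/= !inE /A/= !lpE// => /lt_le_trans; apply.
    exact: dl.2.1.
have mJ : measurable_fun (@pos_itv R) J.
  rewrite (_ : J = -%E \o (fun y => - J y)); last first.
    by apply/funext => y /=; rewrite oppeK.
  apply: measurableT_comp => //.
  apply: nonincreasing_emeasurable; first exact: interval_is_interval.
  move=> y z; rewrite !pos_itvE => y0 z0 yz; rewrite leeN2.
  apply: ge0_subset_integral; [exact: mBy|exact: mBy| | |].
  - by apply: measurable_funS (mpw _) => //; exact: subIsetl.
  - by move=> s _; rewrite lee_fin powR_ge0.
  - apply: setIS => s; rewrite /ysection/= !inE /B/= !lpE// => ls.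
    by apply: le_trans ls; exact: dl.2.1.
rewrite -ge0_integralZl//; last 2 first.
- exact: emeasurable_funM.
- by move=> y _; apply: mule_ge0; [exact: dl.1|exact: J0].
apply: ge0_le_integral => //.
- by move=> y _; rewrite mul1e; exact: I0.
- exact: emeasurable_funM.
- by apply: emeasurable_funM => //; exact: emeasurable_funM.
move=> y; rewrite pos_itvE => y0; rewrite mul1e.
have [r lr] : exists r, l y = r%:E.
  by exists (fine (l y)); rewrite fineK// ge0_fin_numE ?lf// dl.1.
have r0 : (0 <= r)%R by rewrite -lee_fin -lr dl.1.
move: r0; rewrite le_eqVlt => /predU1P[r0|r0].
  rewrite (_ : _ `&` ysection A y = set0).
    by rewrite integral_set0 lr -r0 mul0e mule0.
  apply/seteqP; split => s //= []; rewrite pos_itvE /ysection/= inE /A/= lpE// lr -r0.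
  by move=> s0; rewrite lte_fin ltNge (ltW s0).
have q1 : (q < 1)%R by apply: le_lt_trans q2 _; rewrite invf_lt1// ltr1n.
(* The constant 8 is 2 times 4: 1/(1-q) <= 2 since q <= 1/2, and, on [r,2r] alone, r J(y) >=
   2^(-q-1) r^(1-q) >= r^(1-q)/4. *)
apply: (@le_trans _ _ (2 * r `^ (1 - q))%R%:E).
  apply: (@le_trans _ _ (\int[mu]_(s in `]0%R, r]) (s `^ (- q))%R%:E)).
    apply: ge0_subset_integral; [exact: mAy|exact: measurable_itv| | |].
    - by apply/measurable_EFinP; apply: measurable_funS (measurable_powR _).
    - by move=> s _; rewrite lee_fin powR_ge0.
    - move=> s /= []; rewrite pos_itvE /ysection/= inE /A/= lpE// lr lte_fin in_itv/=.
      by move=> -> /ltW.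
  apply: le_trans (integral_powR_head q1 r0) _.
  rewrite lee_fin ler_wpM2r ?powR_ge0// invf_ple ?posrE ?subr_gt0//; lra.
have rr : (r <= 2 * r)%R by rewrite ler_peMl ?(ltW r0)// ler1n.
have Jr : (r * (2 * r) `^ (- q - 1))%R%:E <= J y.
  apply: (@le_trans _ _ (\int[mu]_(s in `[r, (2 * r)%R]) ((2 * r) `^ (- q - 1))%R%:E)).
    rewrite integral_cst// -[X in _ <= _ * X]/(mu `[r, (2 * r)%R]).
    rewrite lebesgue_measure_itv/= lte_fin ltr_pMl// ltr1n -EFinB -EFinM lee_fin mulrC.
    by rewrite mulr_natl mulr2n addrK.
  apply: (@le_trans _ _ (\int[mu]_(s in `[r, (2 * r)%R]) (s `^ (- q - 1))%R%:E)).
    apply: ge0_le_integral => //.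
    - by move=> s _; rewrite lee_fin powR_ge0.
    - by apply/measurable_EFinP; apply: measurable_funS (measurable_powR _).
    - move=> s; rewrite /= in_itv/= => /andP[rs s2]; rewrite lee_fin -opprD.
      by apply: powRN_nonincreasing => //; [rewrite addr_ge0// ltW|exact: lt_le_trans rs].
  apply: ge0_subset_integral; [exact: measurable_itv|exact: mBy| | |].
  - by apply: measurable_funS (mpw _) => //; exact: subIsetl.
  - by move=> s _; rewrite lee_fin powR_ge0.
  - move=> s /=; rewrite in_itv/= pos_itvE /ysection/= inE /B/= lpE// lr lee_fin.
    by move=> /andP[rs _]; split => //; exact: lt_le_trans rs.
apply: (@le_trans _ _ (8%:E * (r%:E * (r * (2 * r) `^ (- q - 1))%R%:E))); last first.
  by rewrite lr; apply: lee_wpmul2l => //; apply: lee_wpmul2l => //; rewrite lee_fin ltW.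
rewrite -!EFinM lee_fin powRM ?(ltW r0)//.
have -> : (r `^ (1 - q) = r * (r * r `^ (- q - 1)))%R.
  rewrite mulrA -expr2 -powR_mulrn ?(ltW r0)// -powRD; last by rewrite (gt_eqF r0) implybT.
  by congr (_ `^ _)%R; lra.
have two : (4^-1 <= 2 `^ (- q - 1) :> R)%R.
  apply: (@le_trans _ _ (2 `^ (- 2%:R)))%R.
    by rewrite powRN powR_mulrn// expr2 -natrM.
  by apply: ler_powR; [rewrite ler1n|lra].
set X := (r `^ (- q - 1))%R; set Y := (2 `^ _)%R.
have : (0 <= r * (r * X) * (Y - 4^-1))%R by rewrite !mulr_ge0 ?powR_ge0 ?(ltW r0) ?subr_ge0.
lra.
Qed.

End HardyOscillation.

(** * Lower semicontinuity under convergence in L^1 *)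

Section LowerLimits.
Local Open Scope ereal_scope.
Context {R : realType}.
Local Notation mu := (@lebesgue_measure R).
Implicit Types u v : (\bar R)^nat.

Lemma limn_einf_pZl u (c : R) : (0 < c)%R ->
  limn_einf (fun k => c%:E * u k) = c%:E * limn_einf u.
Proof.
move=> c0; rewrite !limn_einf_lim -limeMl//; last exact: is_cvg_einfs.
congr (limn _); apply/funext => k; rewrite /einfs/= -ereal_inf_pZl//.
congr ereal_inf; apply/seteqP; split => [_ [j kj <-]|_ [_ [j kj <-] <-]].
  by exists (u j) => //; exists j.
by exists j.
Qed.

Lemma le_limn_einf u v : (forall k, u k <= v k) -> limn_einf u <= limn_einf v.
Proof.
move=> uv; rewrite !limn_einf_lim; apply: lee_lim; [exact: is_cvg_einfs..|].
apply: nearW => k; apply/ereal_infP => _ [j kj <-].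
by apply: le_trans (uv j); apply: ereal_inf_lbound; exists j.
Qed.

Lemma limn_einf_ge u (a : \bar R) : (\forall k \near \oo, a <= u k) ->
  a <= limn_einf u.
Proof.
move=> [N _ Nu]; rewrite limn_einf_lim; apply: lime_ge; first exact: is_cvg_einfs.
by exists N => // k /= Nk; apply/ereal_infP => _ [j /= kj <-]; apply: Nu => /=; exact: leq_trans kj.
Qed.

(** If |f| > z then |g| > y or |g - f| >= z - y, and Chebyshev bounds the measure of the second
    event. *)
Lemma distrib_le_add n (f g : 'rV[R]_n -> R) (y z : R) : borelRn f -> borelRn g ->
  (y < z)%R -> distrib (@lebRn R n) (fun x => (f x)%:E) z <=
  distrib (@lebRn R n) (fun x => (g x)%:E) y +
  ((z - y)^-1)%:E * intRn (fun x => `|g x - f x|%:E).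
Proof.
move=> bf bg yz; rewrite !distrib_lebRnE// /distrib !setIT.
have bd : borelRn (fun x => g x - f x)%R by exact: measurable_funB.
have bn := borel_norm bd; rewrite intRnE//.
have zy : (0 < z - y)%R by rewrite subr_gt0.
have mn (h : 'rV[R]_n -> R) : borelRn h ->
    measurable_fun setT (fun t : n.-tuple R => `|(h (row_of_tuple t))%:E|).
  by move=> bh; apply: measurableT_comp => //; exact: (borel_EFin bh).
have mS (h : 'rV[R]_n -> R) w : borelRn h ->
    measurable [set t : n.-tuple R | w%:E < `|(h (row_of_tuple t))%:E|].
  move=> bh; rewrite -[X in measurable X]setTI; apply: emeasurable_fun_o_infty => //.
  exact: mn.
pose E := [set t : n.-tuple R | (z - y)%:E <= `|(g (row_of_tuple t) - f (row_of_tuple t))%:E|].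
have mE : measurable E.
  rewrite -[X in measurable X]setTI; apply: emeasurable_fun_c_infty => //.
  exact: (mn _ bd).
apply: (@le_trans _ _ (tuple_leb n
    ([set t | y%:E < `|(g (row_of_tuple t))%:E|] `|` E))).
  apply: le_measure; rewrite ?inE; [exact: mS|by apply: measurableU => //; exact: mS|].
  move=> t /=; rewrite lte_fin => zf.
  have [yg|gy] := ltP y `|g (row_of_tuple t)|%R; [by left; rewrite lte_fin|right].
  rewrite /E/= lee_fin; have := ler_normB (g (row_of_tuple t)) (g (row_of_tuple t) - f (row_of_tuple t))%R.
  by rewrite subKr => H; lra.
apply: le_trans (measureU2 _ (mS g y bg) mE) _.
apply: leeD2l; rewrite lee_pdivlMl//.
have := @le_integral_abse _ _ _ (tuple_leb n) setT measurableT
  (fun t => (g (row_of_tuple t) - f (row_of_tuple t))%:E) (z - y)%R (borel_EFin bd) zy.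
by rewrite setTI.
Qed.

(** If the lower limit were y < f^*(s), right continuity would give z > y with lambda(z) > s. At a
    level w between y and z, [distrib_le_add] then keeps the distribution functions of the
    approximations above s eventually, contradicting the value y. *)
Lemma rstar_le_limn_einf n (f : 'rV[R]_n -> R) (phi : nat -> 'rV[R]_n -> R) s :
  borelRn f -> (forall k, borelRn (phi k)) ->
  (fun k => intRn (fun x => `|phi k x - f x|%:E)) @ \oo --> 0 ->
  rstar f s <= limn_einf (fun k => rstar (phi k) s).
Proof.
move=> bf bphi Hcvg; have dl := distr_like_lebRn bf.
have dlk k := distr_like_lebRn (bphi k).
rewrite leNgt; apply/negP => H.
have L0 : 0 <= limn_einf (fun k => rstar (phi k) s).
  by apply: limn_einf_ge; apply: nearW => k; exact: ginv_ge0.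
have [y yE] : exists y, limn_einf (fun k => rstar (phi k) s) = y%:E.
  move: L0 H; case: (limn_einf _) => [y _ _|_|//]; first by exists y.
  by rewrite ltNge leey.
have y0 : (0 <= y)%R by rewrite -lee_fin -yE.
move: H; rewrite yE /rstar rearrE ginv_gt// => /(dl.2.2 y)[z yz sz].
pose w := ((y + z) / 2)%R.
have yw : (y < w)%R by rewrite /w; lra.
have wz : (w < z)%R by rewrite /w; lra.
suff : w%:E <= y%:E by rewrite lee_fin leNgt yw.
rewrite -yE; apply: limn_einf_ge.
have zw : (0 < z - w)%R by rewrite subr_gt0.
(* A real margin above s, available also when the distribution function is infinite at z. *)
have [e e0 se] : exists2 e, (0 < e)%R & (s + e)%R%:E <=
    distrib (@lebRn R n) (fun x => (f x)%:E) z.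
  move: sz (dl.1 z); case: (distrib _ _ z) => [r|_ _|//].
    by rewrite lte_fin => sr _; exists (r - s)%R; rewrite ?subr_gt0// subrKC.
  by exists 1%R; rewrite ?leey.
have /fine_cvgP[Ffin /cvgrPdist_lt/(_ (e * (z - w))%R)] := Hcvg.
rewrite mulr_gt0// => /(_ isT) Fe.
near=> k.
have If : intRn (fun x => `|phi k x - f x|%:E) \is a fin_num by near: k.
have Ie : (`|0 - fine (intRn (fun x => `|phi k x - f x|%:E))| < e * (z - w))%R by near: k.
apply: ltW; rewrite /rstar rearrE ginv_gt//; last exact: le_trans (ltW yw).
rewrite ltNge; apply/negP => Hs.
have := le_trans se (le_trans (distrib_le_add bf (bphi k) wz) (leeD2r _ Hs)).
rewrite -(fineK If) -EFinM -EFinD lee_fin lerD2l leNgt => /negP; apply.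
rewrite mulrC ltr_pdivrMr//; apply: le_lt_trans Ie.
by rewrite sub0r normrN ler_norm.
Unshelve. all: by end_near. Qed.

End LowerLimits.

Section WeakLimit.
Local Open Scope ereal_scope.
Context {R : realType}.
Local Notation mu := (@lebesgue_measure R).

Lemma measurable_fun_limn_einf d (T : measurableType d) (D : set T)
    (f : (T -> \bar R)^nat) : (forall k, measurable_fun D (f k)) ->
  measurable_fun D (fun x => limn_einf (f ^~ x)).
Proof.
move=> mf; rewrite /limn_einf; apply: measurableT_comp => //.
by apply: measurable_fun_limn_esup => k; exact: measurableT_comp.
Qed.

(** Fatou is used twice: for the average defining f^** and for the outer integral. *)
Lemma lorentz_norm_le_limn_einf n (f : 'rV[R]_n -> R) (phi : nat -> 'rV[R]_n -> R) :
  borelRn f -> (forall k, borelRn (phi k)) ->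
  (fun k => intRn (fun x => `|phi k x - f x|%:E)) @ \oo --> 0 ->
  lorentz_norm f <= limn_einf (fun k => lorentz_norm (phi k)).
Proof.
move=> bf bphi Hcvg; have mp := @measurable_pos_itv R.
have star s : (0 < s)%R -> rstarstar f s <= limn_einf (fun k => rstarstar (phi k) s).
  move=> s0; rewrite /rstarstar /mean_fun limn_einf_pZl ?invr_gt0//.
  apply: lee_wpmul2l; first by rewrite lee_fin invr_ge0 ltW.
  have sub : `]0%R, s] `<=` @pos_itv R.
    by move=> z /=; rewrite pos_itvE in_itv/= => /andP[].
  have mr (h : 'rV[R]_n -> R) : measurable_fun `]0%R, s] (rstar h).
    by apply: measurable_funS (ginv_measurable _) => //.
  apply: le_trans (fatou mu _ _ _) => //; last 2 first.
  - by move=> k; exact: mr.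
  - by move=> k x _; exact: ginv_ge0.
  apply: ge0_le_integral => //.
  - by move=> x _; exact: ginv_ge0.
  - exact: mr.
  - by apply: measurable_fun_limn_einf => k; exact: mr.
  - by move=> x _; exact: rstar_le_limn_einf.
have st0 (h : 'rV[R]_n -> R) s : (0 < s)%R -> 0 <= rstarstar h s.
  by move=> s0; apply: mean_fun_ge0 => // x _; exact: ginv_ge0.
have w0 (s : R) : (0 < s)%R -> (0 < s `^ (1 - n%:R^-1) / s)%R.
  by move=> s0; rewrite divr_gt0// powR_gt0.
have L0 (h : 'rV[R]_n -> R) s : pos_itv s ->
    0 <= rstarstar h s * (s `^ (1 - n%:R^-1) / s)%:E.
  by rewrite pos_itvE => s0; rewrite mule_ge0 ?st0// lee_fin ltW// w0.
rewrite /lorentz_norm.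
apply: le_trans (fatou mu _ _ _) => //; last 2 first.
- by move=> k; exact: measurable_lorentz_integrand.
- by move=> k s; exact: L0.
apply: ge0_le_integral => //.
- by move=> s; exact: L0.
- exact: measurable_lorentz_integrand.
- by apply: measurable_fun_limn_einf => k; exact: measurable_lorentz_integrand.
- move=> s; rewrite /= in_itv/= andbT => s0.
  under [X in limn_einf X]eq_fun do rewrite muleC.
  by rewrite limn_einf_pZl ?w0// muleC; apply: lee_wpmul2l;
    [rewrite lee_fin ltW ?w0|exact: star].
Qed.

(** The error is measured coordinate by coordinate because the approximation in [W011] is. *)
Lemma sqrt_sum_sqr_le n (a b : 'I_n -> R) :
  (Num.sqrt (\sum_i a i ^+ 2) <= Num.sqrt (\sum_i b i ^+ 2) + \sum_i `|a i - b i|)%R.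
Proof.
set B := Num.sqrt (\sum_i b i ^+ 2); set S := (\sum_i `|a i - b i|)%R.
have S0 : (0 <= S)%R by exact: sumr_ge0.
have B0 : (0 <= B)%R by exact: sqrtr_ge0.
have BE : (B ^+ 2 = \sum_i b i ^+ 2)%R.
  by rewrite sqr_sqrtr// sumr_ge0// => i _; exact: sqr_ge0.
have dS i : (`|a i - b i| <= S)%R by rewrite /S (bigD1 i)//= lerDl sumr_ge0.
have bB i : (`|b i| <= B)%R.
  rewrite -sqrtr_sqr /B ler_sqrt ?sumr_ge0// => [|j _]; last exact: sqr_ge0.
  by rewrite (bigD1 i)//= lerDl sumr_ge0// => j _; exact: sqr_ge0.
rewrite -[leRHS]ger0_norm ?addr_ge0// -sqrtr_sqr ler_sqrt ?sqr_ge0//.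
have -> : ((B + S) ^+ 2 = \sum_i (b i ^+ 2 + 2 * B * `|a i - b i| + S * `|a i - b i|))%R.
  by rewrite !big_split/= -!mulr_sumr -/S -BE; ring.
apply: ler_sum => i _.
have := bB i; have := dS i; have := normr_ge0 (a i - b i)%R.
set d := `|a i - b i|%R => d0 dS' bB'.
have d2 : (d ^+ 2 = (a i - b i) ^+ 2)%R by rewrite real_normK// num_real.
have bd : (b i * (a i - b i) <= B * d)%R.
  by apply: le_trans (ler_norm _) _; rewrite normrM ler_wpM2r.
have dd : (d ^+ 2 <= S * d)%R by rewrite expr2 ler_wpM2r.
have -> : (a i ^+ 2 = b i ^+ 2 + 2 * (b i * (a i - b i)) + (a i - b i) ^+ 2)%R by ring.
by rewrite -d2; lra.
Qed.

Lemma borel_vec_norm n (g : 'I_n -> 'rV[R]_n -> R) : (forall i, borelRn (g i)) ->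
  borelRn (vec_norm g).
Proof.
move=> bg; rewrite /borelRn /vec_norm.
apply: (measurableT_comp (f := @Num.sqrt R)).
  by apply: continuous_measurable_fun; exact: sqrt_continuous.
by apply: measurable_sum => i; apply: measurable_funX; exact: bg.
Qed.

Lemma intRn_grad_norm_le n (f : 'rV[R]_n -> R) (g : 'I_n -> 'rV[R]_n -> R) :
  Cc_infty f -> (forall i, borelRn (g i)) ->
  intRn (fun x => (grad_norm f x)%:E) <= intRn (fun x => (vec_norm g x)%:E) +
    \sum_(i < n) intRn (fun x => `|pderiv i f x - g i x|%:E).
Proof.
move=> cf bg; have bf := Cc_grad_norm_borel cf.
have bp i : borelRn (pderiv i f).
  by apply: continuous_borel; exact: smooth_continuous (smooth_pderiv i cf.1).
have bd i : borelRn (fun x => pderiv i f x - g i x)%R.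
  by apply: measurable_funB; [exact: bp|exact: bg].
have bn i := borel_norm (bd i); have bv := borel_vec_norm bg.
have v0 x : (0 <= vec_norm g x)%R by exact: sqrtr_ge0.
under eq_bigr do rewrite intRnE//.
rewrite !intRnE//; last by move=> x; exact: grad_norm_ge0.
rewrite -ge0_integral_sum//; last by move=> i; exact: (borel_EFin (bn i)).
rewrite -ge0_integralD//; last 4 first.
- by move=> t _; rewrite lee_fin.
- exact: (borel_EFin bv).
- by move=> t _; apply: sume_ge0 => i _; rewrite lee_fin.
- by apply: emeasurable_sum => i; exact: (borel_EFin (bn i)).
apply: ge0_le_integral => //.
- by move=> t _; rewrite lee_fin grad_norm_ge0.
- exact: (borel_EFin bf).
- apply: emeasurable_funD; first exact: (borel_EFin bv).
  by apply: emeasurable_sum => i; exact: (borel_EFin (bn i)).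
- by move=> t _; rewrite sumEFin -EFinD lee_fin; exact: sqrt_sum_sqr_le.
Qed.

Lemma lorentz_norm_Cc_le n (f : 'rV[R]_n -> R) : (2 <= n)%N -> Cc_infty f ->
  lorentz_norm f <= 9%:E *
    pos_integral (fun s => (s `^ (- n%:R^-1))%R%:E * (rstarstar f s - rstar f s)).
Proof.
move=> n2 cf; have bsf := Cc_bounded_support cf; have [bf _] := bsf.
have dl := distr_like_lebRn bf; set l := distrib _ _ in dl.
have n0 : (0 < n%:R :> R)%R by rewrite ltr0n (leq_trans _ n2).
have mp := @measurable_pos_itv R.
pose q := (n%:R^-1 : R)%R; have q0 : (0 < q)%R by rewrite invr_gt0.
have q2 : (q <= 2^-1)%R by rewrite lef_pV2 ?posrE// ler_nat.
have lf y : (0 < y)%R -> l y < +oo.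
  by move=> y0; apply: bounded_support_distrib => //; exact: ltW.
have mpw (r : R) : measurable_fun (@pos_itv R) (fun s : R => (s `^ r)%R%:E).
  by apply/measurable_EFinP; apply: measurable_funS (measurable_powR _).
have ff s : (0 < s)%R -> rstar f s \is a fin_num.
  by move=> s0; exact: (bounded_support_rstar_fin bsf (ltW s0)).
have DE : pos_integral (fun s => (s `^ (- q))%R%:E * (rstarstar f s - rstar f s)) =
    \int[mu]_(s in @pos_itv R) ((s `^ (- q - 1))%R%:E * tail l s).
  apply: eq_integral => s; rewrite inE pos_itvE => s0.
  rewrite mean_fun_sub ?ff// muleA -EFinM; congr (_%:E * _).
  by rewrite powRD ?(gt_eqF s0) ?implybT// powR_inv1// ltW.
have F0 s : pos_itv s -> 0 <= (s `^ (- q))%R%:E * (rstarstar f s - rstar f s).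
  rewrite pos_itvE => s0; rewrite mean_fun_sub ?ff// !mule_ge0 ?tail_ge0//.
    by rewrite lee_fin powR_ge0.
  by rewrite lee_fin invr_ge0 ltW.
have mF : measurable_fun (@pos_itv R)
    (fun s => (s `^ (- q))%R%:E * (rstarstar f s - rstar f s)).
  apply: emeasurable_funM => //; apply: emeasurable_funB; last exact: ginv_measurable.
  by apply: measurable_mean_fun; [exact: ginv_measurable|move=> s _; exact: ginv_ge0].
have -> : lorentz_norm f = \int[mu]_(s in @pos_itv R)
    ((s `^ (- q))%R%:E * (rstarstar f s - rstar f s) + (s `^ (- q))%R%:E * rstar f s).
  apply: eq_integral => s; rewrite inE/= in_itv/= andbT => s0.
  rewrite powR_subV// muleC -ge0_muleDr ?ginv_ge0 ?subeK ?ff//.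
  by rewrite mean_fun_sub ?ff// mule_ge0 ?tail_ge0// lee_fin invr_ge0 ltW.
rewrite ge0_integralD//; last 2 first.
- by move=> s _; rewrite mule_ge0 ?lee_fin ?powR_ge0 ?ginv_ge0.
- by apply: emeasurable_funM; [exact: mpw|exact: ginv_measurable].
have I0 : 0 <= pos_integral (fun s => (s `^ (- q))%R%:E * (rstarstar f s - rstar f s)).
  by apply: integral_ge0 => s; exact: F0.
(* The constant 9 is 1 + 8: f^** is the oscillation plus f^*, and the latter costs 8
   oscillations. *)
apply: le_trans (leeD2l _ (integral_ginv_le_tail dl lf q0 q2)) _.
rewrite -DE -/q; set X := pos_integral _ in I0 *.
by rewrite -[X in X + _ <= _]mul1e -ge0_muleDl ?lee_fin// -EFinD.
Qed.

Lemma stmt_iii_iv n : (2 <= n)%N -> stmt_iii R n -> stmt_iv R n.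
Proof.
move=> n2 Hiii.
have [C [C0 HC]] := Hiii _ pos_integral_ri_norm (lower_boyd_pos_integral).
exists (9 * C)%R; split; first by rewrite mulr_gt0.
have Hphi (f : 'rV[R]_n -> R) : Cc_infty f ->
    lorentz_norm f <= (9 * C)%R%:E * intRn (fun x => (grad_norm f x)%:E).
  move=> cf; apply: le_trans (lorentz_norm_Cc_le n2 cf) _.
  rewrite EFinM -muleA; apply: lee_wpmul2l => //.
  apply: le_trans (HC f cf) _; rewrite /pos_integral integral_rstar//.
    exact: Cc_grad_norm_borel.
  by move=> x; exact: grad_norm_ge0.
move=> f g [bf [bg [phi [cphi [fcvg gcvg]]]]].
have bphi k := Cc_borel (cphi k).
apply: le_trans (lorentz_norm_le_limn_einf bf bphi fcvg) _.
set G := intRn _; pose d k := \sum_(i < n) intRn (fun x => `|pderiv i (phi k) x - g i x|%:E).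
have d0 : d @ \oo --> 0.
  rewrite (_ : 0 = \sum_(i < n) 0); last by rewrite big1.
  apply: cvg_nnesum => i _; last exact: gcvg.
  apply: nearW => k; rewrite intRnE//.
    by apply: integral_ge0.
  apply: borel_norm; apply: measurable_funB; last exact: bg.
  by apply: continuous_borel; exact: smooth_continuous (smooth_pderiv i (cphi k).1).
have le k : lorentz_norm (phi k) <= (9 * C)%R%:E * (G + d k).
  apply: le_trans (Hphi _ (cphi k)) _; apply: lee_wpmul2l.
    by rewrite lee_fin mulr_ge0// ltW.
  exact: intRn_grad_norm_le.
apply: le_trans (le_limn_einf le) _.
have H : (fun k => (9 * C)%R%:E * (G + d k)) @ \oo --> (9 * C)%R%:E * (G + 0).
  apply: cvgeZl => //; apply: cvgeD => //; last exact: cvg_cst.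
  by rewrite fin_num_adde_defl.
by rewrite (cvg_limn_einf_sup H).1 adde0.
Qed.

End WeakLimit.

Theorem theorem1p1 (R : realType) (n : nat) : (2 <= n)%N ->
  (stmt_i R n <-> stmt_ii R n) /\ (stmt_ii R n <-> stmt_iii R n) /\
  (stmt_iii R n <-> stmt_iv R n).
Proof.
move=> n2; have i_ii := @stmt_i_ii R n n2; have ii_iii := @stmt_ii_iii R n n2.
by have iii_iv := @stmt_iii_iv R n n2; have iv_i := @stmt_iv_i R n n2; tauto.
Qed.
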